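(* Let $n\ge 0$, let $\mathcal{P}_n$ be the set of plane permutations of size $n$ and $\mathcal{B}_n$ the set of plane bipolar posets with $n+2$ vertices. The mapping $\Phi$ (dominance diagram of the completed permutation) is a bijection from $\mathcal{P}_n$ to $\mathcal{B}_n$. Its inverse is $\Psi$.
   Context: Plane bipolar posets: a planar map is a connected multigraph embedded on the oriented sphere, up to orientation-preserving homeomorphism; it is rooted if a corner is marked; the vertex and face at this corner are the root vertex and the root (outer) face. A plane bipolar orientation is a rooted planar map (with at least one edge) endowed with an acyclic orientation having a unique source $S$, which is the root vertex, and a unique sink $N$, incident to the outer face; it is drawn in the plane with $S$ at the bottom and $N$ at the top. It is known that at each non-pole vertex the ingoing edges are consecutive and the outgoing edges are consecutive, so that they are each ordered from left to right. An edge $e=(u,v)$ is transitive if there is a directed path from $u$ to $v$ avoiding $e$. A plane bipolar poset is a plane bipolar orientation with no transitive edge. Plane permutations: a permutation $\pi$ of $\{1,\dots,n\}$ is plane if it avoids the vincular pattern $2\,\underline{14}\,3$, i.e., there are no indices $i<j<j+1<k$ with $\pi(j)<\pi(i)<\pi(k)<\pi(j+1)$. A permutation is identified with its set of points $(i,\pi(i))$. The dominance order on points is $(x,y)\le(x',y')$ iff $x\le x'$ and $y\le y'$. The dominance diagram is obtained by drawing a segment $(p,p')$ for each pair of points such that $p'$ covers $p$ in this poset. It is known that a permutation is plane iff its dominance diagram is crossing-free. The completion $\overline{\pi}$ of $\pi$ is the permutation of $\{0,\dots,n+1\}$ with $\overline\pi(0)=0$, $\overline\pi(n+1)=n+1$,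 $\overline\pi(i)=\pi(i)$ for $1\le i\le n$; it is plane if $\pi$ is. Mapping $\Phi$: for $\pi\in\mathcal{P}_n$, $\Phi(\pi)\in\mathcal{B}_n$ is the plane bipolar poset underlying the dominance diagram of $\overline\pi$, with edges oriented from the dominated to the dominating point, $S=(0,0)$ and $N=(n+1,n+1)$. Mapping $\Psi$: for $B\in\mathcal{B}_n$ with set $I$ of non-pole vertices, the left tree $T_\ell$ (resp. right tree $T_r$) is the spanning tree of $I\cup\{S\}$, rooted at $S$, where the parent-edge of every $v\in I$ is its leftmost (resp. rightmost) ingoing edge. For $v\in I$, $x(v)\in\{1,\dots,n\}$ is the rank of $v$ for the order of first visit in a clockwise tour around $T_r$ (starting at $S$ from the left outer side), and $y(v)\in\{1,\dots,n\}$ is the rank of $v$ for the order of first visit in a counterclockwise tour around $T_\ell$ (starting at $S$ from the right outer side). $\Psi(B)$ is the permutation with point set $\{(x(v),y(v)):v\in I\}$. *)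

(* Defs.v *)
From mathcomp Require Import all_boot all_order all_algebra all_fingroup.

Set Implicit Arguments.
Unset Strict Implicit.
Unset Printing Implicit Defensive.

(* Permutations of {1, ..., n} are elements of 'S_n, whose indices and values
   run over {0, ..., n-1}; the point of index i is (i + 1, s i + 1). *)

Definition plane_perm n (s : 'S_n) : bool :=
  [forall i : 'I_n, forall j : 'I_n, forall j' : 'I_n, forall k : 'I_n,
    [&& i < j, (j' : nat) == j.+1 & j' < k] ==>
    ~~ [&& s j < s i, s i < s k & s k < s j']].

Definition perm_points n (s : 'S_n) : seq (nat * nat) :=
  [seq ((i : nat).+1, (s i : nat).+1) | i : 'I_n].

(* The completion lives on {0, ..., n+1}: [lift ord0] shifts {0, ..., n-1} to
   {1, ..., n} and [lift ord_max] adds the new maximum (cf. completion_inner). *)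
Definition completion n (s : 'S_n) : 'S_n.+2 :=
  lift_perm ord_max ord_max (lift_perm ord0 ord0 s).

Lemma completion0 n (s : 'S_n) : completion s ord0 = ord0.
Proof.
have -> : ord0 = lift ord_max (ord0 : 'I_n.+1) by apply: val_inj.
by rewrite /completion lift_perm_lift lift_perm_id.
Qed.

Lemma completion_max n (s : 'S_n) : completion s ord_max = ord_max.
Proof. by rewrite /completion lift_perm_id. Qed.

Lemma completion_inner n (s : 'S_n) (i : 'I_n) :
  completion s (lift ord_max (lift ord0 i)) = lift ord_max (lift ord0 (s i)).
Proof. by rewrite /completion !lift_perm_lift. Qed.

(* A rooted map with oriented edges, as a rotation system.  A dart is a
   half-edge: [src d] is the vertex it is attached to, [twin d] the other half of
   its edge, [turn d] the next dart counterclockwise around [src d], and [out d]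
   says that the edge of [d] is oriented from [src d] to [src (twin d)].  A dart
   [d] also stands for the corner between [d] and the dart before it in
   counterclockwise order, i.e. the corner to the right of [d] seen from
   [src d]; [root_dart] is the marked corner in this sense. *)
Record rooted_map := RootedMap {
  vertex : finType;
  dart : finType;
  src : dart -> vertex;
  twin : dart -> dart;
  turn : dart -> dart;
  root_dart : dart;
  out : pred dart }.

(* Maps are considered up to orientation-preserving homeomorphism, i.e. up to
   isomorphism of rotation systems. *)
Definition map_iso (M M' : rooted_map) : Prop :=
  exists (fv : vertex M -> vertex M') (fd : dart M -> dart M'),
    [/\ bijective fv, bijective fd & fd (root_dart M) = root_dart M'] /\
    [/\ forall d, src (fd d) = fv (src d),
        forall d, twin (fd d) = fd (twin d),
        forall d, turn (fd d) = fd (turn d)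
      & forall d, out (fd d) = out d].

Section Notions.
Variable M : rooted_map.

Definition tgt (d : dart M) : vertex M := src (twin d).

Definition adjacent (u v : vertex M) : bool :=
  [exists d : dart M, (src d == u) && (tgt d == v)].

Definition connected_map : Prop :=
  [/\ involutive (@twin M),
      forall d : dart M, twin d != d,
      injective (@turn M),
      forall d d' : dart M, fconnect (@turn M) d d' = (src d == src d')
    & forall u v : vertex M, connect adjacent u v].

(* The face to the right of [d] is the orbit of [d] under [face]: after [d], the
   next edge having this face on its right is the one following [twin d] in
   counterclockwise order around [tgt d]. *)
Definition face (d : dart M) : dart M := turn (twin d).

Definition euler_planar : Prop :=
  (#|vertex M| + fcard face (dart M) = #|dart M|./2 + 2)%N.

Definition arc_avoiding (A : pred (dart M)) (u v : vertex M) : bool :=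
  [exists d : dart M, [&& out d, ~~ A d, src d == u & tgt d == v]].

Definition arc : rel (vertex M) := arc_avoiding pred0.

Definition is_orientation : Prop := forall d : dart M, out (twin d) = ~~ out d.

Definition acyclic : Prop :=
  forall d : dart M, out d -> ~~ connect arc (tgt d) (src d).

Definition source (v : vertex M) : bool :=
  [forall d : dart M, (src d == v) ==> out d].

Definition sink (v : vertex M) : bool :=
  [forall d : dart M, (src d == v) ==> ~~ out d].

Definition transitive_edge (e : dart M) : bool :=
  out e && connect (arc_avoiding (pred1 e)) (src e) (tgt e).

Definition on_outer_face (v : vertex M) : Prop :=
  exists2 d : dart M, fconnect face (root_dart M) d & src d = v.

(* "At least one edge" is automatic, [root_dart M] being a dart. *)
Definition plane_bipolar_orientation : Prop :=
  [/\ connected_map, euler_planar, is_orientation & acyclic] /\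
  (forall v, source v <-> v = src (root_dart M)) /\
  (exists N, (forall v, sink v <-> v = N) /\ on_outer_face N).

Definition plane_bipolar_poset (n : nat) : Prop :=
  [/\ plane_bipolar_orientation,
      forall e : dart M, ~~ transitive_edge e
    & #|vertex M| = n.+2].

Definition inner (v : vertex M) : bool := ~~ source v && ~~ sink v.

(* With sources at the bottom, the counterclockwise order around a non-pole
   vertex lists the outgoing edges from right to left, then the ingoing edges
   from left to right. *)
Definition rightmost_in (d : dart M) : bool := ~~ out d && out (turn d).
Definition leftmost_in (d : dart M) : bool :=
  ~~ out d && out (finv (@turn M) d).

Definition right_tree (d : dart M) : bool :=
  let parent_edge e := inner (src e) && rightmost_in e in
  parent_edge d || parent_edge (twin d).

Definition left_tree (d : dart M) : bool :=
  let parent_edge e := inner (src e) && leftmost_in e in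
  parent_edge d || parent_edge (twin d).

(* Tours around a tree given by its set T of darts, moving from corner to corner.
   From a corner, a tour meets the next dart around the vertex: it walks along
   its edge if this is a tree edge, and otherwise goes past it.
   Counterclockwise, the dart met from the corner d is d itself and the walker
   stays on the right of the edges; clockwise, it is the dart before d. *)
Definition ccw_step (T : pred (dart M)) (d : dart M) : dart M :=
  if T d then turn (twin d) else turn d.

Definition cw_step (T : pred (dart M)) (d : dart M) : dart M :=
  let e := finv (@turn M) d in if T e then twin e else e.

Definition tour_vertices (step : dart M -> dart M) : seq (vertex M) :=
  [seq src d | d <- fingraph.orbit step (root_dart M)].

(* [index] returns the position of the first occurrence. *)
Definition visit_rank (step : dart M -> dart M) (v : vertex M) : nat :=
  let tour := tour_vertices step in
  #|[set u | inner u & index u tour <= index v tour]|.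

Definition xcoord : vertex M -> nat := visit_rank (cw_step right_tree).
Definition ycoord : vertex M -> nat := visit_rank (ccw_step left_tree).

End Notions.

(* [None] if the points of M are not those of a permutation of size n. *)
Definition Psi n (M : rooted_map) : option 'S_n :=
  [pick s : 'S_n |
    perm_eq (perm_points s) [seq (xcoord v, ycoord v) | v in @inner M]].

(* The dominance diagram of a permutation of {0, ..., m-1}; the point
   (i, s i) is identified with i. *)
Section Diagram.
Variables (m : nat) (s : 'S_m).
Implicit Types i j k : 'I_m.

Definition dominated i j : bool := (i <= j) && (s i <= s j).

Definition covered_by i j : bool :=
  [&& i != j, dominated i j &
      [forall k, dominated i k && dominated k j ==> (k == i) || (k == j)]].

Definition diag_dart : finType :=
  {d : 'I_m * 'I_m | covered_by d.1 d.2 || covered_by d.2 d.1}.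

Definition diag_src (d : diag_dart) : 'I_m := (val d).1.
Definition diag_out (d : diag_dart) : bool := covered_by (val d).1 (val d).2.

Lemma diag_twin_subproof (d : diag_dart) :
  covered_by (val d).2 (val d).1 || covered_by (val d).1 (val d).2.
Proof. by rewrite orbC; exact: (valP d). Qed.

Definition diag_twin (d : diag_dart) : diag_dart :=
  exist _ ((val d).2, (val d).1) (diag_twin_subproof d).

Local Open Scope ring_scope.
Definition diag_dx (d : diag_dart) : int :=
  (val d).2%:Z - (val d).1%:Z.
Definition diag_dy (d : diag_dart) : int :=
  (s (val d).2)%:Z - (s (val d).1)%:Z.

(* Comparison of the arguments in [0, 2 pi[ of the direction vectors of the
   segments (never horizontal): first by half-plane, then by cross product. *)
Definition angle_le (d e : diag_dart) : bool :=
  let upper c := 0 < diag_dy c in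
  (upper d && ~~ upper e) ||
  ((upper d == upper e) &&
     (0 <= diag_dx d * diag_dy e - diag_dy d * diag_dx e)).
Local Close Scope ring_scope.

Definition darts_at i : seq diag_dart :=
  sort angle_le [seq d <- enum diag_dart | diag_src d == i].

Definition diag_turn (d : diag_dart) : diag_dart :=
  next (darts_at (diag_src d)) d.

End Diagram.

Lemma diag_root_subproof n (s : 'S_n) (t := completion s)
  (j := (t^-1 : 'S_n.+2)%g (lift ord0 ord0)) :
  covered_by t ord0 j || covered_by t j ord0.
Proof.
have tj : t j = lift ord0 ord0 by rewrite permKV.
have t0 : t ord0 = ord0 by apply: completion0.
have n0j : ord0 != j.
  by apply/eqP => e; move: tj; rewrite -e t0 => /(congr1 val).
apply/orP; left; apply/and3P; split=> //; first by rewrite /dominated t0.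
apply/forallP => k; apply/implyP => /andP[_ /andP[_]]; rewrite tj => tk.
case: (posnP (t k)) => [k0|kpos].
  by apply/orP; left; apply/eqP/(@perm_inj _ t)/val_inj; rewrite t0.
apply/orP; right; apply/eqP/(@perm_inj _ t)/val_inj/eqP.
by rewrite tj eqn_leq tk kpos.
Qed.

(* All segments at (0, 0) have their argument in ]0, pi/2[, so the corner of the
   outer face there is the one before the first dart in increasing argument.
   The first argument of [head] is a default value, never used as the list is
   not empty. *)
Definition Phi n (s : 'S_n) : rooted_map :=
  let t := completion s in
  @RootedMap 'I_n.+2 (diag_dart t) (@diag_src _ t) (@diag_twin _ t) (@diag_turn _ t)
    (head (exist _ (_, _) (diag_root_subproof s)) (darts_at t ord0))
    (@diag_out _ t).

(* Main.v *)
Require Import Defs.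
From mathcomp Require Import all_boot order ssralg ssrnum ssrint all_fingroup zify.

Set Implicit Arguments.
Unset Strict Implicit.
Unset Printing Implicit Defensive.

(* On a rotation system with an acyclic orientation having one source and one
   sink, every non-pole vertex has a corner where the orientation changes and
   every face has a corner with two outgoing edges. Euler's formula says exactly
   that there is one of each (per sense of turning), so planarity becomes a local
   statement: edges at a vertex form two runs, and faces have one bottom and one
   top corner.

   From a plane bipolar poset to a permutation: the edges leaving a down-closed
   set of vertices form a list, the cut, ordered by crossing faces from left to
   right; the edges entering a next available vertex are consecutive in it and
   get replaced by the outgoing ones. The relative order of two edges is the same
   in all cuts containing them, so two incomparable vertices are either left or
   right of each other. A tour of the right tree always discovers the vertex of
   the first cut edge that is a rightmost ingoing edge; hence it visits u before v
   if u is below or to the left of v. Symmetrically for the left tree, so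
   reachability is dominance of the coordinates, and the pattern 2 14 3 is
   excluded because it would make two edges change sides.

   From a plane permutation to a map: two segments of the diagram meeting a
   vertical line are ordered in the same way by both of their ends. Two segments
   that are adjacent on a line remain so when the line moves to the left, until
   they start at a common point; so the face below each top corner has a single
   bottom corner, and counting these corners gives Euler's formula. The same
   vertical lines are cuts sorted by height, which makes the first coordinate
   computed by the tour agree with the original one. *)

(** * Corner counting *)

(** A rotation system has no geometry: left and right must come out of Euler's formula, a mere
    count. If [I] is the set of non-pole vertices, the formula reads [#|I| + F = E], the two poles
    absorbing the constant 2. Each edge owns the corner just before its outgoing dart, which lies
    either between two outgoing darts or at a change of orientation; corners of the first kind meet
    all faces, those of the second all of [I], so equality leaves none to spare. A tour mixes
    discoveries and returns, so it is followed through the set of visited vertices: this set stays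
    down-closed, and the walker has passed a prefix of its cut without a parent edge, so that the
    next parent edge met is the first of the whole cut. The left tour is a mirror image; rather than
    reflecting maps, the sweep is done over abstract lists and used again with reversed cuts. *)

Section Rises.
Variables (T : finType) (f : T -> T) (P : pred T).
Hypothesis f_inj : injective f.

Definition rise x := P x && ~~ P (finv f x).

(** Without any rise, [~~ P] would propagate from [y] to the whole cycle. *)
Lemma rise_exists x y :
  fconnect f x y -> P x -> ~~ P y -> exists2 z, fconnect f x z & rise z.
Proof.
move=> xy Px Py.
case: (pickP [pred z | fconnect f x z && rise z]) => [z /andP[]|no]; first by exists z.
suff: ~~ P x by rewrite Px.
have /iter_findex <- : fconnect f y x by rewrite fconnect_sym.
elim: (findex _ _ _) => //= k IH; apply/negP => Pk.
have := no (f (iter k f y)); rewrite /= /rise Pk finv_f // IH andbT.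
by rewrite -iterS (connect_trans xy) ?fconnect_iter.
Qed.

Hypothesis rise_uniq : forall x y, fconnect f x y -> rise x -> rise y -> x = y.

Lemma rise_run r a b : rise r -> a <= b -> b < fingraph.order f r ->
  ~~ P (iter a f r) -> ~~ P (iter b f r).
Proof.
move=> rr; elim: b => [|b IH]; first by rewrite leqn0 => /eqP->.
rewrite leq_eqVlt => /predU1P[->//|ab] bo Pa.
have Pb := IH ab (ltnW bo) Pa.
apply/negP => Pb'; have rb : rise (iter b.+1 f r) by rewrite /rise Pb' finv_f.
have e := rise_uniq (fconnect_iter f b.+1 r) rr rb.
by have := findex_iter bo; rewrite -e findex0.
Qed.

(** With a single rise per cycle, the points outside [P] form one arc, so one of any two of them
    leads to the other inside this arc. *)
Lemma rise_chain x y : fconnect f x y -> ~~ P x -> ~~ P y ->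
  (exists k, iter k f x = y /\ forall i, i <= k -> ~~ P (iter i f x)) \/
  (exists k, iter k f y = x /\ forall i, i <= k -> ~~ P (iter i f y)).
Proof.
move=> xy Px Py.
case: (pickP [pred z | fconnect f x z && P z]) => [z /andP[xz Pz]|no]; last first.
  left; exists (findex f x y); split; first exact: iter_findex.
  by move=> i _; have := no (iter i f x); rewrite /= fconnect_iter /= => ->.
have zx : fconnect f z x by rewrite fconnect_sym.
have [r zr rr] := rise_exists zx Pz Px.
have rx : fconnect f r x by rewrite fconnect_sym // (connect_trans xz).
have ry : fconnect f r y by rewrite (connect_trans rx).
have := findex_max rx; have := findex_max ry.
have := iter_findex rx; have := iter_findex ry.
move: (findex f r x) (findex f r y) => a b eb ea bo ao.
wlog ab : x y a b {xy xz zx rx ry} Px Py eb ea bo ao / a <= b => [W|].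
  have [ab|ba] := leqP a b; first exact: (W x y a b).
  by case: (W y x b a) => //; [exact: ltnW|right|left].
left; exists (b - a); rewrite -ea -iterD subnK //; split=> // i ib.
rewrite -iterD; apply: (@rise_run r a) => //; first exact: leq_addl.
  by apply: leq_ltn_trans bo; lia.
by rewrite ea.
Qed.
End Rises.

Section Corners.
Variable M : rooted_map.
Hypothesis twinK : involutive (@twin M).
Hypothesis turn_inj : injective (@turn M).
Hypothesis turn_src : forall d d' : dart M, fconnect (@turn M) d d' = (src d == src d').
Let cw := finv (@turn M).

Lemma face_inj : injective (@face M).
Proof. by move=> d d' /turn_inj /(can_inj twinK). Qed.

Lemma finv_face d : finv (@face M) d = twin (cw d).
Proof.
have {1}-> : d = face (twin (cw d)) by rewrite /face twinK f_finv.
by rewrite finv_f //; apply: face_inj.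
Qed.

Lemma src_turn (d : dart M) : src (turn d) = src d.
Proof. by apply/eqP; rewrite eq_sym -turn_src fconnect1. Qed.

Variables (P : pred (dart M)) (I : {set vertex M}).
Hypothesis euler : #|vertex M| + fcard (@face M) (dart M) = #|dart M|./2 + 2.
Hypothesis cardI : #|vertex M| = #|I| + 2.
Hypothesis P_twin : forall d, P (twin d) = ~~ P d.
Hypothesis P_face : forall d : dart M,
  exists x y, [/\ fconnect (@face M) d x, fconnect (@face M) d y, P x & ~~ P y].
Hypothesis P_vertex : forall v, v \in I ->
  exists x y, [/\ src x = v, src y = v, P x & ~~ P y].

Lemma card_half : #|dart M|./2 = #|P|.
Proof.
have e : #|[predC P]| = #|P|.
  rewrite -(card_image (can_inj twinK) P); apply: eq_card => d.
  rewrite inE /=; apply/idP/imageP => [Pd|[x Px ->]].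
    by exists (twin d); rewrite ?twinK // unfold_in P_twin.
  by rewrite unfold_in /=; move: Px; rewrite unfold_in => Px; rewrite P_twin Px.
have := cardC P; rewrite e => <-; by rewrite addnn doubleK.
Qed.

Let same := [set d | P d && P (cw d)].
Let chg := [set d | P d && ~~ P (cw d)].

(** By [finv_face], a rise of [P] along a face is a dart of [same], while a rise around a vertex is
    one of [chg]. So [same] meets all faces and [chg] all vertices of [I]; as Euler's formula gives
    [#|same| + #|chg| = F + #|I|], nothing can be met twice. *)
Lemma corner_unique :
  {in same &, injective (froot (@face M))} /\
  {in chg &, injective (@src M)}.
Proof.
have sumE : #|same| + #|chg| = #|P|.
  rewrite -(cardID (mem same) P); congr (_ + _); apply: eq_card => d;
    rewrite !inE -?topredE /=; by case: (P d); rewrite ?andbT ?andbF.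
have F_le : fcard (@face M) (dart M) <= #|froot (@face M) @: same|.
  apply: subset_leq_card; apply/subsetP => x; rewrite !inE => /andP[/eqP xr _].
  have [y [z [xy xz Py Pz]]] := P_face x.
  have yz : fconnect (@face M) y z.
    by rewrite (connect_trans _ xz) // fconnect_sym //; apply: face_inj.
  have [c yc] := rise_exists face_inj yz Py Pz.
  rewrite /rise finv_face P_twin negbK => cs; apply/imsetP; exists c; first by rewrite inE.
  rewrite -xr; apply/rootP; first exact: fconnect_sym face_inj.
  by rewrite (connect_trans xy).
have I_sub : I \subset (@src M) @: chg.
  apply/subsetP => v /P_vertex[x [y [xv yv Px Py]]].
  have xy : fconnect (@turn M) x y by rewrite turn_src xv yv.
  have [c xc cc] := rise_exists turn_inj xy Px Py.
  apply/imsetP; exists c; first by rewrite inE.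
  by move: xc; rewrite turn_src xv => /eqP.
have I_le := subset_leq_card I_sub.
have le1 := leq_imset_card (froot (@face M)) same.
have le2 := leq_imset_card (@src M) chg.
move: euler; rewrite card_half -sumE cardI => E.
by split; apply/imset_injP; apply/eqP; lia.
Qed.
End Corners.

(** * Reachability and corners in a plane bipolar poset *)

Section Bipolar.
Variables (n : nat) (M : rooted_map).
Hypothesis HM : plane_bipolar_poset M n.

Definition south : vertex M := src (root_dart M).
Definition north : vertex M := odflt south [pick v | sink v].
Definition le : rel (vertex M) := connect (@Defs.arc M).
Definition cw : dart M -> dart M := finv (@turn M).
Definition face_of : dart M -> dart M := froot (@face M).
Definition outer : dart M := face_of (root_dart M).

Lemma twinK : involutive (@twin M). Proof. by case: HM => [[[[]]]]. Qed.
Lemma twin_inj : injective (@twin M). Proof. exact: can_inj twinK. Qed.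
Lemma turn_inj : injective (@turn M). Proof. by case: HM => [[[[]]]]. Qed.
Lemma turn_fconnect (d d' : dart M) : fconnect (@turn M) d d' = (src d == src d').
Proof. by case: HM => [[[[]]]]. Qed.
Lemma out_twin (d : dart M) : out (twin d) = ~~ out d.
Proof. by case: HM => [[[]]]. Qed.
Lemma acyclicM : acyclic M. Proof. by case: HM => [[[]]]. Qed.

Lemma tgt_twin (d : dart M) : tgt (twin d) = src d.
Proof. by rewrite /tgt twinK. Qed.

Lemma turnK : cancel (@turn M) cw. Proof. exact: finv_f turn_inj. Qed.
Lemma cwK : cancel cw (@turn M). Proof. exact: f_finv turn_inj. Qed.
Lemma srcT (d : dart M) : src (turn d) = src d.
Proof. exact: src_turn turn_fconnect d. Qed.
Lemma srcC (d : dart M) : src (cw d) = src d.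
Proof. by rewrite -[in RHS](cwK d) srcT. Qed.
Lemma src_face (d : dart M) : src (face d) = tgt d.
Proof. by rewrite /face srcT. Qed.
Lemma faceI : injective (@face M). Proof. exact: face_inj twinK turn_inj. Qed.

Lemma face_ofP (d e : dart M) : reflect (face_of d = face_of e) (fconnect (@face M) d e).
Proof. by apply: rootP; apply: fconnect_sym faceI. Qed.
Lemma face_of_face (d : dart M) : face_of (face d) = face_of d.
Proof. by apply/face_ofP; rewrite fconnect_sym ?fconnect1 //; apply: faceI. Qed.
Lemma face_of_turn (d : dart M) : face_of (turn d) = face_of (twin d).
Proof. by rewrite -[RHS]face_of_face /face twinK. Qed.

Lemma sourceE v : source v = (v == south).
Proof.
by case: HM => [[_ [h _]]] _ _; apply/idP/eqP => [/h|/h].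
Qed.

Lemma north_props : (forall v, sink v <-> v = north) /\ on_outer_face north.
Proof.
case: HM => [[_ [_ [N [hN oN]]]]] _ _.
suff -> : north = N by [].
rewrite /north; case: pickP => [v /hN -> //|/(_ N)].
by have /hN -> : N = N by [].
Qed.

Lemma sinkE v : sink v = (v == north).
Proof. by case: north_props => h _; apply/idP/eqP => [/h|/h]. Qed.

Lemma outS (d : dart M) : src d = south -> out d.
Proof.
move=> e; have : source south by rewrite sourceE.
by move/forallP/(_ d); rewrite e eqxx.
Qed.
Lemma outN (d : dart M) : src d = north -> out d = false.
Proof.
move=> e; have : sink north by rewrite sinkE.
by move/forallP/(_ d); rewrite e eqxx => /negbTE.
Qed.
Lemma south_neq_north : south != north.
Proof. by apply/eqP => e; have := outS (erefl south); rewrite outN. Qed.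
Lemma innerE v : inner v = (v != south) && (v != north).
Proof. by rewrite /inner sourceE sinkE. Qed.
Lemma inS v : v != south -> exists2 d : dart M, src d = v & ~~ out d.
Proof.
rewrite -sourceE => /forallPn[d]; rewrite negb_imply => /andP[/eqP sd od].
by exists d.
Qed.
Lemma inN v : v != north -> exists2 d : dart M, src d = v & out d.
Proof.
rewrite -sinkE => /forallPn[d]; rewrite negb_imply negbK => /andP[/eqP sd od].
by exists d.
Qed.

Lemma le_arc (d : dart M) : out d -> le (src d) (tgt d).
Proof.
by move=> od; apply/connect1/existsP; exists d; rewrite od !eqxx.
Qed.
Lemma le_trans u v w : le u v -> le v w -> le u w.
Proof. exact: connect_trans. Qed.
Lemma le_refl u : le u u. Proof. exact: connect0. Qed.

Lemma arcP u v : reflect (exists d : dart M, [/\ out d, src d = u & tgt d = v]) (Defs.arc u v).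
Proof.
apply: (iffP existsP) => [[d /and4P[od _ /eqP ? /eqP ?]]|[d [od <- <-]]]; exists d => //.
by rewrite od !eqxx.
Qed.

Lemma le_first u v : le u v -> u != v ->
  exists d : dart M, [/\ out d, src d = u & le (tgt d) v].
Proof.
case/connectP => [[|w p] /=]; first by move=> _ ->; rewrite eqxx.
case/andP=> /arcP[d [od sd td]] pw ev _; exists d; split=> //.
by rewrite td; apply/connectP; exists p.
Qed.

Lemma le_last u v : le u v -> u != v ->
  exists d : dart M, [/\ out d, tgt d = v & le u (src d)].
Proof.
case/connectP => p; case/lastP: p => [|p w] /=; first by move=> _ ->; rewrite eqxx.
rewrite rcons_path last_rcons => /andP[pw /arcP[d [od sd td]]] ev _; exists d.
by split; rewrite ?ev // sd; apply/connectP; exists p.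
Qed.

Lemma le_anti u v : le u v -> le v u -> u = v.
Proof.
move=> uv vu; apply/eqP/negPn/negP => /(le_first uv)[d [od sd dv]].
by have := acyclicM od; rewrite sd [connect _ _ _](le_trans dv vu).
Qed.

Lemma arc_lt (d : dart M) : out d -> ~~ le (tgt d) (src d).
Proof. exact: acyclicM. Qed.
Lemma arc_neq (d : dart M) : out d -> src d != tgt d.
Proof. by move=> od; apply: contraNneq (arc_lt od) => ->; apply: le_refl. Qed.

Lemma min_exists (A : {set vertex M}) x : x \in A ->
  exists2 y, y \in A & forall d : dart M, out d -> tgt d = y -> src d \notin A.
Proof.
move=> xA; case: (arg_minnP (fun y => #|[set w | le w y]|) xA) => y yA ymin.
exists y => // d od td; apply/negP => dA; have := ymin _ dA; rewrite leqNgt => /negP; apply.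
apply: proper_card; apply/properP; split.
  by apply/subsetP => w; rewrite !inE => wd; rewrite (le_trans wd) // -td le_arc.
by exists y; rewrite inE ?le_refl // -td arc_lt.
Qed.

Lemma max_exists (A : {set vertex M}) x : x \in A ->
  exists2 y, y \in A & forall d : dart M, out d -> src d = y -> tgt d \notin A.
Proof.
move=> xA; case: (arg_minnP (fun y => #|[set w | le y w]|) xA) => y yA ymin.
exists y => // d od sd; apply/negP => dA; have := ymin _ dA; rewrite leqNgt => /negP; apply.
apply: proper_card; apply/properP; split.
  by apply/subsetP => w; rewrite !inE => dw; rewrite (le_trans _ dw) // -sd le_arc.
by exists y; rewrite inE ?le_refl // -sd arc_lt.
Qed.

Lemma le_south v : le south v.
Proof.
apply/negPn/negP => nv.
have [|y] := @min_exists [set w | ~~ le south w] v; first by rewrite inE.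
rewrite inE => ny ymin; have [|d sd od] := @inS y.
  by apply: contraNneq ny => ->; apply: le_refl.
have td : out (twin d) by rewrite out_twin.
have := ymin _ td; rewrite tgt_twin sd => /(_ erefl); rewrite inE negbK => h.
by case/negP: ny; rewrite (le_trans h) // -sd -(tgt_twin d) le_arc.
Qed.

Lemma le_north v : le v north.
Proof.
apply/negPn/negP => nv.
have [|y] := @max_exists [set w | ~~ le w north] v; first by rewrite inE.
rewrite inE => ny ymax; have [|d sd od] := @inN y.
  by apply: contraNneq ny => ->; apply: le_refl.
have := ymax _ od; rewrite sd => /(_ erefl); rewrite inE negbK => h.
by case/negP: ny; rewrite (le_trans _ h) // -sd le_arc.
Qed.

Lemma not_transitive (d : dart M) : out d ->
  ~~ connect (arc_avoiding (pred1 d)) (src d) (tgt d).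
Proof. by case: HM => _ /(_ d); rewrite /transitive_edge => + _ od; rewrite od. Qed.

Lemma arc_inj (d e : dart M) :
  out d -> out e -> src d = src e -> tgt d = tgt e -> d = e.
Proof.
move=> od oe sde tde; apply/eqP/negPn/negP => de; case/negP: (not_transitive od).
by apply/connect1/existsP; exists e; rewrite oe /= eq_sym de sde tde !eqxx.
Qed.

Lemma le_avoiding (d : dart M) a b : le a b -> ~~ (le a (src d) && le (tgt d) b) ->
  connect (arc_avoiding (pred1 d)) a b.
Proof.
case/connectP => p; elim: p a => [a _ -> _|x p IH a /= /andP[/arcP[e [oe se te]] px eb] nd].
  exact: connect0.
have ax : le a x by rewrite -se -te le_arc.
have xb : le x b by apply/connectP; exists p.
apply: connect_trans (IH x px eb _); last first.
  by apply: contra nd => /andP[xd ->]; rewrite (le_trans ax).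
apply/connect1/existsP; exists e; rewrite oe se te !eqxx /= andbT.
by apply: contra nd => /eqP <-; rewrite se te le_refl.
Qed.

(** A vertex strictly between the ends would split a path into two halves which avoid [d] by
    antisymmetry, making [d] transitive. So arcs are covers of the reachability order. *)
Lemma arc_cover (d : dart M) w : out d -> le (src d) w -> le w (tgt d) ->
  w = src d \/ w = tgt d.
Proof.
move=> od dw wd; have [->|ws] := eqVneq w (src d); first by left.
have [->|wt] := eqVneq w (tgt d); first by right.
case/negP: (not_transitive od); apply: (@connect_trans _ _ w); apply: le_avoiding => //.
  by apply: contra wt => /andP[_ dw']; apply/eqP/le_anti.
by apply: contra ws => /andP[wd' _]; apply/eqP/le_anti.
Qed.

Lemma arcs_incomparable (d e : dart M) : out d -> out e -> d != e ->
  src d = src e -> ~~ le (tgt d) (tgt e).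
Proof.
move=> od oe de se; apply/negP => h.
have := @arc_cover e (tgt d) oe; rewrite -se le_arc // => /(_ isT h) [] e1.
  by have := arc_neq od; rewrite e1 eqxx.
by case/eqP: de; apply: arc_inj.
Qed.

Lemma arcs_incomparable_in (d e : dart M) : out d -> out e -> d != e ->
  tgt d = tgt e -> ~~ le (src d) (src e).
Proof.
move=> od oe de te; apply/negP => h.
have := @arc_cover d (src e) od; rewrite te le_arc // => /(_ h isT) [] e1.
  by case/eqP: de; apply: arc_inj.
by have := arc_neq oe; rewrite e1 eqxx.
Qed.

Lemma face_descends k (d : dart M) :
  (forall i, i < k -> ~~ out (iter i (@face M) d)) -> le (src (iter k (@face M) d)) (src d).
Proof.
elim: k => [|k IH] h; first exact: le_refl.
rewrite iterS src_face; apply: le_trans (IH _) => [|i ik]; last by apply/h/ltnW.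
rewrite -(tgt_twin (iter k _ d)) /= le_arc // out_twin; exact: h.
Qed.

Lemma face_ascends k (d : dart M) :
  (forall i, i < k -> out (iter i (@face M) d)) -> le (src d) (src (iter k (@face M) d)).
Proof.
elim: k => [|k IH] h; first exact: le_refl.
rewrite iterS src_face; apply: le_trans (IH _) _ => [i ik|]; first by apply/h/ltnW.
by apply: le_arc; apply: h.
Qed.

(** A face whose darts all have the same orientation would be a directed cycle. *)
Lemma face_mixed (d : dart M) :
  (exists2 x, fconnect (@face M) d x & out x) /\ (exists2 y, fconnect (@face M) d y & ~~ out y).
Proof.
have back : iter (findex (@face M) (face d) d) (@face M) (face d) = d.
  by apply: iter_findex; rewrite fconnect_sym ?fconnect1 //; apply: faceI.
split.
  case: (pickP [pred x | fconnect (@face M) d x && out x]) => [x /andP[]|no]; first by exists x.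
  have h i : ~~ out (iter i (@face M) d).
    by have := no (iter i (@face M) d); rewrite /= fconnect_iter /= => ->.
  have := @face_descends (findex (@face M) (face d) d) (face d).
  rewrite back src_face -(tgt_twin d) => g; have ot : out (twin d) by rewrite out_twin; apply: (h 0).
  case/negP: (arc_lt ot); apply: g => i _; rewrite -iterSr; exact: h.
case: (pickP [pred x | fconnect (@face M) d x && ~~ out x]) => [x /andP[]|no]; first by exists x.
have h i : out (iter i (@face M) d).
  by have := no (iter i (@face M) d); rewrite /= fconnect_iter /= => /negPn.
have := @face_ascends (findex (@face M) (face d) d) (face d).
rewrite back src_face => g; case/negP: (arc_lt (h 0)); apply: g => i _.
rewrite -iterSr; exact: h.
Qed.

Lemma card_inner : #|vertex M| = #|[set v : vertex M | inner v]| + 2.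
Proof.
rewrite -(cardsC [set v : vertex M | inner v]); congr (_ + _).
have -> : ~: [set v : vertex M | inner v] = [set south; north].
  by apply/setP => v; rewrite !inE innerE negb_and !negbK.
by rewrite cards2 south_neq_north.
Qed.

Lemma card_innerE : #|[set v : vertex M | inner v]| = n.
Proof. by have := card_inner; case: HM => _ _ ->; lia. Qed.

Lemma eulerM : #|vertex M| + fcard (@face M) (dart M) = #|dart M|./2 + 2.
Proof. by case: HM => [[[]]]. Qed.

Lemma corner_out_unique :
  {in [set d | out d && out (cw d)] &, injective face_of} /\
  {in [set d | out d && ~~ out (cw d)] &, injective (@src M)}.
Proof.
have [d|v|hf hv] := @corner_unique M twinK turn_inj turn_fconnect (@out M)
    [set v | inner v] eulerM card_inner out_twin.
- by have [[x ? ?] [y ? ?]] := face_mixed d; exists x, y.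
- rewrite inE innerE => /andP[/inS[y]] ? ? /inN[x] ? ?.
  by exists x, y.
by split; [apply: hf|apply: hv].
Qed.
Lemma corner_in_unique :
  {in [set d | ~~ out d && ~~ out (cw d)] &, injective face_of} /\
  {in [set d | ~~ out d && out (cw d)] &, injective (@src M)}.
Proof.
have [|d|v|hf hv] := @corner_unique M twinK turn_inj turn_fconnect (predC (@out M))
    [set v | inner v] eulerM card_inner.
- by move=> d; rewrite /= out_twin.
- by have [[x ? ?] [y ? ?]] := face_mixed d; exists y, x; rewrite /= negbK.
- rewrite inE innerE => /andP[/inS[y]] ? ? /inN[x] ? ?.
  by exists y, x; rewrite /= negbK.
split; first exact: hf.
move=> c d; rewrite !inE => hc hd; apply: hv; by rewrite inE /= negbK.
Qed.

(** In the names of the four rules that start here, the first letter is the orientation of the dart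
    and the second that of the dart clockwise before it: [oo] is a bottom corner of a face, [ii] a
    top corner, [oi] and [io] are the two changes of orientation at a vertex. *)
Lemma oo_unique (c d : dart M) :
  out c -> out (cw c) -> out d -> out (cw d) -> face_of c = face_of d -> c = d.
Proof.
by move=> ? ? ? ?; case: corner_out_unique => /(_ c d) + _; apply; rewrite inE; apply/andP.
Qed.
Lemma oi_unique (c d : dart M) :
  out c -> ~~ out (cw c) -> out d -> ~~ out (cw d) -> src c = src d -> c = d.
Proof.
by move=> ? ? ? ?; case: corner_out_unique => _ /(_ c d); apply; rewrite inE; apply/andP.
Qed.
Lemma ii_unique (c d : dart M) :
  ~~ out c -> ~~ out (cw c) -> ~~ out d -> ~~ out (cw d) -> face_of c = face_of d -> c = d.
Proof.
by move=> ? ? ? ?; case: corner_in_unique => /(_ c d) + _; apply; rewrite inE; apply/andP.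
Qed.
Lemma io_unique (c d : dart M) :
  ~~ out c -> out (cw c) -> ~~ out d -> out (cw d) -> src c = src d -> c = d.
Proof.
by move=> ? ? ? ?; case: corner_in_unique => _ /(_ c d); apply; rewrite inE; apply/andP.
Qed.

Definition cut (U : {set vertex M}) : pred (dart M) :=
  fun d => [&& out d, src d \in U & tgt d \notin U].

Definition down (U : {set vertex M}) :=
  [/\ south \in U, north \notin U & forall d : dart M, out d -> tgt d \in U -> src d \in U].

Lemma down_le U u v : down U -> le u v -> v \in U -> u \in U.
Proof.
case=> _ _ dU /connectP[p]; elim: p u => [u _ -> //|w p IH u /= /andP[/arcP[d [od <- td]] pw] ev vU].
by apply: dU => //; rewrite td; apply: IH vU.
Qed.

Lemma finv_faceE d : finv (@face M) d = twin (cw d).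
Proof. exact: finv_face twinK turn_inj d. Qed.

(* The edges having a given face on their left form a directed path, which
   leaves a down-closed set at most once. *)
Lemma cut_left_unique U (d e : dart M) : down U -> cut U d -> cut U e ->
  face_of (twin d) = face_of (twin e) -> d = e.
Proof.
move=> dU cd ce /face_ofP f.
have uniq x y : fconnect (@face M) x y -> rise (@face M) (@out M) x ->
    rise (@face M) (@out M) y -> x = y.
  rewrite /rise !finv_faceE !out_twin !negbK => /face_ofP xy /andP[? ?] /andP[? ?].
  exact: oo_unique.
have aux x y : cut U x -> cut U y ->
    (exists k, iter k (@face M) (twin x) = twin y /\
      forall i, i <= k -> ~~ out (iter i (@face M) (twin x))) -> x = y.
  case/and3P=> ox sx tx /and3P[oy sy ty] [[|k] [ek hk]]; first exact: twin_inj ek.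
  (* The walk descends from [src x], which is in [U], to [tgt y], which is not. *)
  have := @face_descends k (face (twin x)); rewrite -iterSr ek src_face tgt_twin => h.
  case/negP: ty; apply: (down_le dU _ sx); apply: h => i ik.
  by rewrite -iterSr; apply: hk; apply: ltnW.
have od : ~~ out (twin d) by rewrite out_twin negbK; case/and3P: cd.
have oe : ~~ out (twin e) by rewrite out_twin negbK; case/and3P: ce.
case: (rise_chain faceI uniq f od oe) => h; first exact: aux h.
by symmetry; apply: aux h.
Qed.

End Bipolar.

Lemma filter_split (T : Type) (P : pred T) (s : seq T) :
  pairwise (fun x y => ~~ P x ==> ~~ P y) s -> s = filter P s ++ filter (predC P) s.
Proof.
elim: s => //= x s IH /andP[xs /IH e].
case Px: (P x) => /=; first by rewrite -e.
suff h : all (predC P) s.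
  have /all_filterP -> := h.
  have /eqP/size0nil -> // : size (filter P s) == 0.
  by rewrite size_filter -leqn0 leqNgt -has_count; move: h; rewrite all_predC.
by apply: sub_all xs => y; rewrite Px.
Qed.

(** * Rotations and cuts *)

Section Rotation.
Variables (n : nat) (M : rooted_map).
Hypothesis HM : plane_bipolar_poset M n.
Notation S := (south M).
Notation N := (north M).
Notation turn := (@turn M).

(* The rotation at a vertex is read from its leftmost ingoing edge; at the poles,
   this means starting from the outer face. *)
Definition lm (v : vertex M) : dart M :=
  odflt (root_dart M) [pick d : dart M | (src d == v) &&
    (if v == S then d == root_dart M else
     if v == N then face_of d == outer M else ~~ out d && out (cw d))].

Lemma lm_pick v : (exists d : dart M, (src d == v) &&
    (if v == S then d == root_dart M else
     if v == N then face_of d == outer M else ~~ out d && out (cw d))) ->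
  (src (lm v) == v) && (if v == S then lm v == root_dart M else
     if v == N then face_of (lm v) == outer M else ~~ out (lm v) && out (cw (lm v))).
Proof. by rewrite /lm; case: pickP => //= h [d]; rewrite h. Qed.

Lemma lm_spec v :
  (src (lm v) == v) && (if v == S then lm v == root_dart M else
     if v == N then face_of (lm v) == outer M else ~~ out (lm v) && out (cw (lm v))).
Proof.
apply: lm_pick; have [->|vS] := eqVneq v S.
  by exists (root_dart M); rewrite !eqxx.
have [->|vN] := eqVneq v N.
  have [_ [d rd sd]] := north_props HM; exists d; rewrite sd eqxx /=.
  by apply/eqP/(face_ofP HM); rewrite fconnect_sym //; apply: faceI HM.
have [x sx ox] := inS HM vS; have [y sy oy] := inN HM vN.
have xy : fconnect turn x y by rewrite (turn_fconnect HM) sx sy.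
have [|z xz /andP[iz oz]] := @rise_exists _ turn (predC (@out M)) (turn_inj HM) x y xy ox.
  by rewrite /= negbK.
exists z; move: xz; rewrite (turn_fconnect HM) sx eq_sym => -> /=.
by move: iz oz; rewrite /= negbK => -> ->.
Qed.

Lemma src_lm v : src (lm v) = v.
Proof. by case/andP: (lm_spec v) => /eqP. Qed.
Lemma lmS : lm S = root_dart M.
Proof. by case/andP: (lm_spec S) => _; rewrite eqxx => /eqP. Qed.
Lemma lmN : face_of (lm N) = outer M.
Proof.
by case/andP: (lm_spec N) => _; rewrite eq_sym (negPf (south_neq_north HM)) eqxx => /eqP.
Qed.
Lemma lm_inner v : inner v -> ~~ out (lm v) && out (cw (lm v)).
Proof.
rewrite (innerE HM) => /andP[vS vN]; case/andP: (lm_spec v) => _.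
by rewrite (negPf vS) (negPf vN).
Qed.

Definition rotation v := fingraph.orbit turn (lm v).
(** [ins] and [es] list the ingoing edges from left to right, as darts at [v] and as darts at their
    lower ends. [rouT] lists the outgoing edges from right to left, as met counterclockwise, and
    [outs] from left to right, as they appear in a cut. *)
Definition ins v := [seq d <- rotation v | ~~ out d].
Definition rouT v := [seq d <- rotation v | out d].
Definition es v := [seq twin d | d <- ins v].
Definition outs v := rev (rouT v).

Lemma mem_rotation v d : (d \in rotation v) = (src d == v).
Proof. by rewrite -fconnect_orbit (turn_fconnect HM) src_lm eq_sym. Qed.
Lemma uniq_rotation v : uniq (rotation v). Proof. exact: orbit_uniq. Qed.
Lemma cycle_rotation v : fcycle turn (rotation v). Proof. exact: cycle_orbit (turn_inj HM) _. Qed.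
Lemma mem_ins v d : (d \in ins v) = ~~ out d && (src d == v).
Proof. by rewrite mem_filter mem_rotation. Qed.
Lemma mem_rouT v d : (d \in rouT v) = out d && (src d == v).
Proof. by rewrite mem_filter mem_rotation. Qed.
Lemma mem_outs v d : (d \in outs v) = out d && (src d == v).
Proof. by rewrite mem_rev mem_rouT. Qed.
Lemma mem_es v d : (d \in es v) = out d && (tgt d == v).
Proof.
apply/mapP/andP => [[x + ->]|[od td]].
  by rewrite mem_ins => /andP[ox sx]; rewrite (out_twin HM) (tgt_twin HM).
by exists (twin d); rewrite ?mem_ins ?(out_twin HM) ?negbK ?od ?(twinK HM).
Qed.
Lemma uniq_ins v : uniq (ins v). Proof. by rewrite filter_uniq ?uniq_rotation. Qed.
Lemma uniq_rouT v : uniq (rouT v). Proof. by rewrite filter_uniq ?uniq_rotation. Qed.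
Lemma uniq_outs v : uniq (outs v). Proof. by rewrite rev_uniq uniq_rouT. Qed.
Lemma uniq_es v : uniq (es v).
Proof. by rewrite map_inj_uniq ?uniq_ins //; apply: twin_inj HM. Qed.

Lemma insS : ins S = [::].
Proof.
apply/eqP; rewrite -[_ == _]negbK -has_filter; apply/hasPn => d.
by rewrite mem_rotation => /eqP /(outS HM) ->.
Qed.
Lemma rouTN : rouT N = [::].
Proof.
apply/eqP; rewrite -[_ == _]negbK -has_filter; apply/hasPn => d.
by rewrite mem_rotation => /eqP /(outN HM) ->.
Qed.
Lemma rouTS : rouT S = rotation S.
Proof. by apply/all_filterP/allP => d; rewrite mem_rotation => /eqP /(outS HM). Qed.
Lemma insN : ins N = rotation N.
Proof. by apply/all_filterP/allP => d; rewrite mem_rotation => /eqP /(outN HM) ->. Qed.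

(** At a non-pole vertex, [lm v] is the only rise of [predC out], so no ingoing dart can follow an
    outgoing one; at a pole one of the two lists is empty. *)
Lemma rotationE v : rotation v = ins v ++ rouT v.
Proof.
have [->|vS] := eqVneq v S; first by rewrite insS rouTS.
have [->|vN] := eqVneq v N; first by rewrite rouTN insN cats0.
have vi : inner v by rewrite (innerE HM) vS.
have -> : rouT v = filter (predC (predC (@out M))) (rotation v).
  by apply: eq_filter => d /=; rewrite negbK.
apply: filter_split; apply/(pairwiseP (lm v)) => i j.
rewrite !inE size_orbit => io jo ij; rewrite /rotation /fingraph.orbit !nth_traject //; apply/implyP.
apply: (@rise_run _ _ (predC (@out M)) (turn_inj HM)) (ltnW ij) jo => [x y xy|].
  move=> /andP[/= ix ox] /andP[/= iy oy]; apply: (io_unique HM) => //.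
  - by rewrite negbK in ox.
  - by rewrite negbK in oy.
  by apply/eqP; rewrite -(turn_fconnect HM).
by have := lm_inner vi; rewrite /rise /= negbK.
Qed.

(** [g] is the face to the left of the first edge and [h] the face to the right of the last one: an
    outgoing dart [e] has [face_of e] on its right and [face_of (twin e)] on its left. *)
Fixpoint chain (g : dart M) (l : seq (dart M)) (h : dart M) : bool :=
  if l is e :: l' then (face_of (twin e) == g) && chain (face_of e) l' h else g == h.

Lemma chain_catP g l1 l2 h :
  reflect (exists2 m, chain g l1 m & chain m l2 h) (chain g (l1 ++ l2) h).
Proof.
apply: (iffP idP) => [|[m]].
  elim: l1 g => [|e l1 IH] g /=; first by exists g.
  by case/andP=> -> /IH.
by elim: l1 g => [|e l1 IH] g /=; [move/eqP-> | case/andP=> -> /IH h1 /h1].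
Qed.

Lemma chain_end g l h h' : chain g l h -> chain g l h' -> h = h'.
Proof.
by elim: l g => [|e l IH] g /=; [move=> /eqP <- /eqP | case/andP=> _ /IH h1 /andP[_ /h1]].
Qed.

Lemma chain_es x s : fpath turn x s ->
  chain (face_of x) [seq twin d | d <- belast x s] (face_of (last x s)).
Proof.
elim: s x => [|y s IH] x /=; first by rewrite eqxx.
case/andP=> /eqP <- /IH; rewrite (twinK HM) eqxx /=.
by rewrite [face_of (turn x)](face_of_turn HM).
Qed.

Lemma chain_outs x s : fpath turn x s ->
  chain (face_of (last x s)) (rev (belast x s)) (face_of x).
Proof.
elim: s x => [|y s IH] x /=; first by rewrite eqxx.
case/andP=> /eqP <- /IH c; rewrite rev_cons -cats1; apply/chain_catP.
by exists (face_of (turn x)) => //=; rewrite (face_of_turn HM) !eqxx.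
Qed.

Lemma ins_nil v : v != S -> exists d s, ins v = d :: s /\ d = lm v.
Proof.
move=> vS; have : exists d, d \in ins v.
  by have [d sd od] := inS HM vS; exists d; rewrite mem_ins od sd eqxx.
have := rotationE v; rewrite /rotation /fingraph.orbit -orderSpred /=.
by case: (ins v) => [|d s] e [x] // _; exists d, s; case: e.
Qed.

Lemma rouT_nil v : v != N -> exists d s, rouT v = d :: s.
Proof.
move=> vN; have [d sd od] := inN HM vN.
have : d \in rouT v by rewrite mem_rouT od sd eqxx.
by case: (rouT v) => // x s _; exists x, s.
Qed.

(** Both fans of [v] run from the face at its left corner to the face at its right corner, hence one
    can replace the other inside a longer chain. *)
Lemma es_outs_chain v g h : inner v -> chain g (es v) h -> chain g (outs v) h.
Proof.
rewrite (innerE HM) => /andP[/ins_nil[x [s [ei ex]]] /rouT_nil[y [t eo]]].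
have := cycle_rotation v; rewrite rotationE ei eo /= rcons_cat cat_path /=.
case/and3P=> p1 /eqP p2 p3.
have c1 : chain (face_of x) (es v) (face_of y).
  have : fpath turn x (rcons s y) by rewrite rcons_path p1 /=; apply/eqP.
  by move/chain_es; rewrite /es ei belast_rcons last_rcons.
have c2 : chain (face_of x) (outs v) (face_of y).
  by move/chain_outs: p3; rewrite belast_rcons last_rcons /outs eo.
move=> c; have eg : g = face_of x.
  by move: c; rewrite /es ei /= (twinK HM) => /andP[/eqP].
by rewrite eg in c *; rewrite (chain_end c c1).
Qed.

Lemma chain_outsS : chain (outer M) (outs S) (outer M).
Proof.
have := cycle_rotation S; rewrite /outs rouTS /rotation /fingraph.orbit -orderSpred /=.
by move/chain_outs; rewrite belast_rcons last_rcons lmS.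
Qed.

Lemma chain_esN : chain (outer M) (es N) (outer M).
Proof.
have := cycle_rotation N; rewrite /es insN /rotation /fingraph.orbit -orderSpred /=.
by move/chain_es; rewrite belast_rcons last_rcons lmN.
Qed.

(* The edges leaving a down-closed set [U], listed so that each one has the next
   one across the face on its right. *)
Definition is_cut (U : {set vertex M}) (l : seq (dart M)) :=
  [/\ uniq l, l =i cut U & chain (outer M) l (outer M)].

Definition avail (U : {set vertex M}) (v : vertex M) :=
  [/\ v \notin U, v != N & forall d : dart M, out d -> tgt d = v -> src d \in U].

Lemma avail_inner U v : down U -> avail U v -> inner v.
Proof.
case=> SU _ _ [vU vN _]; rewrite (innerE HM) vN andbT.
by apply: contraNneq vU => ->.
Qed.

Lemma down_south : down [set S].
Proof.
split=> [||d od]; rewrite ?inE //; first by rewrite eq_sym (south_neq_north HM).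
by move/eqP => td; have := outS HM td; rewrite (out_twin HM) od.
Qed.

Lemma down_not_north : down (~: [set N]).
Proof.
split=> [||d od]; rewrite !inE ?eqxx ?(south_neq_north HM) // => _.
by apply: contraTneq od => /(outN HM) ->.
Qed.

Lemma down_step U v : down U -> avail U v -> down (v |: U).
Proof.
case=> SU NU dU [vU vN va]; split=> [||d od]; rewrite !inE.
- by rewrite SU orbT.
- by rewrite negb_or NU eq_sym vN.
by case/predU1P=> [/(va _ od) ->|/(dU _ od) ->]; rewrite orbT.
Qed.

Lemma avail_exists U U' : down U -> down U' -> U \subset U' -> U != U' ->
  exists2 v, v \in U' & avail U v.
Proof.
move=> dU [SU' NU' dU'] sU nU.
have [x xU] : exists x, x \in U' :\: U.
  by apply/set0Pn; apply: contra nU; rewrite setD_eq0 eqEsubset sU.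
have [v] := min_exists HM xU; rewrite inE => /andP[vU vU'] vmin; exists v => //.
split=> // [|d od td]; first by apply: contraNneq NU' => <-.
have := vmin d od td; rewrite inE negb_and negbK => /orP[//|/negP[]].
by apply: dU' => //; rewrite td.
Qed.

Lemma is_cut_south : is_cut [set S] (outs S).
Proof.
split; [exact: uniq_outs| |exact: chain_outsS] => d.
rewrite mem_outs unfold_in !inE; case od: (out d) => //=.
by have [sd|//] := eqVneq (src d) S; rewrite -sd eq_sym (arc_neq HM od).
Qed.

Lemma is_cut_north : is_cut (~: [set N]) (es N).
Proof.
split; [exact: uniq_es| |exact: chain_esN] => d.
rewrite mem_es unfold_in !inE negbK; case od: (out d) => //=.
by have [td|] := eqVneq (tgt d) N; rewrite ?andbF // -td (arc_neq HM od).
Qed.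

(** [lm N] already marks a top corner of the outer face, and a face has only one. *)
Lemma outer_sink d : ~~ out d -> ~~ out (cw d) -> face_of d = outer M -> src d = N.
Proof.
move=> od oc cd; rewrite -[RHS]src_lm; congr src.
have h x : src x = N -> ~~ out x by move/(outN HM) ->.
apply: (ii_unique HM) => //; first exact/h/src_lm.
  by apply: h; rewrite (srcC HM) src_lm.
by rewrite lmN.
Qed.

(** In the cut, the edge following an ingoing edge of [v] has on its left the face to the right of
    that edge. The next ingoing edge also has this face on its left, and only one cut edge does. The
    walk starts from the leftmost ingoing edge. *)
Lemma es_contiguous U l v : down U -> is_cut U l -> avail U v ->
  exists A B, l = A ++ es v ++ B.
Proof.
move=> dU [ul ml cl] av; have vi := avail_inner dU av; case: av => vU vN va.
have [x [s [ei ex]]] : exists d s, ins v = d :: s /\ d = lm v.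
  by apply: ins_nil; move: vi; rewrite (innerE HM) => /andP[].
have esl d : d \in es v -> cut U d.
  by rewrite mem_es => /andP[od /eqP td]; rewrite /cut od va // td.
have insl d : d \in ins v -> cut U (twin d) by move=> di; apply/esl/map_f.
have pth : fpath turn x s.
  by have := cycle_rotation v; rewrite rotationE ei /= rcons_cat cat_path => /andP[].
have xl : twin x \in l by rewrite ml; apply: insl; rewrite ei mem_head.
case/splitPr: xl ul ml cl => A L ul ml cl; exists A; rewrite /es ei /=.
suff [B ->] : exists B, L = [seq twin d | d <- s] ++ B by exists B.
have mL d : d \in L -> cut U d by move=> dL; rewrite -[cut U d]ml mem_cat inE dL !orbT.
have {cl} : chain (face_of (twin x)) L (outer M).
  by case/chain_catP: cl => m _ /= /andP[].
have : {subset x :: s <= ins v} by rewrite ei.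
elim: s x pth L mL {ul ml ei ex} => [|y s IH] x /= pth L mL sub cL; first by exists L.
case/andP: pth => /eqP exy pth.
have xi : x \in ins v by apply: sub; rewrite mem_head.
have yi : y \in ins v by apply: sub; rewrite !inE eqxx orbT.
have cy : face_of (twin x) = face_of y by rewrite -exy (face_of_turn HM).
case: L mL cL => [|e L] mL /= cL.
  (* If the cut stopped here, the corner between [x] and [y] would be a top corner of the outer
     face, forcing [v = N]. *)
  move: xi yi; rewrite !mem_ins => /andP[ox sx] /andP[oy /eqP sy].
  case/eqP: vN; rewrite -sy; apply: outer_sink => //; first by rewrite -exy (turnK HM).
  by rewrite -cy; apply/eqP.
case/andP: cL => /eqP ce cL.
have ey : e = twin y.
  apply: (cut_left_unique HM dU) (mL _ (mem_head _ _)) (insl _ yi) _.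
  by rewrite ce cy (twinK HM).
case: (IH y pth L) => [d dL|d ds||B ->]; last by exists B; rewrite ey.
- by apply: mL; rewrite inE dL orbT.
- by apply: sub; rewrite inE ds orbT.
by rewrite -ey.
Qed.

Lemma cut_step U l v : down U -> is_cut U l -> avail U v ->
  exists A B, l = A ++ es v ++ B /\ is_cut (v |: U) (A ++ outs v ++ B).
Proof.
move=> dU cl av; have [A [B el]] := es_contiguous dU cl av; exists A, B; split=> //.
have vi := avail_inner dU av; case: cl av => ul ml cl [vU vN va].
have mAB d : (d \in A ++ B) = cut U d && (tgt d != v).
  move: ul (ml d); rewrite el uniq_catCA cat_uniq => /and3P[_ /hasPn h _].
  have := h d; rewrite !mem_cat mem_es => {}h; case AB: ((d \in A) || (d \in B)).
    rewrite AB in h; have {h} := h isT.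
    rewrite orbCA AB orbT => /= nes; rewrite -topredE /= => mc; rewrite -mc.
    have /and3P[od _ _] : cut U d by rewrite -mc.
    by move: nes; rewrite od => ->.
  rewrite orbCA AB orbF -[d \in cut U]topredE /= => <-.
  by case: (out d); case: (tgt d == v).
split.
- rewrite uniq_catCA cat_uniq uniq_outs /=; apply/andP; split.
    apply/hasPn => d; rewrite mAB => /andP[/and3P[_ sd _] _]; rewrite mem_outs negb_and.
    by apply/orP; right; apply: contraTneq sd => ->.
  by move: ul; rewrite el uniq_catCA cat_uniq => /and3P[].
- move=> d; rewrite !mem_cat orbCA -mem_cat mAB mem_outs unfold_in !inE /cut.
  rewrite !negb_or; case od: (out d) => //=.
  have [sd|sd] := eqVneq (src d) v; last by do !case: (_ \in _) => /=; case: (_ == v).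
  have tU : tgt d \notin U by apply: contra vU; rewrite -sd; case: dU => _ _; apply.
  by have tv := arc_neq HM od; rewrite sd eq_sym in tv; rewrite tv tU.
move: cl; rewrite el => /chain_catP[g cA /chain_catP[h ce cB]].
apply/chain_catP; exists g => //; apply/chain_catP; exists h => //.
exact: es_outs_chain.
Qed.

(** The first edge has the outer face on its left, each edge fixes the left face of the next one,
    and a cut edge is determined by its left face. *)
Lemma is_cut_fun U l l' : down U -> is_cut U l -> is_cut U l' -> l = l'.
Proof.
move=> dU [ul ml cl] [ul' ml' cl'].
have sz : size l = size l'.
  by apply: perm_size; apply: uniq_perm => // d; rewrite ml ml'.
have {ul ml} cU d : d \in l -> cut U d by rewrite ml.
have {ul' ml'} cU' d : d \in l' -> cut U d by rewrite ml'.
elim: l l' {1 3}(outer M) cl cl' sz cU cU' => [|e l IH] [|e' l'] g //=.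
move=> /andP[/eqP ce cl] /andP[/eqP ce' cl'] [sz] cU cU'.
have ee : e = e'.
  apply: (cut_left_unique HM dU); last by rewrite ce ce'.
    by apply: cU; rewrite mem_head.
  by apply: cU'; rewrite mem_head.
rewrite -ee in cl' *; congr cons; apply: (IH l' _ cl cl' sz) => d dl.
  by apply: cU; rewrite inE dl orbT.
by apply: cU'; rewrite inE dl orbT.
Qed.
End Rotation.

(** * Sweeps and tours *)

Section Before.
Variable D : eqType.
Implicit Types (l A B X Y : seq D) (e f : D).

Definition before l e f := subseq [:: e; f] l.

Lemma before_mem l e f : before l e f -> (e \in l) /\ (f \in l).
Proof. by move/mem_subseq => h; split; apply: h; rewrite !inE eqxx ?orbT. Qed.

Lemma before_neq l e f : uniq l -> before l e f -> e != f.
Proof. by move=> ul /subseq_uniq/(_ ul); rewrite /= andbT inE. Qed.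

Lemma before_asym l e f : uniq l -> before l e f -> ~~ before l f e.
Proof.
move=> ul b; apply/negP => b'; move: (before_neq ul b).
move: b b' => /(subseq_uniqP ul) h /(subseq_uniqP ul).
have -> : [seq x <- l | x \in [:: f; e]] = [seq x <- l | x \in [:: e; f]].
  by apply: eq_filter => x; rewrite !inE orbC.
by rewrite -h => -[->]; rewrite eqxx.
Qed.

Lemma before_cat l1 l2 e f : e \in l1 -> f \in l2 -> before (l1 ++ l2) e f.
Proof.
by move=> e1 f2; rewrite /before -[[:: e; f]]/([:: e] ++ [:: f]) cat_subseq ?sub1seq.
Qed.

Lemma before_total l e f : e \in l -> f \in l -> e != f -> before l e f || before l f e.
Proof.
case/splitPr => A B; rewrite mem_cat inE eq_sym => /orP[fA|/predU1P[->|fB]] ne.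
- by apply/orP; right; rewrite before_cat // mem_head.
- by rewrite eqxx in ne.
by rewrite -cat_rcons before_cat // mem_rcons mem_head.
Qed.

Lemma before_replace X Y A B e f : e \notin X -> f \notin X ->
  before (A ++ X ++ B) e f -> before (A ++ Y ++ B) e f.
Proof.
move=> eX fX b; have : subseq [:: e; f] (filter (predC (mem X)) (A ++ X ++ B)).
  by rewrite subseq_filter; apply/andP; split=> //=; rewrite eX fX.
rewrite !filter_cat.
have -> : filter (predC (mem X)) X = [::].
  by apply/eqP; rewrite -[_ == _]negbK -has_filter; apply/hasPn => x xX; rewrite /= xX.
move/subseq_trans; apply; rewrite cat0s cat_subseq ?filter_subseq //.
by rewrite (subseq_trans (filter_subseq _ _)) ?suffix_subseq.
Qed.

Lemma before_prefix A L e f : uniq (A ++ L) -> e \in A -> before (A ++ L) f e -> before A f e.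
Proof.
move=> u eA b; have fe := before_neq u b.
have fA : f \in A.
  have [] := before_mem b; rewrite mem_cat => /orP[//|fL] _.
  by have := before_asym u b; rewrite before_cat.
have /orP[//|b'] := before_total fA eA fe.
have := before_asym u b; rewrite /before (subseq_trans b') //.
exact: prefix_subseq.
Qed.

Lemma before_widen A B l e f : before l e f -> before (A ++ l ++ B) e f.
Proof.
move=> b; apply: (subseq_trans b); apply: (subseq_trans (prefix_subseq l B)).
exact: suffix_subseq.
Qed.

Lemma uniq_split X Y X' Y' e : uniq (X ++ e :: Y) -> X ++ e :: Y = X' ++ e :: Y' ->
  X = X' /\ Y = Y'.
Proof.
move=> u ee; have hi X1 Y1 : uniq (X1 ++ e :: Y1) -> index e (X1 ++ e :: Y1) = size X1.
  rewrite cat_uniq /= negb_or => /and3P[_ /andP[/negPf h _] _].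
  by rewrite index_cat h /= eqxx addn0.
have sz : size X = size X' by rewrite -(hi X Y) // ee hi // -ee.
by move/eqP: ee; rewrite eqseq_cat // => /andP[/eqP -> /eqP[->]].
Qed.
End Before.

Lemma index_first_visit (T : finType) (V : eqType) (step : T -> T) (src : T -> V) r u v :
  (exists k, src (iter k step r) = u /\ forall j, j <= k -> src (iter j step r) != v) ->
  index u [seq src d | d <- fingraph.orbit step r] <
  index v [seq src d | d <- fingraph.orbit step r].
Proof.
move=> [k [ku kv]].
have [j jo ej] : exists2 j, j < fingraph.order step r & iter j step r = iter k step r.
  exists (findex step r (iter k step r)); first by rewrite findex_max ?fconnect_iter.
  by rewrite iter_findex ?fconnect_iter.
(* [k] may exceed the period; [a] lies within the orbit and is still at most [k], hence before any
   visit of [v]. *)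
pose a := minn j k.
have ao : a < fingraph.order step r by rewrite /a gtn_min jo.
have ea : src (iter a step r) = u.
  by rewrite /a /minn; case: ifP => _; rewrite ?ej ku.
set s := map _ _; have sz : size s = fingraph.order step r by rewrite size_map size_orbit.
have nths i : i < fingraph.order step r -> nth u s i = src (iter i step r).
  by move=> io; rewrite (nth_map r) ?size_orbit // nth_traject.
have ua : index u s <= a.
  by rewrite leqNgt; apply/negP => /(before_find u) /=; rewrite nths // ea eqxx.
apply: leq_ltn_trans ua _; rewrite ltnNge; apply/negP => va.
have vs : v \in s by rewrite -index_mem sz (leq_ltn_trans va).
have := nth_index u vs; rewrite nths; last by rewrite -sz index_mem.
by apply/eqP/kv; rewrite (leq_trans va) // geq_minr.
Qed.

Section NotAbove.
Variables (n : nat) (M : rooted_map).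
Hypothesis HM : plane_bipolar_poset M n.

(** The largest down-closed set avoiding both [u] and [v]. When they are incomparable, both are
    available from it, so its cut shows their ingoing edges side by side. *)
Definition not_above (u v : vertex M) := [set w : vertex M | ~~ le u w && ~~ le v w].

Lemma not_above_down u v : inner u -> inner v -> down (not_above u v).
Proof.
have hS w : inner w -> ~~ le w (south M).
  rewrite (innerE HM) => /andP[wS _]; apply: contra wS => h; apply/eqP.
  exact: le_anti HM _ _ h (le_south HM w).
move=> ui vi; split=> [||d od]; rewrite !inE ?hS // ?(le_north HM) //.
by move=> /andP[ud vd]; apply/andP; split; [apply: contra ud|apply: contra vd] => h;
  apply: le_trans h (le_arc od).
Qed.

Lemma not_above_sym u v : not_above u v = not_above v u.
Proof. by apply/setP => w; rewrite !inE andbC. Qed.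

Lemma not_above_avail u v : inner u -> ~~ le v u -> avail (not_above u v) u.
Proof.
rewrite (innerE HM) => /andP[_ uN] vu; split=> //; first by rewrite inE le_refl.
move=> d od td; rewrite inE -td (arc_lt HM od) /=.
by apply: contra vu => h; rewrite -td; apply: le_trans h (le_arc od).
Qed.
End NotAbove.

Section Sweep.
Variables (n : nat) (M : rooted_map).
Hypothesis HM : plane_bipolar_poset M n.
Notation S := (south M).
Notation N := (north M).

(* Instantiated by the cuts read from left to right, with rightmost ingoing
   edges as parents, and by the cuts read from right to left, with leftmost ones. *)
Variables (cutl : {set vertex M} -> seq (dart M) -> Prop).
Variables (esX outsX : vertex M -> seq (dart M)) (parX : vertex M -> dart M).
Hypothesis cutl_uniq : forall U l, cutl U l -> uniq l.
Hypothesis cutl_mem : forall U l, cutl U l -> l =i cut U.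
Hypothesis cutl_step : forall U l v, down U -> cutl U l -> avail U v ->
  exists A B, l = A ++ esX v ++ B /\ cutl (v |: U) (A ++ outsX v ++ B).
Hypothesis cutl_start : cutl [set S] (outsX S).
Hypothesis cutl_fun : forall U l l', down U -> cutl U l -> cutl U l' -> l = l'.
Hypothesis mem_esX : forall v d, (d \in esX v) = out d && (tgt d == v).
Hypothesis mem_outsX : forall v d, (d \in outsX v) = out d && (src d == v).
Hypothesis esX_par : forall v, inner v -> exists s, esX v = rcons s (parX v).

Definition par (d : dart M) := [&& out d, inner (tgt d) & d == parX (tgt d)].

Lemma parX_in v : inner v -> parX v \in esX v.
Proof. by case/esX_par => s ->; rewrite mem_rcons mem_head. Qed.
Lemma out_parX v : inner v -> out (parX v).
Proof. by move/parX_in; rewrite mem_esX => /andP[]. Qed.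
Lemma tgt_parX v : inner v -> tgt (parX v) = v.
Proof. by move/parX_in; rewrite mem_esX => /andP[_ /eqP]. Qed.
Lemma par_parX v : inner v -> par (parX v).
Proof. by move=> vi; rewrite /par out_parX // tgt_parX // vi eqxx. Qed.

(** Induction along a linear extension: available vertices are added to [U] one at a time until [U']
    is reached, each replacing its ingoing fan by its outgoing fan. [Q] arrives at some cut of [U'];
    [sweep_ind] reaches any given one by uniqueness. *)
Lemma sweep_ex (Q : {set vertex M} -> seq (dart M) -> Prop) U' : down U' ->
  (forall U A B v, down U -> U \subset U' -> v \in U' -> avail U v ->
     cutl U (A ++ esX v ++ B) -> cutl (v |: U) (A ++ outsX v ++ B) ->
     Q U (A ++ esX v ++ B) -> Q (v |: U) (A ++ outsX v ++ B)) ->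
  forall U l, down U -> U \subset U' -> cutl U l -> Q U l ->
  exists2 l', cutl U' l' & Q U' l'.
Proof.
move=> dU' step U; have [m] := ubnP #|U' :\: U|; elim: m U => // m IH U Um l dU sU cl ql.
have [eU|nU] := eqVneq U U'; first by exists l; rewrite -eU.
have [v vU' av] := avail_exists HM dU dU' sU nU.
have [A [B [el cl']]] := cutl_step dU cl av; rewrite el in cl ql.
have dvU := down_step dU av.
have sU2 : v |: U \subset U' by rewrite subUset sub1set vU'.
apply: (IH (v |: U) _ _ dvU sU2 cl'); last exact: step ql.
rewrite ltnS in Um; apply: leq_trans Um; apply: proper_card; apply/properP.
split; first by apply/setDS/subsetUr.
by case: av => vU _ _; exists v; rewrite !inE ?eqxx // vU.
Qed.

Lemma sweep_ind (Q : {set vertex M} -> seq (dart M) -> Prop) U' : down U' ->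
  (forall U A B v, down U -> U \subset U' -> v \in U' -> avail U v ->
     cutl U (A ++ esX v ++ B) -> cutl (v |: U) (A ++ outsX v ++ B) ->
     Q U (A ++ esX v ++ B) -> Q (v |: U) (A ++ outsX v ++ B)) ->
  forall U l l', down U -> U \subset U' -> cutl U l -> cutl U' l' -> Q U l -> Q U' l'.
Proof.
move=> dU' step U l l' dU sU cl cl' ql.
have [l2 cl2 ql2] := sweep_ex dU' step dU sU cl ql.
by rewrite (cutl_fun dU' cl' cl2).
Qed.

Lemma cutl_exists U : down U -> exists l, cutl U l.
Proof.
move=> dU; have sU : [set S] \subset U by rewrite sub1set; case: dU.
have step U1 A B v : down U1 -> U1 \subset U -> v \in U -> avail U1 v ->
  cutl U1 (A ++ esX v ++ B) -> cutl (v |: U1) (A ++ outsX v ++ B) -> True -> True by [].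
by have [l] := @sweep_ex (fun _ _ => True) U dU step _ _ (down_south HM) sU cutl_start I; exists l.
Qed.

Lemma cutl_out U l d : cutl U l -> d \in l -> out d.
Proof. by move=> cl; rewrite (cutl_mem cl) => /and3P[]. Qed.
Lemma cutl_tgt U l d : cutl U l -> d \in l -> tgt d \notin U.
Proof. by move=> cl; rewrite (cutl_mem cl) => /and3P[]. Qed.

Lemma before_mono U U' l l' e f : down U -> down U' -> U \subset U' ->
  cutl U l -> cutl U' l' -> tgt e \notin U' -> tgt f \notin U' ->
  before l e f -> before l' e f.
Proof.
move=> dU dU' sU cl cl' te tf.
apply: (@sweep_ind (fun _ l => before l e f) U' dU' _ _ _ _ dU sU cl cl') => {U l dU sU cl}.
move=> U A B v _ _ vU' _ _ _; apply: before_replace; rewrite mem_esX negb_and.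
  by rewrite orbC (contraNneq _ te) // => ->.
by rewrite orbC (contraNneq _ tf) // => ->.
Qed.

(** When the head of [f] is swept, [f] gives way to an arc leading from there towards [v]. As [e] is
    not in the replaced fan, it lies to the left of all of it, hence of the new arc. *)
Lemma before_path U U' l l' e f v : down U -> down U' -> U \subset U' ->
  cutl U l -> cutl U' l' -> tgt e \notin U' -> v \notin U' ->
  before l e f -> le (tgt f) v -> exists2 g, before l' e g & le (tgt g) v.
Proof.
move=> dU dU' sU cl cl' te vU' b fv.
have := @sweep_ind (fun _ l => exists2 g, before l e g & le (tgt g) v) U' dU' _ _ _ _ dU sU cl cl'.
apply; last by exists f.
move=> {U l dU sU cl f b fv} U A B w dU sU wU' aw cl cl2 [f b fv].
have ew : e \notin esX w by rewrite mem_esX negb_and orbC (contraNneq _ te) // => ->.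
have [fw|fw] := boolP (f \in esX w); last by exists f => //; apply: before_replace b.
move: (fw); rewrite mem_esX => /andP[of_ /eqP tf]; rewrite tf in fv.
have wv : w != v by apply: contraNneq vU' => <-.
have [d [od sd dv]] := le_first fv wv; exists d => //.
have eA : e \in A.
  have [] := before_mem b; rewrite mem_cat => /orP[//|eL] _.
  move: (eL); rewrite mem_cat (negPf ew) /= => eB.
  have b' : before (A ++ esX w ++ B) f e by rewrite catA before_cat // mem_cat fw orbT.
  by have := before_asym (cutl_uniq cl) b; rewrite b'.
by rewrite before_cat // mem_cat mem_outsX od sd eqxx.
Qed.

Definition no_par_before (l : seq (dart M)) e := forall f, before l f e -> ~~ par f.

(** No vertex whose fan lies before [e] can be swept, since that fan contains a parent edge. So the
    part of the cut up to [e] never changes. *)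
Lemma no_par_mono U U' l l' e : down U -> down U' -> U \subset U' ->
  cutl U l -> cutl U' l' -> e \in l -> tgt e \notin U' ->
  no_par_before l e -> no_par_before l' e.
Proof.
move=> dU dU' sU cl cl' el te nl.
suff [] : e \in l' /\ no_par_before l' e by [].
apply: (@sweep_ind (fun _ l => e \in l /\ no_par_before l e) U' dU' _ _ _ _ dU sU cl cl') => //.
move=> {U l dU sU cl el nl} U A B w dU sU wU' aw cl cl2 [el nl].
have wi := avail_inner HM dU aw.
have ew : e \notin esX w by rewrite mem_esX negb_and orbC (contraNneq _ te) // => ->.
have eA : e \in A.
  move: el; rewrite !mem_cat (negPf ew) /= => /orP[//|eB].
  have := nl (parX w); rewrite par_parX // catA before_cat // => [/(_ isT)//|].
  by rewrite mem_cat parX_in ?orbT.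
split=> [|f b]; first by rewrite mem_cat eA.
apply: nl; apply: (subseq_trans (before_prefix (cutl_uniq cl2) eA b)).
exact: prefix_subseq.
Qed.

(** If an edge entered [v] from outside [U], some available [w] below [v] would have its parent edge
    after [parX v], which is the first. Sweeping everything strictly below [v] and following a path
    from [w] to [v] gives an ingoing edge of [v] after [parX v], although [parX v] ends the fan of
    [v]. *)
Lemma first_par_avail U l v : down U -> cutl U l -> inner v -> parX v \in l ->
  no_par_before l (parX v) -> avail U v.
Proof.
move=> dU cl vi pl np.
have vU : v \notin U by have := cutl_tgt cl pl; rewrite tgt_parX.
have vN : v != N by move: vi; rewrite (innerE HM) => /andP[].
split=> // d od td; apply/negPn/negP => dnU.
pose U' := [set w | (w \in U) || (le w v && (w != v))].
have dU' : down U'.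
  case: dU => SU NU dU; split; rewrite ?inE ?SU //.
    rewrite (negPf NU) /=; apply/negP => /andP[Nv].
    by case/negP; apply/eqP/(le_anti HM) => //; apply: le_north HM v.
  move=> c oc; rewrite !inE => /orP[/(dU _ oc) -> //|/andP[tv ntv]]; apply/orP; right.
  rewrite (le_trans (le_arc oc)) //=; apply: contraNneq (arc_lt HM oc) => ->.
  exact: tv.
have sU : U \subset U' by apply/subsetP => w wU; rewrite inE wU.
have dU'd : src d \in U'.
  by rewrite inE (negPf dnU) -td le_arc //= (arc_neq HM od).
have nU : U != U' by apply: contraNneq dnU => ->.
have [w wU' aw] := avail_exists HM dU dU' sU nU.
have [wU wv nwv] : [/\ w \notin U, le w v & w != v].
  by case: aw => wU _ _; move: wU'; rewrite inE (negPf wU) => /andP[].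
have vU' : v \notin U' by rewrite inE (negPf vU) eqxx andbF.
have wi := avail_inner HM dU aw.
have pwl : parX w \in l.
  have [A [B [-> _]]] := cutl_step dU cl aw; by rewrite !mem_cat parX_in ?orbT.
have npw : parX v != parX w.
  by apply: contraNneq nwv => e; rewrite -(tgt_parX vi) e tgt_parX.
have b : before l (parX v) (parX w).
  have /orP[//|/np] := before_total pl pwl npw; by rewrite par_parX.
have [l' cl'] := cutl_exists dU'.
have [||g bg gv] := before_path dU dU' sU cl cl' _ vU' b.
- by rewrite tgt_parX.
- by rewrite tgt_parX.
have [pl' gl'] := before_mem bg.
have tg : tgt g = v.
  have := cutl_tgt cl' gl'; rewrite inE negb_or negb_and negbK gv /= => /andP[_ /eqP//].
have av : avail U' v.
  split=> // c oc tc; rewrite inE -tc le_arc //= (arc_neq HM oc) orbT //.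
have [A [B [el' _]]] := cutl_step dU' cl' av.
have gv' : g \in esX v by rewrite mem_esX tg eqxx (cutl_out cl' gl').
have [s es_] := esX_par vi; move: (cutl_uniq cl') bg; rewrite el' => u bg.
have ngp := before_neq u bg.
have : g \in s by move: gv'; rewrite es_ mem_rcons inE eq_sym (negPf ngp).
move=> gs; have b' : before (A ++ esX v ++ B) g (parX v).
  by apply: before_widen; rewrite es_ -cats1 before_cat // mem_head.
by have := before_asym u bg; rewrite b'.
Qed.

(** * Tours of the spanning tree *)

Variables (nx : dart M -> dart M) (T : pred (dart M)) (r0 : dart M).
Hypothesis src_nx : forall d, src (nx d) = src d.
Hypothesis src_r0 : src r0 = S.
Hypothesis nx_south : fpath nx r0 (outsX S).
(** As the parent edge is the last of its fan in the cut, the tour turning away from it passes the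
    other ingoing edges and then meets the outgoing ones in the order of the cut. *)
Hypothesis nx_inner : forall v, inner v -> exists s,
  [/\ fpath nx (twin (parX v)) (s ++ outsX v),
      nx (last (twin (parX v)) (s ++ outsX v)) = twin (parX v)
    & forall d, d \in s -> [&& ~~ out d, src d == v & d != twin (parX v)]].
Hypothesis T_out : forall d, out d -> T d = par d.
Hypothesis T_in : forall d, ~~ out d -> inner (src d) -> T d = (d == twin (parX (src d))).

Definition step d := let e := nx d in if T e then twin e else e.

(* [remains U d B]: from the corner [d], and if the tour walked past every
   outgoing edge without following it, the outgoing edges it would meet
   include, in this order and within [U], those of [B]. *)
Inductive remains (U : {set vertex M}) : dart M -> seq (dart M) -> Prop :=
| Remains_end d : remains U d [::]
| Remains_out d B : out (nx d) -> remains U (nx d) B -> remains U d (nx d :: B)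
| Remains_in d B : ~~ out (nx d) -> src (step d) \in U -> remains U (step d) B ->
    remains U d B.

Lemma remains_mono (U U' : {set vertex M}) d B : U \subset U' -> remains U d B -> remains U' d B.
Proof.
move=> /subsetP sU; elim=> {d B} [d|d B od _ IH|d B od dU _ IH].
- exact: Remains_end.
- exact: Remains_out.
by apply: Remains_in => //; apply: sU.
Qed.

Lemma remains_outs U x s B : fpath nx x s -> all (@out M) s ->
  remains U (last x s) B -> remains U x (s ++ B).
Proof.
elim: s x => //= y s IH x /andP[/eqP <- ps] /andP[oy os] r.
by apply: Remains_out => //; apply: IH.
Qed.

(** The excursion at [v]: the other ingoing edges are not in the tree and are passed, the outgoing
    ones are met in order, and the parent edge leads back to the place where the tour left the
    parent. *)
Lemma remains_vertex (U : {set vertex M}) v B : inner v -> v \in U -> src (parX v) \in U ->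
  remains U (parX v) B -> remains U (twin (parX v)) (outsX v ++ B).
Proof.
move=> vi vU pU r; have [s [ps nl hs]] := nx_inner vi.
have op := out_parX vi; have tp := tgt_parX vi.
set p := twin (parX v) in ps nl hs *.
have inp : ~~ out p by rewrite (out_twin HM) op.
have srcp : src p = v by [].
have Tp : T p by rewrite T_in // srcp.
move: {1 2 4}p ps nl => q; elim: s q hs => [|y s IH] q hs /=.
  move=> ps nl; apply: remains_outs => //.
    by apply/allP => d; rewrite mem_outsX => /andP[].
  have st : step (last q (outsX v)) = parX v by rewrite /step nl Tp (twinK HM).
  by apply: Remains_in; rewrite ?nl ?st.
case/andP=> /eqP qy ps nl.
have /and3P[iny /eqP sy yp] := hs y (mem_head _ _).
have st : step q = y by rewrite /step qy T_in // sy // (negPf yp).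
apply: Remains_in; rewrite ?qy ?st ?sy //; apply: IH => // d ds.
by apply: hs; rewrite inE ds orbT.
Qed.

Definition visited_at k w := exists2 j, j <= k & src (iter j step r0) = w.

(** Invariant: the visited set [U] is down-closed with cut [A ++ B], where [A] contains no parent
    edge and [B] is still to be met in this order. The next parent edge met is thus the first of the
    cut, and its head is available. The outer induction is on the number of unvisited vertices, the
    inner one on the derivation of [remains]. *)
Lemma tour_first_visit_from m U k A B : #|~: U| < m -> down U -> cutl U (A ++ B) ->
  (forall f, f \in A -> ~~ par f) -> remains U (iter k step r0) B ->
  (forall w, w \in U <-> visited_at k w) ->
  forall v, inner v -> v \notin U ->
  exists k' (U' : {set vertex M}) l', [/\ src (iter k' step r0) = v, 
     forall j, j < k' -> src (iter j step r0) \in U' ,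
     forall w, w \in U' -> exists2 j, j < k' & src (iter j step r0) = w,
     down U' /\ v \notin U'
   & avail U' v /\ cutl U' l' /\ parX v \in l' /\ no_par_before l' (parX v)].
Proof.
elim: m U k A B => // m IHm U k A B; rewrite ltnS => Um dU cl nA rem vis v vi vU.
move ed : (iter k step r0) rem => d rem.
elim: rem k A ed cl nA vis => {d B} [d|d B od rem IH|d B od sd rem IH] k A ed cl nA vis.
(* Nothing is left to be met, yet some available vertex has its parent edge in the cut, against
   [nA]. *)
- have nU : U != ~: [set N].
    apply: contraNneq vU => ->; rewrite !inE.
    by move: vi; rewrite (innerE HM) => /andP[].
  have sU : U \subset ~: [set N].
    by apply/subsetP => w wU; rewrite !inE; apply: contraTneq wU => ->; case: dU.
  have [w _ aw] := avail_exists HM dU (down_not_north HM) sU nU.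
  have wi := avail_inner HM dU aw.
  have [A1 [B1 [e _]]] := cutl_step dU cl aw.
  have : parX w \in A by rewrite -[A]cats0 e !mem_cat parX_in ?orbT.
  by move/nA; rewrite par_parX.
- have sd : src (nx d) \in U by rewrite src_nx; apply/vis; exists k; rewrite ?ed.
  have [pe|npe] := boolP (par (nx d)); last first.
    have st : step d = nx d by rewrite /step T_out // (negPf npe).
    apply: (IH k.+1 (rcons A (nx d))).
    + by rewrite iterS ed st.
    + by rewrite cat_rcons.
    + by move=> f; rewrite mem_rcons inE => /predU1P[->|/nA].
    move=> w; split=> [/vis[j jk jw]|[j]]; first by exists j => //; apply: leqW.
    rewrite leq_eqVlt => /predU1P[->|jk] <-; last by apply/vis; exists j.
    by rewrite iterS ed st.
  case/and3P: (pe) => _ wi /eqP ee; set w := tgt (nx d) in wi ee.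
  have np : no_par_before (A ++ nx d :: B) (parX w).
    move=> f; rewrite -cat_rcons -ee => b.
    have u : uniq (rcons A (nx d) ++ B) by rewrite cat_rcons (cutl_uniq cl).
    have ein : nx d \in rcons A (nx d) by rewrite mem_rcons mem_head.
    have b2 := before_prefix u ein b; have [] := before_mem b2.
    rewrite mem_rcons inE => /predU1P[e|/nA //].
    have u2 : uniq (rcons A (nx d)) by move: u; rewrite cat_uniq => /and3P[].
    by have := before_neq u2 b2; rewrite e eqxx.
  have el : parX w \in A ++ nx d :: B by rewrite -ee mem_cat mem_head orbT.
  have aw := first_par_avail dU cl wi el np.
  have st : step d = twin (nx d) by rewrite /step T_out // pe.
  have sw : src (iter k.+1 step r0) = w by rewrite iterS ed st.
  have [ewv|nwv] := eqVneq w v.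
    exists k.+1, U, (A ++ nx d :: B); split=> //; last by rewrite -ewv.
    + by rewrite sw.
    + by move=> j jk; apply/vis; exists j.
    + by move=> x /vis[j jk jx]; exists j.
  have [A1 [B1 [el1 cl1]]] := cutl_step dU cl aw.
  have [s es_] := esX_par wi.
  (* The fan of [w] ends with the edge just met, so its other edges are at the end of [A] and [B] is
     all that follows it. *)
  have [eA eB] : A = A1 ++ s /\ B = B1.
    apply: (@uniq_split _ _ _ _ _ (nx d) (cutl_uniq cl)).
    by rewrite el1 es_ -ee -catA cat_rcons.
  have wU : w \notin U by case: aw.
  apply: (IHm (w |: U) k.+1 A1 (outsX w ++ B1)) => //.
  + apply: leq_trans Um; apply: proper_card; apply/properP; split.
      by rewrite setCS subsetUr.
    by exists w; rewrite !inE ?eqxx.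
  + exact: down_step dU aw.
  + by move=> f fA; apply: nA; rewrite eA mem_cat fA.
  + rewrite iterS ed st ee; apply: remains_vertex => //.
    * by rewrite !inE eqxx.
    * by rewrite inE -ee sd orbT.
    by rewrite -eB -ee; apply: remains_mono rem; apply: subsetUr.
  + move=> x; rewrite !inE; split.
      case/predU1P=> [->|/vis[j jk jx]]; first by exists k.+1.
      by exists j => //; apply: leqW.
    case=> j; rewrite leq_eqVlt => /predU1P[->|jk] <-; first by rewrite sw eqxx.
    by apply/orP; right; apply/vis; exists j.
  by rewrite !inE negb_or eq_sym nwv.
apply: (IH k.+1 A) => //; first by rewrite iterS ed.
move=> w; split=> [/vis[j jk jw]|[j]]; first by exists j => //; apply: leqW.
rewrite leq_eqVlt => /predU1P[->|jk] <-; last by apply/vis; exists j.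
by rewrite iterS ed.
Qed.

Lemma tour_first_visit v : inner v ->
  exists k (U : {set vertex M}) l, [/\ src (iter k step r0) = v, 
     forall j, j < k -> src (iter j step r0) \in U ,
     forall w, w \in U -> exists2 j, j < k & src (iter j step r0) = w,
     down U /\ v \notin U
   & avail U v /\ cutl U l /\ parX v \in l /\ no_par_before l (parX v)].
Proof.
move=> vi; apply: (@tour_first_visit_from _ [set S] 0 [::] (outsX S) (ltnSn _)) => //.
- exact: down_south HM.
- rewrite -[outsX S]cats0; apply: remains_outs => //.
    by apply/allP => d; rewrite mem_outsX => /andP[].
  exact: Remains_end.
- move=> w; rewrite inE; split=> [/eqP ->|[j]]; first by exists 0.
  by rewrite leqn0 => /eqP -> /= <-; rewrite src_r0.
by rewrite inE; move: vi; rewrite (innerE HM) => /andP[].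
Qed.

Definition visits_before (st : dart M -> dart M) r (u v : vertex M) :=
  exists k, src (iter k st r) = u /\ forall j, j <= k -> src (iter j st r) != v.

(** [v] is available when first reached, so all that is below it has been visited. *)
Lemma tour_le u v : inner v -> le u v -> u != v -> visits_before step r0 u v.
Proof.
move=> vi uv nuv; have [k [U [l [_ hk hU [dU vU] [[_ _ av] _]]]]] := tour_first_visit vi.
have [d [od td ud]] := le_last uv nuv.
have [j jk ju] := hU u (down_le dU ud (av d od td)).
by exists j; split=> // i ij; apply: contraNneq vU => <-; apply/hk/(leq_ltn_trans ij).
Qed.

(** If [u] were not visited when [v] is reached, the visited set would be contained in
    [not_above u v]; the absence of parent edges before [parX v] would persist up to that cut, where
    [parX u] comes earlier. *)
Lemma tour_left u v : inner u -> inner v -> ~~ le u v -> ~~ le v u ->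
  (forall l, cutl (not_above u v) l -> before l (parX u) (parX v)) ->
  visits_before step r0 u v.
Proof.
move=> ui vi uv vu left.
have [k [U [l [_ hk hU [dU vU] [av [cl [pl np]]]]]]] := tour_first_visit vi.
have uU : u \in U.
  apply/negPn/negP => uU; have dU' := not_above_down HM ui vi.
  have sU : U \subset not_above u v.
    apply/subsetP => w wU; rewrite inE; apply/andP; split.
      by apply: contra uU => uw; apply: down_le dU uw wU.
    by apply: contra vU => vw; apply: down_le dU vw wU.
  have [l' cl'] := cutl_exists dU'.
  have := no_par_mono dU dU' sU cl cl' pl _ np => /(_ _ (parX u) (left _ cl')).
  by rewrite par_parX // tgt_parX // inE le_refl andbF; move/(_ isT).
have [j jk ju] := hU u uU.
by exists j; split=> // i ij; apply: contraNneq vU => <-; apply/hk/(leq_ltn_trans ij).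
Qed.

End Sweep.

(** * The left-to-right order of incomparable vertices *)

Section Left.
Variables (n : nat) (M : rooted_map).
Hypothesis HM : plane_bipolar_poset M n.
Notation S := (south M).
Notation N := (north M).
Notation turn := (@turn M).

Definition rpar (v : vertex M) : dart M := last (root_dart M) (es v).
Definition lpar (v : vertex M) : dart M := head (root_dart M) (es v).

Lemma inner_neqS (v : vertex M) : inner v -> v != S.
Proof. by rewrite (innerE HM) => /andP[]. Qed.
Lemma inner_neqN (v : vertex M) : inner v -> v != N.
Proof. by rewrite (innerE HM) => /andP[]. Qed.

Lemma es_rpar v : inner v -> exists s, es v = rcons s (rpar v).
Proof.
move/inner_neqS/(ins_nil HM) => [d [s [ei _]]].
rewrite /rpar /es ei map_cons; exists (belast (twin d) [seq twin d | d <- s]).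
by rewrite -lastI.
Qed.

Lemma es_lpar v : inner v -> exists s, es v = lpar v :: s.
Proof.
move/inner_neqS/(ins_nil HM) => [d [s [ei _]]].
by rewrite /lpar /es ei map_cons; exists [seq twin d | d <- s].
Qed.

Lemma twin_lpar v : inner v -> twin (lpar v) = lm v.
Proof.
move/inner_neqS/(ins_nil HM) => [d [s [ei <-]]].
by rewrite /lpar /es ei /= (twinK HM).
Qed.

Lemma ins_rpar v : inner v -> exists s, ins v = rcons s (twin (rpar v)).
Proof.
move/es_rpar => [s e]; exists [seq twin d | d <- s].
by rewrite -map_rcons -e /es -map_comp map_id_in // => d _ /=; rewrite (twinK HM).
Qed.

Lemma fpath_cw p q : fcycle turn (p :: q) -> fpath (@cw M) p (rcons (rev q) p).
Proof.
rewrite /cw (fpath_finv (turn_inj HM)) last_rcons belast_rcons rev_cons revK /=.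
by [].
Qed.

Lemma out_turn_rpar v d : inner v -> src d = v -> ~~ out d ->
  out (turn d) = (d == twin (rpar v)).
Proof.
move=> vi sd od; have [s e] := ins_rpar vi.
have [y [t eo]] := rouT_nil HM (inner_neqN vi).
have tp : turn (twin (rpar v)) = y.
  have := cycle_rotation HM v; rewrite (rotationE HM) e eo cat_rcons.
  by rewrite -(rot_cycle (size s)) rot_size_cat /= => /andP[/eqP].
have oy : out y by have := mem_rouT HM v y; rewrite eo mem_head => /esym /andP[].
apply/idP/eqP => [ot|->]; last by rewrite tp.
apply: (turn_inj HM); apply: (oi_unique HM) => //; rewrite ?(turnK HM) ?tp //.
  have := mem_ins HM v (twin (rpar v)); rewrite e mem_rcons mem_head => /esym /andP[//].
rewrite (srcT HM) sd; symmetry.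
by have := mem_rouT HM v y; rewrite eo mem_head => /esym /andP[_ /eqP].
Qed.

Lemma out_cw_lpar v d : inner v -> src d = v -> ~~ out d ->
  out (cw d) = (d == twin (lpar v)).
Proof.
move=> vi sd od; rewrite (twin_lpar vi); have /andP[il ol] := lm_inner HM vi.
apply/idP/eqP => [oc|->//]; apply: (io_unique HM) => //.
by rewrite sd (src_lm HM).
Qed.

(** Reading cuts from right to left stands for reflecting the map; the parent edge, last of its fan,
    becomes the leftmost one. *)
Definition cutr U l := is_cut U (rev l : seq (dart M)).

Lemma cut_uniqX U (l : seq (dart M)) : is_cut U l -> uniq l. Proof. by case. Qed.
Lemma cut_memX U (l : seq (dart M)) : is_cut U l -> l =i cut U. Proof. by case. Qed.
Lemma cutr_uniq U l : cutr U l -> uniq l. Proof. by case; rewrite rev_uniq. Qed.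
Lemma cutr_mem U l : cutr U l -> l =i cut U.
Proof. by case=> _ h _ d; rewrite -h mem_rev. Qed.
Lemma cutr_step U l v : down U -> cutr U l -> avail U v ->
  exists A B, l = A ++ rev (es v) ++ B /\ cutr (v |: U) (A ++ rouT v ++ B).
Proof.
move=> dU cl av; have [A [B [e c]]] := cut_step HM dU cl av.
exists (rev B), (rev A); rewrite -[l]revK e !rev_cat -!catA; split=> //.
by rewrite /cutr !rev_cat !revK -catA.
Qed.
Lemma cutr_start : cutr [set S] (rouT S). Proof. exact: (is_cut_south HM). Qed.
Lemma cutr_fun U l l' : down U -> cutr U l -> cutr U l' -> l = l'.
Proof. by move=> dU c c'; rewrite -[l]revK -[l']revK (is_cut_fun HM dU c c'). Qed.
Lemma mem_esr (v : vertex M) (d : dart M) : (d \in rev (es v)) = out d && (tgt d == v).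
Proof. by rewrite mem_rev (mem_es HM). Qed.
Lemma esr_par v : inner v -> exists s, rev (es v) = rcons s (lpar v).
Proof. by case/es_lpar => s ->; exists (rev s); rewrite rev_cons. Qed.

Lemma right_tree_out (d : dart M) : out d -> right_tree d = par rpar d.
Proof.
move=> od; rewrite /right_tree /par /rightmost_in od andbF /= (out_twin HM) od /=.
case ti: (inner (tgt d)) => //=.
rewrite (@out_turn_rpar (tgt d)) ?(out_twin HM) ?od //.
by apply/eqP/eqP => [/(twin_inj HM)|<-].
Qed.
Lemma right_tree_in (d : dart M) : ~~ out d -> inner (src d) ->
  right_tree d = (d == twin (rpar (src d))).
Proof.
move=> od si; rewrite /right_tree /rightmost_in si od (out_twin HM) od /= andbF orbF.
exact: out_turn_rpar.
Qed.
Lemma left_tree_out (d : dart M) : out d -> left_tree d = par lpar d.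
Proof.
move=> od; rewrite /left_tree /par /leftmost_in od andbF /= (out_twin HM) od /=.
case ti: (inner (tgt d)) => //=.
rewrite [out _](@out_cw_lpar (tgt d)) ?(out_twin HM) ?od //.
by apply/eqP/eqP => [/(twin_inj HM)|<-].
Qed.
Lemma left_tree_in (d : dart M) : ~~ out d -> inner (src d) ->
  left_tree d = (d == twin (lpar (src d))).
Proof.
move=> od si; rewrite /left_tree /leftmost_in si od (out_twin HM) od /= andbF orbF.
exact: out_cw_lpar.
Qed.

Lemma nx_southX : fpath (@cw M) (root_dart M) (outs S).
Proof.
have := cycle_rotation HM S; rewrite /outs (rouTS HM) /rotation /fingraph.orbit -orderSpred /= (lmS HM).
by move=> h; rewrite rev_cons; apply: fpath_cw.
Qed.
Lemma nx_southY : fpath turn (cw (root_dart M)) (rouT S).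
Proof.
have := cycle_rotation HM S; rewrite (rouTS HM) /rotation /fingraph.orbit -orderSpred /= (lmS HM).
by rewrite (cwK HM) eqxx rcons_path => /andP[].
Qed.
Lemma nx_innerX v : inner v -> exists s,
  [/\ fpath (@cw M) (twin (rpar v)) (s ++ outs v),
      cw (last (twin (rpar v)) (s ++ outs v)) = twin (rpar v)
    & forall d, d \in s -> [&& ~~ out d, src d == v & d != twin (rpar v)]].
Proof.
move=> vi; have [s e] := ins_rpar vi; exists (rev s).
have cyc : fcycle turn (twin (rpar v) :: rouT v ++ s).
  have := cycle_rotation HM v; rewrite (rotationE HM) e cat_rcons.
  by rewrite -(rot_cycle (size s)) rot_size_cat.
have := fpath_cw cyc; rewrite rev_cat rcons_path => /andP[p /eqP l]; split=> // d.
rewrite mem_rev => ds; have di : d \in ins v by rewrite e mem_rcons inE ds orbT.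
move: (di); rewrite (mem_ins HM) => /andP[-> ->] /=.
by have := uniq_ins v; rewrite e rcons_uniq => /andP[h _]; apply: contraNneq h => <-.
Qed.
Lemma nx_innerY v : inner v -> exists s,
  [/\ fpath turn (twin (lpar v)) (s ++ rouT v),
      turn (last (twin (lpar v)) (s ++ rouT v)) = twin (lpar v)
    & forall d, d \in s -> [&& ~~ out d, src d == v & d != twin (lpar v)]].
Proof.
move=> vi; have [x [s [e el]]] := ins_nil HM (inner_neqS vi); exists s.
rewrite (twin_lpar vi) -el; have := cycle_rotation HM v; rewrite (rotationE HM) e /= rcons_path.
case/andP=> p /eqP l; split=> // d ds.
have di : d \in ins v by rewrite e inE ds orbT.
move: (di); rewrite (mem_ins HM) => /andP[-> ->] /=.
by have := uniq_ins v; rewrite e /= => /andP[h _]; apply: contraNneq h => <-.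
Qed.

Lemma cut_exists U : down U -> exists l : seq (dart M), is_cut U l.
Proof. exact: (cutl_exists HM (cut_step HM) (is_cut_south HM)). Qed.

Lemma cut_before_mono U U' (l l' : seq (dart M)) e f : down U -> down U' -> U \subset U' ->
  is_cut U l -> is_cut U' l' -> tgt e \notin U' -> tgt f \notin U' ->
  before l e f -> before l' e f.
Proof. exact: (before_mono HM (cut_step HM) (is_cut_fun HM) (mem_es HM)). Qed.

Lemma cut_no_par_mono U U' (l l' : seq (dart M)) e : down U -> down U' -> U \subset U' ->
  is_cut U l -> is_cut U' l' -> e \in l -> tgt e \notin U' ->
  no_par_before rpar l e -> no_par_before rpar l' e.
Proof.
exact: (no_par_mono HM cut_uniqX (cut_step HM) (is_cut_fun HM) (mem_es HM) es_rpar).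
Qed.

Lemma right_tour_le u v : inner v -> le u v -> u != v ->
  visits_before (cw_step (@right_tree M)) (root_dart M) u v.
Proof.
apply: (tour_le HM cut_uniqX cut_memX (cut_step HM) (is_cut_south HM) (is_cut_fun HM)
  (mem_es HM) (mem_outs HM) es_rpar (srcC HM) _ nx_southX nx_innerX
  right_tree_out right_tree_in) => //.
Qed.

Lemma right_tour_left u v : inner u -> inner v -> ~~ le u v -> ~~ le v u ->
  (forall l : seq (dart M), is_cut (not_above u v) l -> before l (rpar u) (rpar v)) ->
  visits_before (cw_step (@right_tree M)) (root_dart M) u v.
Proof.
apply: (tour_left HM cut_uniqX cut_memX (cut_step HM) (is_cut_south HM) (is_cut_fun HM)
  (mem_es HM) (mem_outs HM) es_rpar (srcC HM) _ nx_southX nx_innerX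
  right_tree_out right_tree_in) => //.
Qed.

(* [step] names a corner by the dart that precedes it counterclockwise. *)
Lemma iter_ccw_step k :
  iter k (ccw_step (@left_tree M)) (root_dart M) =
  turn (iter k (step turn (@left_tree M)) (cw (root_dart M))).
Proof.
elim: k => [|k IH]; first by rewrite /= (cwK HM).
by rewrite !iterS IH /ccw_step /step; case: ifP.
Qed.

Lemma visits_before_ccw u v :
  visits_before (step turn (@left_tree M)) (cw (root_dart M)) u v ->
  visits_before (ccw_step (@left_tree M)) (root_dart M) u v.
Proof.
case=> k [ku kv]; exists k; rewrite iter_ccw_step (srcT HM); split=> // j jk.
by rewrite iter_ccw_step (srcT HM) kv.
Qed.

Lemma left_tour_le u v : inner v -> le u v -> u != v ->
  visits_before (ccw_step (@left_tree M)) (root_dart M) u v.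
Proof.
move=> vi uv nuv; apply: visits_before_ccw; move: vi uv nuv.
apply: (tour_le HM cutr_uniq cutr_mem cutr_step cutr_start cutr_fun
  mem_esr (mem_rouT HM) esr_par (srcT HM) _ nx_southY nx_innerY
  left_tree_out left_tree_in) => //.
by rewrite (srcC HM).
Qed.

Lemma left_tour_left u v : inner u -> inner v -> ~~ le u v -> ~~ le v u ->
  (forall l, cutr (not_above u v) l -> before l (lpar u) (lpar v)) ->
  visits_before (ccw_step (@left_tree M)) (root_dart M) u v.
Proof.
move=> ui vi uv vu h; apply: visits_before_ccw; move: ui vi uv vu h.
apply: (tour_left HM cutr_uniq cutr_mem cutr_step cutr_start cutr_fun
  mem_esr (mem_rouT HM) esr_par (srcT HM) _ nx_southY nx_innerY
  left_tree_out left_tree_in) => //.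
by rewrite (srcC HM).
Qed.

Lemma visit_rank_lt st u v : inner v -> visits_before st (root_dart M) u v ->
  visit_rank st u < visit_rank st v.
Proof.
move=> vi /index_first_visit h; apply: proper_card; apply/properP; split.
  apply/subsetP => w; rewrite !inE => /andP[-> wu] /=.
  exact: leq_trans wu (ltnW h).
by exists v; rewrite !inE vi //= -ltnNge.
Qed.

Definition left_of (u v : vertex M) :=
  exists2 l : seq (dart M), is_cut (not_above u v) l & before l (rpar u) (rpar v).

Section Incomparable.
Variables u v : vertex M.
Hypotheses (ui : inner u) (vi : inner v) (uv : ~~ le u v) (vu : ~~ le v u).

Lemma rpar_in w : inner w -> rpar w \in es w.
Proof. by case/es_rpar => s ->; rewrite mem_rcons mem_head. Qed.
Lemma lpar_in w : inner w -> lpar w \in es w.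
Proof. by case/es_lpar => s ->; rewrite mem_head. Qed.

Lemma not_above_es (l : seq (dart M)) : is_cut (not_above u v) l ->
  {subset es u <= l} /\ {subset es v <= l}.
Proof.
move=> cl; have dU := not_above_down HM ui vi.
have [A [B [e _]]] := cut_step HM dU cl (not_above_avail HM ui vu).
have avv : avail (not_above u v) v by rewrite not_above_sym; apply: (not_above_avail HM).
have [A' [B' [e' _]]] := cut_step HM dU cl avv.
by split=> x xe; [rewrite e|rewrite e']; rewrite !mem_cat xe orbT.
Qed.

Lemma es_disjoint (w w' : vertex M) d : w != w' -> d \in es w -> d \notin es w'.
Proof. by move=> ww; rewrite !(mem_es HM) => /andP[-> /eqP ->]. Qed.

(** Both fans are contiguous in the cut, so one pair in order puts all pairs in the same order. *)
Lemma left_of_all (l : seq (dart M)) : is_cut (not_above u v) l -> left_of u v ->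
  forall e f, e \in es u -> f \in es v -> before l e f.
Proof.
move=> cl [l0 cl0]; have dU := not_above_down HM ui vi.
rewrite (is_cut_fun HM dU cl0 cl) => b e f eu fv.
have avv : avail (not_above u v) v by rewrite not_above_sym; apply: (not_above_avail HM).
have [A [B [el _]]] := cut_step HM dU cl (not_above_avail HM ui vu).
have [A' [B' [el' _]]] := cut_step HM dU cl avv.
have nuv : u != v by apply: contraNneq uv => ->; apply: le_refl.
have ul := cut_uniqX cl; have asym x y := @before_asym _ l x y ul.
have ru := rpar_in ui; have rv := rpar_in vi.
have fnu : f \notin es u by apply: es_disjoint fv; rewrite eq_sym.
have ruA' : rpar u \in A'.
  have : rpar u \in l by rewrite el !mem_cat ru orbT.
  rewrite el' !mem_cat (negPf (es_disjoint nuv ru)) /= => /orP[//|rB].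
  by have := asym _ _ b; rewrite el' catA before_cat // mem_cat rv orbT.
have bf : before l (rpar u) f by rewrite el' before_cat // mem_cat fv.
have fB : f \in B.
  have : f \in l by rewrite el' !mem_cat fv orbT.
  rewrite el !mem_cat (negPf fnu) /= => /orP[fA|//].
  by have := asym _ _ bf; rewrite el before_cat // mem_cat ru.
by rewrite el catA before_cat // mem_cat eu orbT.
Qed.
End Incomparable.

Lemma left_of_total u v : inner u -> inner v -> ~~ le u v -> ~~ le v u ->
  left_of u v \/ left_of v u.
Proof.
move=> ui vi uv vu; have [l cl] := cut_exists (not_above_down HM ui vi).
have [su sv] := not_above_es ui vi uv vu cl.
have ne : rpar u != rpar v.
  have nuv : u != v by apply: contraNneq uv => ->; apply: le_refl.
  apply: contraTneq (rpar_in vi) => <-; exact: es_disjoint (rpar_in ui).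
have /orP[b|b] := before_total (su _ (rpar_in ui)) (sv _ (rpar_in vi)) ne.
  by left; exists l.
by right; exists l; rewrite // not_above_sym.
Qed.

Lemma xcoord_le (u v : vertex M) : inner v -> le u v -> u != v -> xcoord u < xcoord v.
Proof. by move=> vi uv nuv; apply: visit_rank_lt (right_tour_le vi uv nuv). Qed.
Lemma ycoord_le (u v : vertex M) : inner v -> le u v -> u != v -> ycoord u < ycoord v.
Proof. by move=> vi uv nuv; apply: visit_rank_lt (left_tour_le vi uv nuv). Qed.

Lemma xcoord_left (u v : vertex M) : inner u -> inner v -> ~~ le u v -> ~~ le v u ->
  left_of u v -> xcoord u < xcoord v.
Proof.
move=> ui vi uv vu h; apply: visit_rank_lt => //; apply: right_tour_left => // l cl.
by apply: left_of_all cl h _ _ _ _ => //; apply: rpar_in.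
Qed.
Lemma ycoord_left (u v : vertex M) : inner u -> inner v -> ~~ le u v -> ~~ le v u ->
  left_of u v -> ycoord v < ycoord u.
Proof.
move=> ui vi uv vu h; apply: visit_rank_lt => //; apply: left_tour_left => // l.
rewrite /cutr not_above_sym => cl.
have : before (rev l) (lpar u) (lpar v).
  by apply: left_of_all cl h _ _ _ _ => //; apply: lpar_in.
by rewrite /before -[l in X in _ -> X]revK -[[:: lpar v; _]]/(rev [:: lpar u; lpar v]) subseq_rev.
Qed.

(** Edges common to both cuts also leave [U :&: U'], and their order in its cut passes on to each of
    the two. *)
Lemma before_consistent U U' (l l' : seq (dart M)) e f : down U -> down U' ->
  is_cut U l -> is_cut U' l' -> before l e f -> ~~ before l' f e.
Proof.
move=> dU dU' cl cl' b; apply/negP => b'.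
have dI : down (U :&: U').
  case: dU dU' => SU NU dU [SU' NU' dU']; split; rewrite ?inE ?SU //.
    by rewrite (negPf NU).
  by move=> d od; rewrite !inE => /andP[/(dU _ od) -> /(dU' _ od) ->].
have [l0 cl0] := cut_exists dI.
have mem_l0 x : x \in l -> x \in l' -> x \in l0.
  rewrite (cut_memX cl) (cut_memX cl') (cut_memX cl0).
  by rewrite -![_ \in cut _]topredE /= /cut !in_setI => /and3P[-> -> /negPf ->] /and3P[_ -> _].
have tl x : x \in l -> tgt x \notin U by rewrite (cut_memX cl) => /and3P[].
have tl' x : x \in l' -> tgt x \notin U' by rewrite (cut_memX cl') => /and3P[].
have [el fl] := before_mem b; have [fl' el'] := before_mem b'.
have ne := before_neq (cut_uniqX cl) b.
have /orP[b0|b0] := before_total (mem_l0 _ el el') (mem_l0 _ fl fl') ne.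
  have := cut_before_mono dI dU' (subsetIr _ _) cl0 cl' (tl' _ el') (tl' _ fl') b0.
  by apply/negP; apply: before_asym (cut_uniqX cl') b'.
have := cut_before_mono dI dU (subsetIl _ _) cl0 cl (tl _ fl) (tl _ el) b0.
by apply/negP; apply: before_asym (cut_uniqX cl) b.
Qed.

Definition edge_before e f :=
  exists U, exists2 l : seq (dart M), down U /\ is_cut U l & before l e f.

Lemma edge_before_asym e f : edge_before e f -> edge_before f e -> False.
Proof.
by move=> [U [l [dU cl] b]] [U' [l' [dU' cl'] b']]; have := before_consistent dU dU' cl cl' b; rewrite b'.
Qed.

Lemma left_of_ins u v e f : inner u -> inner v -> ~~ le u v -> ~~ le v u ->
  left_of u v -> e \in es u -> f \in es v -> edge_before e f.
Proof.
move=> ui vi uv vu h eu fv; have dU := not_above_down HM ui vi.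
have [l cl] := cut_exists dU; exists (not_above u v), l => //.
exact: left_of_all cl h _ _ eu fv.
Qed.

(** Sweeping [u] and then [v] from [not_above u v] puts both outgoing fans into one cut, in the
    places of the ingoing ones. *)
Lemma left_of_outs u v o o' : inner u -> inner v -> ~~ le u v -> ~~ le v u ->
  left_of u v -> o \in outs u -> o' \in outs v -> edge_before o o'.
Proof.
move=> ui vi uv vu h ou ov; have dU := not_above_down HM ui vi.
have [l cl] := cut_exists dU; have b := left_of_all ui vi uv vu cl h.
have avu := not_above_avail HM ui vu.
have avv : avail (not_above u v) v by rewrite not_above_sym; apply: (not_above_avail HM vi uv).
have [A [B [el cl1]]] := cut_step HM dU cl avu.
have nuv : u != v by apply: contraNneq uv => ->; apply: le_refl.
have dU1 := down_step dU avu.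
have rv := rpar_in vi.
have rvB : rpar v \in B.
  have nru : rpar v \notin es u by apply: es_disjoint rv; rewrite eq_sym.
  have := b _ _ (rpar_in ui) rv => b1; have [_] := before_mem b1.
  rewrite el !mem_cat (negPf nru) /= => /orP[rA|//].
  have := before_asym (cut_uniqX cl) b1; by rewrite el before_cat // mem_cat rpar_in.
have avv1 : avail (u |: not_above u v) v.
  case: avv => vU vN av; split=> // [|d od td]; last by rewrite in_setU1 av ?orbT.
  by rewrite in_setU1 negb_or eq_sym nuv.
have [A' [B' [el1 cl2]]] := cut_step HM dU1 cl1 avv1.
have dU2 := down_step dU1 avv1.
have b1 : before (A ++ outs u ++ B) o (rpar v) by rewrite catA before_cat // mem_cat ou orbT.
have oA : o \in A'.
  have nov : o \notin es v.
    rewrite (mem_es HM); apply: contra uv => /andP[oo /eqP <-].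
    by move: ou; rewrite (mem_outs HM) => /andP[_ /eqP <-]; apply: le_arc.
  have [] := before_mem b1; rewrite {1}el1 !mem_cat (negPf nov) /= => /orP[//|oB] _.
  by have := before_asym (cut_uniqX cl1) b1; rewrite el1 catA before_cat // mem_cat rv orbT.
exists (v |: (u |: not_above u v)), (A' ++ outs v ++ B') => //.
by rewrite before_cat // mem_cat ov.
Qed.

Lemma outs_before_edge u o o' : before (outs u) o o' -> edge_before o o'.
Proof.
move=> b; have [ou _] := before_mem b.
have uN : u != N.
  by apply: contraTneq ou => ->; rewrite /outs (rouTN HM).
have [eu|uS] := eqVneq u S.
  rewrite eu in b; by exists [set S], (outs S) => //; split; [apply: down_south HM|apply: is_cut_south HM].
have ui : inner u by rewrite (innerE HM) uS.
have dU := not_above_down HM ui ui; have [l cl] := cut_exists dU.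
have av : avail (not_above u u) u.
  split=> //; first by rewrite inE le_refl.
  by move=> d od td; rewrite inE -td (arc_lt HM od).
have [A [B [el cl1]]] := cut_step HM dU cl av.
exists (u |: not_above u u), (A ++ outs u ++ B); last exact: before_widen.
by split=> //; apply: down_step.
Qed.

Lemma ins_before_edge u e e' : before (es u) e e' -> edge_before e e'.
Proof.
move=> b; have [eu _] := before_mem b.
have uS : u != S by apply: contraTneq eu => ->; rewrite /es (insS HM).
have [eN|uN] := eqVneq u N.
  rewrite eN in b; by exists (~: [set N]), (es N) => //; split; [apply: down_not_north HM|apply: is_cut_north HM].
have ui : inner u by rewrite (innerE HM) uS.
have dU := not_above_down HM ui ui; have [l cl] := cut_exists dU.
have av : avail (not_above u u) u.
  split=> //; first by rewrite inE le_refl.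
  by move=> d od td; rewrite inE -td (arc_lt HM od).
have [A [B [el _]]] := cut_step HM dU cl av.
by exists (not_above u u), l => //; rewrite el; apply: before_widen.
Qed.

Lemma incomparable_inner (u v : vertex M) : ~~ le u v -> ~~ le v u -> inner u.
Proof.
rewrite (innerE HM) => uv vu; apply/andP; split.
  by apply: contraNneq uv => ->; apply: le_south HM v.
by apply: contraNneq vu => ->; apply: le_north HM v.
Qed.

(** The heads are incomparable as no edge is transitive. Were they in the opposite order, so would
    be the two edges, as ingoing edges of the heads, against their order in the fan of [u]. *)
Lemma outs_left_of u o o' : before (outs u) o o' ->
  [/\ ~~ le (tgt o) (tgt o'), ~~ le (tgt o') (tgt o) & left_of (tgt o) (tgt o')].
Proof.
move=> b; have [] := before_mem b; rewrite !(mem_outs HM).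
case/andP=> oo /eqP so /andP[oo' /eqP so'].
have ne := before_neq (uniq_outs u) b.
have i1 : ~~ le (tgt o) (tgt o') by apply: (arcs_incomparable HM) => //; rewrite so.
have i2 : ~~ le (tgt o') (tgt o) by apply: (arcs_incomparable HM) => //; rewrite 1?eq_sym ?so.
have a1 := incomparable_inner i1 i2; have a2 := incomparable_inner i2 i1.
split=> //; have [//|h] := left_of_total a1 a2 i1 i2.
case: (@edge_before_asym o o'); first exact: outs_before_edge b.
by apply: left_of_ins a2 a1 i2 i1 h _ _; rewrite (mem_es HM) ?oo ?oo' eqxx.
Qed.

Lemma ins_left_of u e e' : before (es u) e e' ->
  [/\ ~~ le (src e) (src e'), ~~ le (src e') (src e) & left_of (src e) (src e')].
Proof.
move=> b; have [] := before_mem b; rewrite !(mem_es HM).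
case/andP=> oo /eqP so /andP[oo' /eqP so'].
have ne := before_neq (uniq_es HM u) b.
have i1 : ~~ le (src e) (src e') by apply: (arcs_incomparable_in HM) => //; rewrite so.
have i2 : ~~ le (src e') (src e) by apply: (arcs_incomparable_in HM) => //; rewrite 1?eq_sym ?so.
have a1 := incomparable_inner i1 i2; have a2 := incomparable_inner i2 i1.
split=> //; have [//|h] := left_of_total a1 a2 i1 i2.
case: (@edge_before_asym e e'); first exact: ins_before_edge b.
by apply: left_of_outs a2 a1 i2 i1 h _ _; rewrite (mem_outs HM) ?oo ?oo' eqxx.
Qed.

(** The tails order the two edges in one way and the heads in the other, while the order of two
    edges does not depend on the cut. *)
Lemma no_crossing (e f : dart M) : out e -> out f ->
  ~~ le (src f) (src e) -> ~~ le (src e) (src f) -> left_of (src f) (src e) ->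
  ~~ le (tgt e) (tgt f) -> ~~ le (tgt f) (tgt e) -> left_of (tgt e) (tgt f) -> False.
Proof.
move=> oe of_ s1 s2 sl t1 t2 tl.
have su := incomparable_inner s1 s2; have se := incomparable_inner s2 s1.
have tu := incomparable_inner t1 t2; have te := incomparable_inner t2 t1.
apply: (@edge_before_asym f e).
  by apply: (left_of_outs su se s1 s2 sl); rewrite (mem_outs HM) ?oe ?of_ eqxx.
by apply: (left_of_ins tu te t1 t2 tl); rewrite (mem_es HM) ?oe ?of_ eqxx.
Qed.

End Left.

(** * Dominance diagrams *)

Section Next.
Variables (T : eqType) (key : T -> nat).

(** Describing [next] by keys alone lets the later arguments about [diag_turn] ignore the sorted
    list. *)
Lemma next_sorted (l : seq T) x : sorted ltn [seq key y | y <- l] -> x \in l ->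
  (key x < key (next l x) /\ forall z, z \in l -> ~~ (key x < key z < key (next l x))) \/
  (forall z, z \in l -> key (next l x) <= key z <= key x).
Proof.
move=> so xl; have /(sorted_uniq ltn_trans ltnn)/map_uniq ul := so.
case/splitPr: xl so ul => A B so ul.
have -> : next (A ++ x :: B) x = head x (B ++ A).
  rewrite -(next_rot (size A)) // rot_size_cat /= .
  by case: (B ++ A) => [|y s] /=; rewrite eqxx.
move: so; rewrite map_cat (sorted_pairwise ltn_trans) pairwise_cat /=.
case/and3P=> AB pA /andP[xB pB]; case: B AB xB pB {ul} => [|y B] AB xB pB /=.
  have h z : z \in A -> key z < key x.
    by move=> zA; move/allrelP: AB => /(_ (key z) (key x)) -> //; rewrite ?map_f ?mem_head.
  right; case: A AB pA h => [|y A] _ pA h z /=.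
    by rewrite inE => /eqP ->; rewrite leqnn.
  rewrite -cat_cons mem_cat !inE => /orP[/predU1P[->|zA]|/eqP ->].
  - by rewrite leqnn ltnW ?h ?mem_head.
  - move: pA => /= /andP[/allP/(_ (key z)) /= yz _].
    have h1 : key y < key z by apply: yz; apply: map_f.
    have h2 : key z < key x by apply: h; rewrite inE zA orbT.
    by rewrite (ltnW h1) ltnW.
  by rewrite leqnn ltnW // h ?mem_head.
left; case/andP: xB => xy _; split=> // z; rewrite mem_cat => /orP[zA|].
  have : key z < key x.
    by move/allrelP: AB => /(_ (key z) (key x)) -> //; rewrite ?map_f ?mem_head.
  by move=> zx; rewrite (ltnNge (key x)) (ltnW zx).
rewrite !inE => /predU1P[->|/predU1P[->|zB]]; rewrite ?ltnn ?andbF //.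
move: pB => /= /andP[/allP/(_ (key z)) /= yz _].
have h1 : key y < key z by apply: yz; apply: map_f.
by rewrite (ltnNge (key z)) (ltnW h1) andbF.
Qed.
End Next.

Section Cross.
Import Order.TTheory GRing.Theory Num.Theory.
Local Open Scope ring_scope.

Lemma cross_lt (x y x' y' : int) : 0 <= x -> 0 <= y' -> x < x' -> y' < y ->
  x * y' - y * x' < 0.
Proof. by move=> x0 y0 xx yy; rewrite subr_lt0 [y * _]mulrC ltr_pM. Qed.

Lemma cross_gt (x y x' y' : int) : 0 <= x' -> 0 <= y -> x' < x -> y < y' ->
  0 < x * y' - y * x'.
Proof. by move=> x0 y0 xx yy; rewrite subr_gt0 [y * _]mulrC ltr_pM. Qed.

Lemma cross_opp (x y x' y' : int) : x * y' - y * x' = - x * - y' - (- y) * - x'.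
Proof. by rewrite !mulrNN. Qed.
End Cross.

Section Covers.
Variables (m : nat) (t : 'S_m).
Implicit Types i j k : 'I_m.
Notation cov := (covered_by t).
Notation dom := (dominated t).

Lemma val_perm_inj i j : t i = t j :> nat -> i = j.
Proof. by move/val_inj/perm_inj. Qed.

Lemma dom_trans i j k : dom i j -> dom j k -> dom i k.
Proof. by case/andP=> a b /andP[c d]; rewrite /dominated (leq_trans a c) (leq_trans b d). Qed.
Lemma dom_refl i : dom i i. Proof. by rewrite /dominated !leqnn. Qed.
Lemma dom_lt i j : dom i j -> i != j -> i < j /\ t i < t j.
Proof.
case/andP=> ij tij ne; rewrite !ltn_neqAle ij tij !andbT; split; first by [].
by apply: contra ne => /eqP/val_perm_inj ->.
Qed.
Lemma cov_lt i j : cov i j -> i < j /\ t i < t j.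
Proof. by case/and3P=> ne d _; apply: dom_lt. Qed.
Lemma cov_dom i j : cov i j -> dom i j. Proof. by case/and3P. Qed.
Lemma cov_between i j k : cov i j -> dom i k -> dom k j -> k = i \/ k = j.
Proof.
case/and3P=> _ _ /forallP/(_ k)/implyP h ik kj.
by case/orP: (h (introT andP (conj ik kj))) => /eqP; [left|right].
Qed.
Lemma cov_gap i j k : cov i j -> i < k < j -> ~~ (t i < t k < t j).
Proof.
move=> c /andP[ik kj]; apply/negP => /andP[tik tkj].
have [||e|e] := @cov_between i j k c; rewrite /dominated.
- by rewrite (ltnW ik) (ltnW tik).
- by rewrite (ltnW kj) (ltnW tkj).
- by rewrite e ltnn in ik.
- by rewrite e ltnn in kj.
Qed.

Lemma dom_first i j : dom i j -> i != j -> exists2 k, cov i k & dom k j.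
Proof.
move=> ij ne; have P0 : [pred k | [&& dom i k, k != i & dom k j]] j.
  by rewrite /= ij eq_sym ne dom_refl.
case: (arg_minnP (fun k : 'I_m => val k) P0) => k /and3P[ik ki kj] kmin; exists k => //.
apply/and3P; split=> //; first by rewrite eq_sym.
apply/forallP => l; apply/implyP => /andP[il lk]; apply/orP.
have [->|li] := eqVneq l i; [by left|right].
rewrite -val_eqE eqn_leq kmin /= ?il ?li ?(dom_trans lk kj) // andbT.
by case/andP: lk.
Qed.

Lemma dom_last i j : dom i j -> i != j -> exists2 k, cov k j & dom i k.
Proof.
move=> ij ne; have P0 : [pred k | [&& dom i k, k != j & dom k j]] i.
  by rewrite /= ij ne dom_refl.
case: (arg_maxnP (fun k : 'I_m => val k) P0) => k /and3P[ik ki kj] kmax; exists k => //.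
apply/and3P; split=> //.
apply/forallP => l; apply/implyP => /andP[kl lj]; apply/orP.
have [->|li] := eqVneq l j; [by right|left].
rewrite -val_eqE eqn_leq [X in X && _]kmax /= ?lj ?li ?(dom_trans ik kl) //.
by case/andP: kl.
Qed.

Lemma cov_outs i j k : cov i j -> cov i k -> j < k -> t k < t j.
Proof.
move=> ij ik jk; rewrite ltnNge; apply/negP => tjk.
have [i1 _] := cov_lt ij; have ji : j != i by rewrite -val_eqE /=; lia.
have [||e|e] := @cov_between i k j ik; rewrite ?(cov_dom ij) /dominated ?tjk ?(ltnW jk) //.
  by rewrite e eqxx in ji.
by rewrite e ltnn in jk.
Qed.
Lemma cov_ins i j k : cov j i -> cov k i -> j < k -> t k < t j.
Proof.
move=> ji ki jk; rewrite ltnNge; apply/negP => tjk.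
have [i1 _] := cov_lt ki; have ne : k != i by rewrite -val_eqE /=; lia.
have [||e|e] := @cov_between j i k ji; rewrite ?(cov_dom ki) /dominated ?tjk ?(ltnW jk) //.
  by rewrite e ltnn in jk.
by rewrite e eqxx in ne.
Qed.

Notation ddart := (diag_dart t).
Definition dtgt (d : ddart) : 'I_m := (val d).2.
Implicit Types d e : ddart.

Lemma diag_outN d : ~~ diag_out d -> cov (dtgt d) (diag_src d).
Proof. by rewrite /diag_out; case/orP: (valP d) => ->. Qed.
Lemma diag_out_lt d : diag_out d -> diag_src d < dtgt d /\ t (diag_src d) < t (dtgt d).
Proof. exact: cov_lt. Qed.
Lemma diag_outN_lt d : ~~ diag_out d -> dtgt d < diag_src d /\ t (dtgt d) < t (diag_src d).
Proof. by move/diag_outN/cov_lt. Qed.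

(* Around a point, the argument of a segment decreases with the abscissa of the
   other end above the point, and increases with it below. *)
Definition key d : nat := if diag_out d then m - dtgt d else m + dtgt d.

Lemma dart_eq d e : diag_src d = diag_src e -> dtgt d = dtgt e -> d = e.
Proof.
move=> s g; apply: val_inj; move: s g; rewrite /diag_src /dtgt.
by case: (val d) (val e) => [? ?] [? ?] /= -> ->.
Qed.

Lemma key_inj d e : diag_src d = diag_src e -> key d = key e -> d = e.
Proof.
move=> s k; apply: dart_eq => //; apply: val_inj; move: k; rewrite /key /=.
have := ltn_ord (dtgt d); have := ltn_ord (dtgt e).
case od: (diag_out d); case oe: (diag_out e); lia.
Qed.

Import Order.TTheory GRing.Theory Num.Theory.
(** Within one half-plane the other ends form an antichain, so abscissae and ordinates vary in
    opposite senses and a comparison of abscissae gives the sign of the cross product. Outgoing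
    darts have keys below [m] and ingoing ones at least [m], in accordance with the half-planes. *)
Lemma angle_key d e : diag_src d = diag_src e -> angle_le d e = (key d <= key e).
Proof.
move=> s; have up (c : ddart) : (0 < diag_dy c)%R = diag_out c.
  rewrite /diag_dy -[(val c).2]/(dtgt c) -[(val c).1]/(diag_src c).
  case oc: (diag_out c); first by have [_] := diag_out_lt oc; lia.
  by have [_] := diag_outN_lt (negbT oc); lia.
rewrite /angle_le !up /key; have := ltn_ord (dtgt d); have := ltn_ord (dtgt e).
rewrite /diag_dx /diag_dy.
rewrite -[(val d).2]/(dtgt d) -[(val e).2]/(dtgt e) -[(val d).1]/(diag_src d) -[(val e).1]/(diag_src e).
rewrite -s; case od: (diag_out d); case oe: (diag_out e) => /=.
- have [a b] := diag_out_lt od; have [a' b'] := diag_out_lt oe; rewrite -s in a' b'.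
  move=> me md; have [c|c|c] := ltngtP (dtgt d) (dtgt e).
  + have h : t (dtgt e) < t (dtgt d) by apply: (@cov_outs (diag_src d)) => //; rewrite s.
    by rewrite leNgt cross_lt //; lia.
  + have h : t (dtgt d) < t (dtgt e) by apply: (@cov_outs (diag_src d)) => //; rewrite s.
    by rewrite ltW ?cross_gt //; lia.
  by rewrite (val_inj c) mulrC subrr lexx leqnn.
- by have [a b] := diag_out_lt od; lia.
- by have [a b] := diag_out_lt oe; lia.
have [a b] := diag_outN_lt (negbT od); have [a' b'] := diag_outN_lt (negbT oe).
rewrite -s in a' b'; move=> me md; have [c|c|c] := ltngtP (dtgt d) (dtgt e).
- have h : t (dtgt e) < t (dtgt d).
    apply: (@cov_ins (diag_src d)) => //; first exact: diag_outN (negbT od).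
    by rewrite s; apply: diag_outN (negbT oe).
  by rewrite cross_opp ltW ?cross_gt //; lia.
- have h : t (dtgt d) < t (dtgt e).
    apply: (@cov_ins (diag_src d)) => //; last exact: diag_outN (negbT od).
    by rewrite s; apply: diag_outN (negbT oe).
  by rewrite cross_opp leNgt cross_lt //; lia.
by rewrite (val_inj c) mulrC subrr lexx leqnn.
Qed.

Lemma mem_darts_at i d : (d \in darts_at t i) = (diag_src d == i).
Proof. by rewrite mem_sort mem_filter mem_enum andbT. Qed.

Lemma darts_at_sorted i : sorted ltn [seq key d | d <- darts_at t i].
Proof.
have ul : uniq (darts_at t i) by rewrite sort_uniq filter_uniq ?enum_uniq.
rewrite ltn_sorted_uniq_leq; apply/andP; split.
  rewrite map_inj_in_uniq // => d e; rewrite !mem_darts_at => /eqP sd /eqP se.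
  by apply: key_inj; rewrite sd se.
rewrite sorted_map.
have all_at : all [pred d | diag_src d == i] (darts_at t i).
  by apply/allP => d; rewrite mem_darts_at.
rewrite -(@eq_in_sorted _ [pred d | diag_src d == i] (@angle_le m t)) //.
  apply: (@sort_sorted_in _ [pred d | diag_src d == i]).
    move=> d e /eqP sd /eqP se; rewrite !angle_key ?sd ?se //; exact: leq_total.
  by apply/allP => d; rewrite mem_filter => /andP[].
by move=> d e /eqP sd /eqP se; rewrite angle_key ?sd ?se.
Qed.

Lemma src_diag_turn d : diag_src (diag_turn d) = diag_src d.
Proof.
apply/eqP; rewrite -mem_darts_at /diag_turn mem_next mem_darts_at eqxx //.
Qed.

Lemma diag_turn_spec d (e := diag_turn d) :
  (key d < key e /\ forall z, diag_src z = diag_src d -> ~~ (key d < key z < key e)) \/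
  (forall z, diag_src z = diag_src d -> key e <= key z <= key d).
Proof.
have din : d \in darts_at t (diag_src d) by rewrite mem_darts_at.
have [[lt h]|h] := next_sorted (darts_at_sorted (diag_src d)) din; [left|right].
  by split=> // z sz; apply: h; rewrite mem_darts_at sz.
by move=> z sz; apply: h; rewrite mem_darts_at sz.
Qed.

Lemma diag_turn_next d e : diag_src e = diag_src d -> key d < key e ->
  (forall z, diag_src z = diag_src d -> ~~ (key d < key z < key e)) -> diag_turn d = e.
Proof.
move=> se de h; have sT := src_diag_turn d; apply: key_inj; first by rewrite sT.
have [[lt h']|h'] := diag_turn_spec d.
  by have := h' e se; have := h _ sT; rewrite de lt /=; lia.
by have := h' e se; lia.
Qed.

Lemma diag_turn_wrap d e : diag_src e = diag_src d ->
  (forall z, diag_src z = diag_src d -> key e <= key z <= key d) -> diag_turn d = e.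
Proof.
move=> se h; have sT := src_diag_turn d; apply: key_inj; first by rewrite sT.
have [[lt h']|h'] := diag_turn_spec d.
  by have := h _ sT; lia.
by have := h' e se; have := h _ sT; lia.
Qed.

End Covers.

(** * From plane bipolar posets to plane permutations *)

Section Completion.
Variable n : nat.

Definition inner_index (i : 'I_n) : 'I_n.+2 := lift ord_max (lift ord0 i).

Arguments inner_index : simpl never.

Lemma val_inner_index i : inner_index i = i.+1 :> nat.
Proof. by rewrite /inner_index lift_max. Qed.

Lemma inner_indexP (j : 'I_n.+2) : 0 < j < n.+1 -> exists i, j = inner_index i.
Proof.
case/andP=> j0 jn; have jn' : j.-1 < n by lia.
by exists (Ordinal jn'); apply: val_inj; rewrite [RHS]val_inner_index /=; lia.
Qed.

Lemma completion_val (s : 'S_n) i : completion s (inner_index i) = (s i).+1 :> nat.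
Proof. by rewrite /inner_index completion_inner val_inner_index. Qed.

Lemma completion_surj (t : 'S_n.+2) : t ord0 = ord0 -> t ord_max = ord_max ->
  exists s : 'S_n, completion s = t.
Proof.
move=> t0 tm; have tin i : 0 < t (inner_index i) < n.+1.
  have a : t (inner_index i) != ord0.
    by rewrite -t0 (inj_eq perm_inj) -val_eqE [X in X != _]val_inner_index.
  have b : t (inner_index i) != ord_max.
    rewrite -tm (inj_eq perm_inj) -val_eqE [X in X != _]val_inner_index eqSS.
    by have := ltn_ord i; lia.
  move: a b; rewrite -!val_eqE /=; have := ltn_ord (t (inner_index i)); lia.
have lt i : (t (inner_index i)).-1 < n by have := tin i; lia.
have inj : injective (fun i => Ordinal (lt i)).
  move=> i j [e]; have := tin i; have := tin j => hj hi.
  have /val_inj/perm_inj : val (t (inner_index i)) = val (t (inner_index j)) by rewrite /=; lia.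
  by move/lift_inj/lift_inj.
exists (perm inj); apply/permP => j.
have [->|j0] := eqVneq j ord0; first by rewrite completion0 t0.
have [->|jm] := eqVneq j ord_max; first by rewrite completion_max tm.
have [|i ->] := @inner_indexP j.
  by move: j0 jm; rewrite -!val_eqE /=; have := ltn_ord j; lia.
apply: val_inj; rewrite [LHS]completion_val permE /=; have := tin i; lia.
Qed.
End Completion.

Section Coordinates.
Variables (n : nat) (M : rooted_map).
Hypothesis HM : plane_bipolar_poset M n.
Notation S := (south M).
Notation N := (north M).

Lemma visit_rank_bounds st (v : vertex M) : inner v -> 0 < visit_rank st v <= n.
Proof.
move=> vi; apply/andP; split.
  by rewrite card_gt0; apply/set0Pn; exists v; rewrite inE vi leqnn.
rewrite -(card_innerE HM); apply: subset_leq_card; apply/subsetP => w.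
by rewrite !inE => /andP[].
Qed.

Definition coord (r : vertex M -> nat) v := if v == S then 0 else if v == N then n.+1 else r v.
Definition px := coord (@xcoord M).
Definition py := coord (@ycoord M).

Lemma px_inner (v : vertex M) : inner v -> px v = xcoord v.
Proof. by rewrite (innerE HM) /px /coord => /andP[/negPf -> /negPf ->]. Qed.
Lemma py_inner (v : vertex M) : inner v -> py v = ycoord v.
Proof. by rewrite (innerE HM) /py /coord => /andP[/negPf -> /negPf ->]. Qed.
Lemma pxS : px S = 0. Proof. by rewrite /px /coord eqxx. Qed.
Lemma pyS : py S = 0. Proof. by rewrite /py /coord eqxx. Qed.
Lemma pxN : px N = n.+1.
Proof. by rewrite /px /coord eqxx eq_sym (negPf (south_neq_north HM)). Qed.
Lemma pyN : py N = n.+1.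
Proof. by rewrite /py /coord eqxx eq_sym (negPf (south_neq_north HM)). Qed.

Variant vertex_spec (v : vertex M) : Prop :=
| Vertex_south of v = S
| Vertex_north of v = N
| Vertex_inner of inner v.

Lemma vertexP (v : vertex M) : vertex_spec v.
Proof.
have [->|vS] := eqVneq v S; first exact: Vertex_south.
have [->|vN] := eqVneq v N; first exact: Vertex_north.
by apply: Vertex_inner; rewrite (innerE HM) vS.
Qed.

Lemma inner_bounds (v : vertex M) : inner v -> 0 < px v <= n /\ 0 < py v <= n.
Proof.
by move=> vi; rewrite px_inner // py_inner //; split; apply: visit_rank_bounds.
Qed.

Lemma coord_bound v : px v < n.+2 /\ py v < n.+2.
Proof.
case: (vertexP v) => [->|->|vi]; rewrite ?pxS ?pyS ?pxN ?pyN //.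
by have [] := inner_bounds vi; lia.
Qed.

Lemma coord_le u v : le u v -> u != v -> px u < px v /\ py u < py v.
Proof.
move=> uv nuv; case: (vertexP v) => [ev|ev|vi].
- case/eqP: nuv; rewrite ev in uv *; exact: (le_anti HM uv (le_south HM u)).
- rewrite ev in nuv *; rewrite pxN pyN; case: (vertexP u) => [->|eu|ui]; rewrite ?pxS ?pyS //.
    by rewrite eu eqxx in nuv.
  by have [] := inner_bounds ui; lia.
case: (vertexP u) => [->|eu|ui].
- by rewrite pxS pyS; have [] := inner_bounds vi; lia.
- case/eqP: nuv; rewrite eu in uv *; exact: (le_anti HM uv (le_north HM v)).
by rewrite !px_inner ?py_inner // (xcoord_le HM) ?(ycoord_le HM).
Qed.

Lemma coord_left u v : ~~ le u v -> ~~ le v u -> left_of u v ->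
  px u < px v /\ py v < py u.
Proof.
move=> uv vu h; have ui := incomparable_inner HM uv vu.
have vi := incomparable_inner HM vu uv.
by rewrite !px_inner ?py_inner // (xcoord_left HM) ?(ycoord_left HM).
Qed.

Variant compare_spec u v : Prop :=
| Compare_eq of u = v
| Compare_le of le u v & px u < px v & py u < py v
| Compare_ge of le v u & px v < px u & py v < py u
| Compare_left of ~~ le u v & ~~ le v u & left_of u v & px u < px v & py v < py u
| Compare_right of ~~ le u v & ~~ le v u & left_of v u & px v < px u & py u < py v.

Lemma vertex_compareP u v : compare_spec u v.
Proof.
have [->|nuv] := eqVneq u v; first exact: Compare_eq.
have [uv|uv] := boolP (le u v).
  by have [] := coord_le uv nuv; apply: Compare_le.
have [vu|vu] := boolP (le v u).
  by have [] := coord_le vu; [rewrite eq_sym|apply: Compare_ge].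
have ui := incomparable_inner HM uv vu; have vi := incomparable_inner HM vu uv.
have [h|h] := left_of_total HM ui vi uv vu.
  by have [] := coord_left uv vu h; apply: Compare_left.
by have [] := coord_left vu uv h; apply: Compare_right.
Qed.

Lemma leE u v : le u v = (px u <= px v) && (py u <= py v).
Proof.
case: (vertex_compareP u v) => [->|-> ? ?|h lx ?|/negPf -> ? ? ? ?|/negPf -> ? ? ? ?]; try lia.
  by rewrite le_refl !leqnn.
have [uv|_] := boolP (le u v); last lia.
by move: lx; rewrite (le_anti HM uv h) ltnn.
Qed.

Lemma left_ofP u v : px u < px v -> py v < py u -> [/\ ~~ le u v, ~~ le v u & left_of u v].
Proof. by case: (vertex_compareP u v) => [->|? ? ?|? ? ?|? ? ? ? ?|? ? ? ? ?] //; lia. Qed.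

Lemma px_inj : injective px.
Proof. by move=> u v; case: (vertex_compareP u v) => // ? ? ?; lia. Qed.
Lemma py_inj : injective py.
Proof. by move=> u v; case: (vertex_compareP u v) => // ? ? ?; lia. Qed.

Definition posx v : 'I_n.+2 := Ordinal (proj1 (coord_bound v)).
Definition posy v : 'I_n.+2 := Ordinal (proj2 (coord_bound v)).

Lemma posx_inj : injective posx. Proof. by move=> u v [/px_inj]. Qed.
Lemma posy_inj : injective posy. Proof. by move=> u v [/py_inj]. Qed.

Lemma posx_bij : bijective posx.
Proof.
apply: inj_card_bij posx_inj _; rewrite card_ord; by case: HM => _ _ ->.
Qed.

Lemma perm_of_map : exists s : 'S_n, forall v, completion s (posx v) = posy v.
Proof.
have [vtx vtxK posxK] := posx_bij.
have inj : injective (posy \o vtx) by apply: inj_comp posy_inj (can_inj posxK).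
have t v : perm inj (posx v) = posy v by rewrite permE /= vtxK.
have [||s e] := @completion_surj n (perm inj).
- have <- : posx S = ord0 by apply: val_inj; rewrite /= pxS.
  by rewrite t; apply: val_inj; rewrite /= pyS pxS.
- have <- : posx N = ord_max by apply: val_inj; rewrite /= pxN.
  by rewrite t; apply: val_inj; rewrite /= pyN pxN.
by exists s => v; rewrite e t.
Qed.

Variable s : 'S_n.
Hypothesis sE : forall v, completion s (posx v) = posy v.
Notation t := (completion s).

Lemma vertex_at (j : 'I_n.+2) : exists2 v, posx v = j & px v = j.
Proof. by have [vtx _ h] := posx_bij; exists (vtx j); rewrite ?h // -[in RHS](h j). Qed.

Lemma vertex_of_index (i : 'I_n) : exists v, [/\ inner v, px v = i.+1 & py v = (s i).+1].
Proof.
have [v ev pv] := vertex_at (inner_index i); rewrite val_inner_index in pv.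
have yv : py v = (s i).+1 by rewrite -completion_val -ev sE.
exists v; split=> //; case: (vertexP v) => // e; move: pv; rewrite e ?pxS ?pxN //.
by move=> [ni]; have := ltn_ord i; rewrite -ni ltnn.
Qed.

Lemma index_of_vertex v : inner v -> exists i : 'I_n, px v = i.+1 /\ py v = (s i).+1.
Proof.
move=> vi; have [|i e] := @inner_indexP n (posx v).
  by have [] := inner_bounds vi; rewrite /=; lia.
exists i; split; first by rewrite -(val_inner_index i) -e.
by rewrite -completion_val -e sE.
Qed.

Lemma perm_points_inj (s1 s2 : 'S_n) : perm_eq (perm_points s1) (perm_points s2) -> s1 = s2.
Proof.
move=> /perm_mem h; apply/permP => i; have := h ((i : nat).+1, (s1 i : nat).+1).
have -> : ((i : nat).+1, (s1 i : nat).+1) \in perm_points s1 by apply: image_f.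
by move/esym/imageP => [j _ [/val_inj -> /val_inj]].
Qed.

Lemma Psi_of_map : Psi n M = Some s.
Proof.
have pe : perm_eq (perm_points s) [seq (xcoord v, ycoord v) | v in @inner M].
  apply: uniq_perm.
  - by rewrite map_inj_uniq ?enum_uniq // => i j [/val_inj].
  - rewrite map_inj_in_uniq ?enum_uniq // => u v; rewrite !mem_enum => ui vi [+ _].
    by rewrite -!px_inner //; apply: px_inj.
  move=> c; apply/imageP/imageP => [[i _ ->]|[v vi ->]].
    have [v [vi xv yv]] := vertex_of_index i.
    by exists v => //; rewrite -px_inner // -py_inner // xv yv.
  have [i [xv yv]] := index_of_vertex vi.
  by exists i => //; rewrite -px_inner // -py_inner // xv yv.
rewrite /Psi; case: pickP => [s' pe'|/(_ s)]; last by rewrite pe.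
congr Some; apply: perm_points_inj; rewrite (perm_trans pe') //.
by rewrite perm_sym.
Qed.

(** Having consecutive abscissae, [b] and [b'] are joined by an arc. Let [w] be the lower end of an
    arc into [c] with [a] below [w]. If [w] is to the left of [b], the two arcs cross; if it is to
    the right, [w] can take the place of [c] and is lower. Hence the induction on [py c]. *)
Lemma no_pattern c a b b' : px a < px b -> px b' = (px b).+1 -> px b' < px c ->
  py b < py a -> py a < py c -> py c < py b' -> False.
Proof.
have [k] := ubnP (py c); elim: k c => // k IH c; rewrite ltnS => ck ab bb bc ba ac cb.
have lbb : le b b' by rewrite leE; lia.
have nbb : b != b' by apply/eqP => e; move: bb; rewrite e; lia.
have [d [od sd db]] := le_first lbb nbb.
have td : tgt d = b'.
  apply: px_inj; have := le_arc od; move: db; rewrite !leE sd.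
  have [] := coord_le (le_arc od) (arc_neq HM od); rewrite sd; lia.
have lac : le a c by rewrite leE; lia.
have nac : a != c by apply/eqP => e; move: ac; rewrite e ltnn.
have [f [of_ tf af]] := le_last lac nac.
have [wx wy] := coord_le (le_arc of_) (arc_neq HM of_); rewrite tf in wx wy.
set w := src f in af wx wy.
have aw : px a <= px w /\ py a <= py w by move: af; rewrite leE => /andP[].
have [t1 t2 tl] : [/\ ~~ le b' c, ~~ le c b' & left_of b' c] by apply: left_ofP.
have [wb|bw|e] := ltngtP (px w) (px b).
- have [s1 s2 sl] : [/\ ~~ le w b, ~~ le b w & left_of w b].
    by apply: left_ofP => //; case: aw => _; apply: leq_trans.
  by apply: (no_crossing HM od of_); rewrite ?sd ?td ?tf.
- have nw : px w != px b'.
    by apply/eqP => /px_inj e; have := ltn_trans wy cb; rewrite e ltnn.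
  have na : py a != py w.
    by apply/eqP => /py_inj e; have := ltn_trans ab bw; rewrite -e ltnn.
  apply: (IH w) => //.
  + exact: leq_trans wy ck.
  + by rewrite ltn_neqAle eq_sym nw bb.
  + by rewrite ltn_neqAle na; case: aw.
  + exact: ltn_trans wy cb.
move/px_inj: e => e; have [_ h] := aw; rewrite e in h.
by have := leq_ltn_trans h ba; rewrite ltnn.
Qed.

Lemma plane_of_map : plane_perm s.
Proof.
apply/forallP => i; apply/forallP => j; apply/forallP => j'; apply/forallP => k.
apply/implyP => /and3P[ij /eqP jj jk]; apply/negP => /and3P[ji ik kj].
have [a [_ ax ay]] := vertex_of_index i; have [b [_ bx by_]] := vertex_of_index j.
have [b' [_ bx' by']] := vertex_of_index j'; have [c [_ cx cy]] := vertex_of_index k.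
by apply: (@no_pattern c a b b'); lia.
Qed.

Lemma dominatedE u v : dominated t (posx u) (posx v) = le u v.
Proof. by rewrite leE /dominated !sE. Qed.

(** * The isomorphism onto the diagram *)

Lemma arc_covered (d : dart M) : out d -> covered_by t (posx (src d)) (posx (tgt d)).
Proof.
move=> od; apply/and3P; split.
- by rewrite (inj_eq posx_inj) (arc_neq HM od).
- by rewrite dominatedE le_arc.
apply/forallP => k; have [w <- _] := vertex_at k; rewrite !dominatedE !(inj_eq posx_inj).
by apply/implyP => /andP[dw wd]; case: (arc_cover HM od dw wd) => ->; rewrite eqxx ?orbT.
Qed.

Lemma covered_arc u v : covered_by t (posx u) (posx v) ->
  exists d : dart M, [/\ out d, src d = u & tgt d = v].
Proof.
case/and3P; rewrite (inj_eq posx_inj) dominatedE => ne uv /forallP h.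
have [d [od sd dv]] := le_first uv ne; exists d; split=> //.
have := h (posx (tgt d)); rewrite !dominatedE dv !(inj_eq posx_inj) -sd le_arc //=.
by rewrite eq_sym (negPf (arc_neq HM od)) => /eqP.
Qed.

Lemma covered_out (d : dart M) : covered_by t (posx (src d)) (posx (tgt d)) = out d.
Proof.
have [od|od] := boolP (out d); first exact: arc_covered.
apply/negP => /cov_lt[lt _].
have ot : out (twin d) by rewrite (out_twin HM).
have [] := coord_le (le_arc ot) (arc_neq HM ot); rewrite (tgt_twin HM).
rewrite -[src (twin d)]/(tgt d); move: lt => /=; lia.
Qed.

Lemma diag_subproof (d : dart M) :
  covered_by t (posx (src d)) (posx (tgt d)) || covered_by t (posx (tgt d)) (posx (src d)).
Proof.
have [od|od] := boolP (out d); first by rewrite arc_covered.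
by apply/orP; right; rewrite -(tgt_twin HM d) arc_covered // (out_twin HM).
Qed.

Definition to_diag (d : dart M) : diag_dart t :=
  exist _ (posx (src d), posx (tgt d)) (diag_subproof d).

Lemma to_diag_out d : diag_out (to_diag d) = out d.
Proof. exact: covered_out. Qed.

Lemma to_diag_inj : injective to_diag.
Proof.
move=> d e h; have oo : out d = out e by rewrite -!to_diag_out h.
case: h => /px_inj sd /px_inj td; have [od|od] := boolP (out d).
  by apply: (arc_inj HM) => //; rewrite -oo.
apply: (twin_inj HM); apply: (arc_inj HM); rewrite ?(out_twin HM) -?oo //.
by rewrite !(tgt_twin HM).
Qed.

Lemma to_diag_surj e : exists d, to_diag d = e.
Proof.
have [u eu _] := vertex_at (val e).1; have [v ev _] := vertex_at (val e).2.
case/orP: (valP e); rewrite -eu -ev => /covered_arc[d [od sd td]].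
  by exists d; apply: val_inj; rewrite [RHS]surjective_pairing -eu -ev -sd -td.
by exists (twin d); apply: val_inj; rewrite [RHS]surjective_pairing -eu -ev -sd -td /= (tgt_twin HM).
Qed.

Lemma to_diag_bij : bijective to_diag.
Proof.
have surj e : exists d, to_diag d == e by have [d <-] := to_diag_surj e; exists d.
have gK e : to_diag (xchoose (surj e)) = e by apply/eqP/(xchooseP (surj e)).
by exists (fun e => xchoose (surj e)) => // d; apply: to_diag_inj; rewrite gK.
Qed.

Lemma key_to_diag d :
  key (to_diag d) = if out d then n.+2 - px (tgt d) else n.+2 + px (tgt d).
Proof. by rewrite /key to_diag_out. Qed.

Lemma sorted_ins v : sorted ltn [seq key (to_diag d) | d <- ins v].
Proof.
apply/(pairwise_sorted); rewrite pairwise_map; apply/(pairwiseP (root_dart M)) => i j.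
rewrite !inE => il jl ij; set d := nth _ _ i; set e := nth _ _ j.
have du : d \in ins v by apply: mem_nth.
have eu : e \in ins v by apply: mem_nth.
have b : before (es v) (twin d) (twin e).
  rewrite /before -[[:: _; _]]/(map (@twin M) [:: d; e]) map_subseq //.
  rewrite -[ins v](cat_take_drop j) -[[:: d; e]]/([:: d] ++ [:: e]) cat_subseq // sub1seq.
    by rewrite /d -(nth_take _ ij) mem_nth // size_take jl.
  by rewrite (drop_nth (root_dart M)) // mem_head.
have [i1 i2 l] := ins_left_of HM b.
rewrite /= !key_to_diag; move: du eu; rewrite !(mem_ins HM) => /andP[/negPf -> _] /andP[/negPf -> _].
have [lt _] := coord_left i1 i2 l; move: lt; rewrite -/(tgt d) -/(tgt e); lia.
Qed.

Lemma sorted_rouT v : sorted ltn [seq key (to_diag d) | d <- rouT v].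
Proof.
apply/(pairwise_sorted); rewrite pairwise_map; apply/(pairwiseP (root_dart M)) => i j.
rewrite !inE => il jl ij; set d := nth _ _ i; set e := nth _ _ j.
have du : d \in rouT v by apply: mem_nth.
have eu : e \in rouT v by apply: mem_nth.
have b : before (outs v) e d.
  rewrite /before /outs -[[:: _; _]]/(rev [:: d; e]) subseq_rev.
  rewrite -[rouT v](cat_take_drop j) -[[:: d; e]]/([:: d] ++ [:: e]) cat_subseq // sub1seq.
    by rewrite /d -(nth_take _ ij) mem_nth // size_take jl.
  by rewrite (drop_nth (root_dart M)) // mem_head.
have [i1 i2 l] := outs_left_of HM b.
rewrite /= !key_to_diag; move: du eu; rewrite !(mem_rouT HM) => /andP[-> _] /andP[-> _].
have [lt _] := coord_left i1 i2 l; have [] := coord_bound (tgt d); lia.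
Qed.

Lemma darts_at_map v : darts_at t (posx v) = [seq to_diag d | d <- rouT v ++ ins v].
Proof.
have inj : {in [pred e | diag_src e == posx v] &, injective (@key _ t)}.
  by move=> d e /eqP sd /eqP se; apply: key_inj; rewrite sd se.
have memE : darts_at t (posx v) =i [seq to_diag d | d <- rouT v ++ ins v].
  move=> e; rewrite mem_darts_at; apply/eqP/mapP => [se|[d dv ->]].
    have [d ed] := to_diag_surj e; exists d => //; rewrite -ed in se.
    move/posx_inj: se => sd.
    by rewrite mem_cat (mem_rouT HM) (mem_ins HM) sd eqxx !andbT orbN.
  by move: dv; rewrite mem_cat (mem_rouT HM) (mem_ins HM) /diag_src /= => /orP[] /andP[_ /eqP ->].
have so : sorted ltn [seq key e | e <- [seq to_diag d | d <- rouT v ++ ins v]].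
  rewrite -map_comp map_cat (sorted_pairwise ltn_trans) pairwise_cat.
  rewrite -!(sorted_pairwise ltn_trans) sorted_rouT sorted_ins !andbT.
  apply/allrelP => x y /mapP[d + ->] /mapP[e + ->].
  rewrite (mem_rouT HM) (mem_ins HM) => /andP[od _] /andP[/negPf oe _] /=.
  rewrite !key_to_diag od oe.
  have [lt _] := coord_le (le_arc od) (arc_neq HM od); lia.
apply: (@irr_sorted_eq _ (relpre (@key _ t) ltn)) memE.
- by move=> y x z; apply: ltn_trans.
- by move=> x; apply: ltnn.
- by rewrite -sorted_map; apply: darts_at_sorted.
by rewrite -sorted_map.
Qed.

Lemma to_diag_turn d : diag_turn (to_diag d) = to_diag (turn d).
Proof.
have dr : d \in ins (src d) ++ rouT (src d) by rewrite -(rotationE HM) (mem_rotation HM).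
have c := cycle_rotation HM (src d); rewrite (rotationE HM) in c.
rewrite /diag_turn /diag_src /= darts_at_map next_map; last 2 first.
- exact: to_diag_inj.
- by rewrite uniq_catC -(rotationE HM) uniq_rotation.
(* [darts_at] begins with the outgoing darts and [rotation] with the ingoing ones; [next] is blind
   to this cyclic shift. *)
rewrite -[rouT _ ++ ins _](rot_size_cat (ins (src d))) next_rot; last first.
  by rewrite -(rotationE HM) uniq_rotation.
by have /eqP <- := next_cycle c dr.
Qed.

Lemma to_diag_root : to_diag (root_dart M) = root_dart (Phi s).
Proof.
have e0 : ord0 = posx S by apply: val_inj; rewrite /= pxS.
have [l e] : exists l, darts_at t ord0 = to_diag (root_dart M) :: l.
  rewrite e0 darts_at_map (rouTS HM) (insS HM) cats0.
  rewrite /rotation /fingraph.orbit -orderSpred /= (lmS HM).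
  by eexists.
by rewrite /Phi /= e.
Qed.

Lemma map_to_Phi : map_iso M (Phi s).
Proof.
exists posx, to_diag; split; split.
- exact: posx_bij.
- exact: to_diag_bij.
- exact: to_diag_root.
- by [].
- by move=> d; apply: val_inj; rewrite /= /tgt (twinK HM).
- by move=> d; apply: to_diag_turn.
by move=> d; apply: to_diag_out.
Qed.

End Coordinates.

Lemma map_iso_sym (M M' : rooted_map) : map_iso M M' -> map_iso M' M.
Proof.
case=> fv [fd [[[gv gvK fvK] [gd gdK fdK] fr] [fs ft fT fo]]].
exists gv, gd; split; split.
- by exists fv.
- by exists fd.
- by rewrite -fr gdK.
- by move=> d; rewrite -{2}(fdK d) fs gvK.
- by move=> d; apply: (can_inj gdK); rewrite -ft !fdK.
- by move=> d; apply: (can_inj gdK); rewrite -fT !fdK.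
by move=> d; rewrite -[in RHS](fdK d) fo.
Qed.

Lemma poset_to_perm n M : plane_bipolar_poset M n ->
  exists s : 'S_n, [/\ plane_perm s, Psi n M = Some s & map_iso (Phi s) M].
Proof.
move=> HM; have [s sE] := perm_of_map HM; exists s; split.
- exact: plane_of_map sE.
- exact: Psi_of_map sE.
exact: map_iso_sym (map_to_Phi sE).
Qed.

(** * Planarity of the diagram of a plane permutation *)

Section Columns.
Variables (n : nat) (s : 'S_n).
Notation t := (completion s).
Notation ddart := (diag_dart t).
Implicit Types (d e f r z : ddart) (i j k v : 'I_n.+2).

(** For edges meeting a common vertical line, this is the order by height, total by [ge_total]. In
    [crosses], the line is at abscissa [j - 1/2]. *)
Definition ge e f := (t (diag_src f) <= t (diag_src e)) && (t (dtgt f) <= t (dtgt e)).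
Definition crosses (j : nat) e := diag_out e && (diag_src e < j <= dtgt e).

Lemma crosses_lt (j : nat) e : crosses j e ->
  [/\ diag_out e, diag_src e < j, j <= dtgt e & t (diag_src e) < t (dtgt e)].
Proof. by case/andP=> oe /andP[? ?]; case: (diag_out_lt oe). Qed.

Lemma gap e v : diag_out e -> diag_src e < v < dtgt e ->
  t v < t (diag_src e) \/ t (dtgt e) < t v.
Proof.
move=> oe /andP[sv vg]; have := @cov_gap _ t _ _ v oe; rewrite -[(val e).1]/(diag_src e).
rewrite -[(val e).2]/(dtgt e) sv vg => /(_ isT).
have a : t v <> t (diag_src e) :> nat by move/val_perm_inj => h; rewrite h ltnn in sv.
have b : t v <> t (dtgt e) :> nat by move/val_perm_inj => h; rewrite h ltnn in vg.
by move: a b; clear; lia.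
Qed.

Lemma ge_anti e f : ge e f -> ge f e -> e = f.
Proof.
case/andP=> a b /andP[c d]; apply: dart_eq; apply: (@val_perm_inj _ t); apply: anti_leq.
  by rewrite a c.
by rewrite b d.
Qed.

Lemma ge_same_src e f : diag_out e -> diag_out f -> diag_src e = diag_src f ->
  ge e f = (dtgt e <= dtgt f).
Proof.
move=> oe of_ se; rewrite /ge se leqnn /=; have [h|h|h] := ltngtP (dtgt e) (dtgt f).
- by rewrite ltnW // (cov_outs oe) // /diag_out -[(val e).1]/(diag_src e) se.
- apply/negbTE; rewrite -ltnNge (cov_outs of_) //.
  by rewrite -[(val f).1]/(diag_src f) -se.
by rewrite (val_inj h) leqnn.
Qed.

Lemma ge_same_tgt e f : diag_out e -> diag_out f -> dtgt e = dtgt f ->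
  ge e f = (diag_src e <= diag_src f).
Proof.
move=> oe of_ se; rewrite /ge se leqnn andbT; have [h|h|h] := ltngtP (diag_src e) (diag_src f).
- rewrite ltnW // (@cov_ins _ _ (dtgt e) (diag_src e)) //.
  by rewrite se.
- apply/negbTE; rewrite -ltnNge (@cov_ins _ _ (dtgt e) (diag_src f)) //.
  by rewrite se.
by rewrite (val_inj h) leqnn.
Qed.

Lemma dom_min v : dominated t ord0 v.
Proof. by rewrite /dominated completion0. Qed.
Lemma dom_max v : dominated t v ord_max.
Proof. by rewrite /dominated completion_max -ltnS ltn_ord /= -ltnS ltn_ord. Qed.

Lemma dart_of_cov i j : covered_by t i j ->
  exists e, [/\ diag_out e, diag_src e = i & dtgt e = j].
Proof.
move=> c; have h : covered_by t (i, j).1 (i, j).2 || covered_by t (i, j).2 (i, j).1.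
  by rewrite /= c.
by exists (exist _ (i, j) h).
Qed.

Lemma out_exists v : v != ord_max -> exists e, diag_out e && (diag_src e == v).
Proof.
move=> vN; have [k c _] := dom_first (dom_max v) vN.
by have [e [oe <- _]] := dart_of_cov c; exists e; rewrite oe eqxx.
Qed.
Lemma in_exists v : v != ord0 -> exists e, diag_out e && (dtgt e == v).
Proof.
rewrite eq_sym => vS; have [k c _] := dom_last (dom_min v) vS.
by have [e [oe _ <-]] := dart_of_cov c; exists e; rewrite oe eqxx.
Qed.

Lemma in_rightmost v : v != ord0 -> exists r, [/\ diag_out r, dtgt r = v &
  forall z, diag_out z -> dtgt z = v -> diag_src z <= diag_src r].
Proof.
move/in_exists => [e he]; case: (@arg_maxnP _ e [pred z | diag_out z && (dtgt z == v)] (fun z => val (diag_src z)) he).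
move=> r /andP[or_ /eqP gr] rmax; exists r; split=> // z oz gz; apply: rmax.
by rewrite /= oz gz eqxx.
Qed.
Lemma in_leftmost v : v != ord0 -> exists r, [/\ diag_out r, dtgt r = v &
  forall z, diag_out z -> dtgt z = v -> diag_src r <= diag_src z].
Proof.
move/in_exists => [e he]; case: (@arg_minnP _ e [pred z | diag_out z && (dtgt z == v)] (fun z => val (diag_src z)) he).
move=> r /andP[or_ /eqP gr] rmin; exists r; split=> // z oz gz; apply: rmin.
by rewrite /= oz gz eqxx.
Qed.

Lemma src_diag_twin d : diag_src (diag_twin d) = dtgt d. Proof. by []. Qed.
Lemma dtgt_diag_twin d : dtgt (diag_twin d) = diag_src d. Proof. by []. Qed.

Lemma out_twin_diag d : diag_out (diag_twin d) = ~~ diag_out d.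
Proof.
have [od|od] := boolP (diag_out d); last exact: diag_outN.
apply/negbTE/negP => /diag_out_lt[]; rewrite src_diag_twin dtgt_diag_twin.
by have [] := diag_out_lt od; lia.
Qed.

Lemma key_out d : diag_out d -> key d = n.+2 - dtgt d /\ key d < n.+2.
Proof. by move=> od; rewrite /key od; have [] := diag_out_lt od; lia. Qed.
Lemma key_in d : ~~ diag_out d -> key d = n.+2 + dtgt d.
Proof. by rewrite /key => /negPf ->. Qed.

(** This lemma and the two after it compute the three kinds of corner met by the sweep: between two
    outgoing edges, and on the right and left sides of a vertex. *)
Lemma turn_outs e e' : diag_out e -> diag_out e' -> diag_src e = diag_src e' ->
  dtgt e < dtgt e' ->
  (forall z, diag_out z -> diag_src z = diag_src e -> ~~ (dtgt e < dtgt z < dtgt e')) ->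
  diag_turn e' = e.
Proof.
move=> oe oe' se lt h; have [k kl] := key_out oe; have [k' kl'] := key_out oe'.
have := ltn_ord (dtgt e'); have := ltn_ord (dtgt e) => l1 l2.
apply: diag_turn_next => [//||z sz]; first lia.
have [oz|oz] := boolP (diag_out z); last by rewrite (key_in oz); lia.
have := h z oz; rewrite se => /(_ sz); have [-> _] := key_out oz.
by have := ltn_ord (dtgt z); lia.
Qed.

Lemma turn_in_out e r : diag_out e -> diag_out r -> diag_src e = dtgt r ->
  (forall z, diag_out z -> diag_src z = dtgt r -> dtgt z <= dtgt e) ->
  (forall z, diag_out z -> dtgt z = dtgt r -> diag_src z <= diag_src r) ->
  diag_turn (diag_twin r) = e.
Proof.
move=> oe or_ se he hr; apply: diag_turn_wrap => // z; rewrite src_diag_twin => sz.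
have kr : key (diag_twin r) = n.+2 + diag_src r by rewrite key_in ?out_twin_diag ?or_.
have [ke ke'] := key_out oe; have [oz|oz] := boolP (diag_out z).
  by have := he z oz sz; have [] := key_out oz; have := ltn_ord (dtgt e); lia.
have := hr (diag_twin z); rewrite out_twin_diag oz dtgt_diag_twin src_diag_twin => /(_ isT sz).
by rewrite (key_in oz); lia.
Qed.

Lemma turn_out_in e r : diag_out e -> diag_out r -> diag_src e = dtgt r ->
  (forall z, diag_out z -> diag_src z = dtgt r -> dtgt e <= dtgt z) ->
  (forall z, diag_out z -> dtgt z = dtgt r -> diag_src r <= diag_src z) ->
  diag_turn e = diag_twin r.
Proof.
move=> oe or_ se he hr.
have kr : key (diag_twin r) = n.+2 + diag_src r by rewrite key_in ?out_twin_diag ?or_.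
have [ke ke'] := key_out oe; apply: diag_turn_next => [//||z]; first lia.
rewrite se => sz; have [oz|oz] := boolP (diag_out z).
  by have := he z oz sz; have [] := key_out oz; have := ltn_ord (dtgt z); lia.
have := hr (diag_twin z); rewrite out_twin_diag oz dtgt_diag_twin src_diag_twin => /(_ isT sz).
by rewrite (key_in oz); lia.
Qed.

Lemma south_out d : diag_src d = ord0 -> diag_out d.
Proof. by move=> sd; apply/negPn/negP => /diag_outN_lt[]; rewrite sd. Qed.
Lemma north_in d : diag_src d = ord_max -> ~~ diag_out d.
Proof.
by move=> sd; apply/negP => /diag_out_lt[]; rewrite sd ltnNge -ltnS ltn_ord.
Qed.

Definition rdart : ddart := root_dart (Phi s).

Lemma rdart_spec : diag_src rdart = ord0 /\
  forall z, diag_src z = ord0 -> dtgt z <= dtgt rdart.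
Proof.
have [e /andP[oe /eqP se]] := @out_exists ord0 isT.
have : e \in darts_at t ord0 by rewrite mem_darts_at se.
rewrite /rdart /Phi /=; have := darts_at_sorted t ord0; have := @mem_darts_at _ t ord0.
case: (darts_at t ord0) => // d l mem so _ /=.
have sd : diag_src d = ord0 by apply/eqP; rewrite -mem mem_head.
split=> // z sz; have : z \in d :: l by rewrite mem sz.
rewrite inE => /predU1P[->//|zl]; have := order_path_min ltn_trans so.
move/allP/(_ (key z)); rewrite map_f // => /(_ isT) /=.
have [-> _] := key_out (south_out sd); have [-> _] := key_out (south_out sz).
by have := ltn_ord (dtgt z); lia.
Qed.

Lemma turn_south e : diag_src e = ord0 ->
  (forall z, diag_src z = ord0 -> dtgt e <= dtgt z) -> diag_turn e = rdart.
Proof.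
move=> se h; have [sr hr] := rdart_spec.
apply: diag_turn_wrap; rewrite ?se ?sr // => z sz.
have [-> _] := key_out (south_out sz); have [-> _] := key_out (south_out sr).
have [-> _] := key_out (south_out se).
by have := h z sz; have := hr z sz; lia.
Qed.

Definition dface d : ddart := diag_turn (diag_twin d).

(** A face is kept on the right of its darts: for a bounded face, [ascends] goes up its left side
    and [descends] comes down its right side. The end of a descent is left free, being in practice
    the outgoing dart of the bottom corner. *)
Definition ascends c d := exists2 i : nat, iter i dface c = d &
  forall k : nat, k <= i -> diag_out (iter k dface c).
Definition descends d c := exists2 i : nat, iter i dface d = c &
  forall k : nat, k < i -> ~~ diag_out (iter k dface d).

Lemma ascends0 c : diag_out c -> ascends c c.
Proof. by exists 0 => // k; rewrite leqn0 => /eqP ->. Qed.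
Lemma ascendsS c r e : ascends c r -> diag_turn (diag_twin r) = e -> diag_out e -> ascends c e.
Proof.
case=> i er h re oe; exists i.+1; first by rewrite iterS er.
by move=> k; rewrite leq_eqVlt => /predU1P[->|/h //]; rewrite iterS er /dface re.
Qed.
Lemma descends1 e c : diag_out e -> diag_turn e = c -> descends (diag_twin e) c.
Proof.
move=> oe ec; exists 1 => [|[|//] _] /=; last by rewrite out_twin_diag oe.
by rewrite /dface -ec; congr diag_turn; apply: val_inj => /=; case: (val e).
Qed.
Lemma descendsS e r c : diag_out e -> descends (diag_twin r) c -> diag_turn e = diag_twin r ->
  descends (diag_twin e) c.
Proof.
move=> oe [i er h] te; have fe : dface (diag_twin e) = diag_twin r.
  by rewrite /dface -te; congr diag_turn; apply: val_inj => /=; case: (val e).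
exists i.+1; first by rewrite iterSr fe.
by case=> [|k] ki; [rewrite /= out_twin_diag oe|rewrite iterSr fe h].
Qed.

(** * Pattern avoidance and segments on a vertical line *)

Hypothesis plane_s : plane_perm s.

(** None of the four points can be one of the two added ones, which are extreme in index and in
    value. *)
Lemma completion_pattern i j j' k : i < j -> j' = j.+1 :> nat -> j' < k ->
  t j < t i -> t i < t k -> t k < t j' -> False.
Proof.
move=> ij jj jk ji ik kj.
have t0 l : (t l == 0 :> nat) = (l == 0 :> nat).
  by rewrite -[0]/(val (ord0 : 'I_n.+2)) -{1}(completion0 s) !val_eqE (inj_eq perm_inj).
have tl l : t l < n.+2 by [].
have [|i0 ei] := @inner_indexP n i; first by have := t0 i; have := ltn_ord k; lia.
have [|j0 ej] := @inner_indexP n j; first by have := ltn_ord k; lia.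
have [|j'0 ej'] := @inner_indexP n j'; first by have := ltn_ord k; lia.
have [|k0 ek] := @inner_indexP n k.
  have km : k != ord_max by apply: contraTneq kj => ->; rewrite completion_max -leqNgt -ltnS /=.
  by move: km; rewrite -val_eqE /=; have := ltn_ord k; lia.
move/forallP/(_ i0)/forallP/(_ j0)/forallP/(_ j'0)/forallP/(_ k0): plane_s.
move: ij jj jk ji ik kj; rewrite ei ej ej' ek !completion_val !val_inner_index !ltnS.
by move=> -> [->] -> -> -> ->; rewrite eqxx.
Qed.

(* Two covers [p -> q] and [p' -> q'] crossing in this way contain the vincular
   pattern: between [p'] and [q'], the values jump over [t p', t q'] at once. *)
Lemma cov_no_cross (p q p' q' : 'I_n.+2) : covered_by t p' q' ->
  p < p' -> q' < q -> t p' < t p -> t p < t q -> t q < t q' -> False.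
Proof.
move=> c pp qq tp pq tq; have [lt tlt] := cov_lt c.
have P0 : [pred j : 'I_n.+2 | (p' <= j < q') && (t j <= t p')] p' by rewrite /= !leqnn lt.
case: (arg_maxnP (fun j : 'I_n.+2 => val j) P0) => j /andP[/andP[pj jq] tj] jmax.
have jlt : j.+1 < n.+2 by apply: leq_ltn_trans (ltn_ord q').
pose j' : 'I_n.+2 := Ordinal jlt.
have tj' : t q' <= t j'.
  have [e|ne] := eqVneq j' q'; first by rewrite e.
  have j'q : j' < q' by rewrite ltn_neqAle ne.
  have : ~~ (t j' <= t p').
    apply/negP => h; have := jmax j'; rewrite /= h (leqW pj) j'q => /(_ isT).
    by rewrite ltnn.
  have := @cov_gap _ t p' q' j' c; rewrite j'q ltnS pj => /(_ isT).
  by rewrite -ltnNge => + h; rewrite h /= -leqNgt.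
apply: (@completion_pattern p j j' q) => //.
- exact: leq_trans pp pj.
- exact: leq_ltn_trans jq qq.
- exact: leq_ltn_trans tj tp.
- exact: leq_trans tq tj'.
Qed.

(** If the ends disagree, [gap] forces the edge with the lower tail and the higher head to lie
    horizontally inside the other one, which is the configuration of [cov_no_cross]. *)
Lemma ge_total (j : nat) e f : crosses j e -> crosses j f -> ge e f || ge f e.
Proof.
have aux e' f' : crosses j e' -> crosses j f' ->
    t (diag_src f') < t (diag_src e') -> t (dtgt e') < t (dtgt f') -> False.
  case/crosses_lt=> oe se ge_ te /crosses_lt[of_ sf gf tf] ts tg.
  have sef : diag_src e' < diag_src f'.
    rewrite ltnNge leq_eqVlt; apply/negP => /predU1P[/val_inj h|h].
      by rewrite h ltnn in ts.
    have [||] := @gap f' (diag_src e') of_; first by rewrite h (leq_trans se gf).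
      by rewrite ltnNge (ltnW ts).
    by rewrite ltnNge (ltnW (ltn_trans te tg)).
  have gfe : dtgt f' < dtgt e'.
    rewrite ltnNge leq_eqVlt; apply/negP => /predU1P[/val_inj h|h].
      by rewrite h ltnn in tg.
    have [||] := @gap f' (dtgt e') of_; first by rewrite h (leq_trans sf ge_).
      by rewrite ltnNge (ltnW (ltn_trans ts te)).
    by rewrite ltnNge (ltnW tg).
  exact: (@cov_no_cross (diag_src e') (dtgt e') (diag_src f') (dtgt f')) of_ sef gfe ts te tg.
move=> ce cf; rewrite /ge; have := aux e f ce cf; have := aux f e cf ce; lia.
Qed.

(* An inductive step leads from the column to the right of the point [v] to the
   column to its left: the edges leaving [v] are replaced by those entering it. *)
Lemma bottom_ascends (j : nat) e : crosses j e ->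
  (forall f, crosses j f -> ge f e) -> ascends rdart e.
Proof.
elim: j e => [|j IH] e ce0 bot; case: (crosses_lt ce0) => oe se je te; first by [].
clear ce0.
have jn : j < n.+2 := ltn_trans je (ltn_ord _).
pose v : 'I_n.+2 := Ordinal jn.
have [ev|nev] := eqVneq (diag_src e) v.
  have rm z : diag_out z -> diag_src z = v -> dtgt z <= dtgt e.
    move=> oz sz; have zv := diag_out_lt oz.
    have cz : crosses j.+1 z by rewrite /crosses oz sz /= ltnS leqnn; case: zv; rewrite sz.
    by have := bot z cz; rewrite ge_same_src // ?ev ?sz.
  have [v0|v0] := eqVneq v ord0.
    have [sr hr] := rdart_spec; have or_ := south_out sr.
    suff -> : e = rdart by apply: ascends0.
    apply: dart_eq; first by rewrite ev v0 sr.
    by apply: val_inj; apply/eqP; rewrite eqn_leq hr ?ev ?v0 //= rm ?sr ?v0.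
  have [r [or_ gr hr]] := in_rightmost v0.
  have [rlt rtlt] := diag_out_lt or_; rewrite gr in rlt rtlt.
  have cr : crosses j r by rewrite /crosses or_ gr leqnn andbT.
  apply: (@ascendsS _ r) => //; last first.
    by apply: turn_in_out; rewrite ?gr ?ev.
  apply: IH => // f cf; have [of_ sf jf tf] := crosses_lt cf.
  have [gf|ngf] := eqVneq (dtgt f) v.
    by rewrite ge_same_tgt ?gf ?gr // hr.
  have cf' : crosses j.+1 f.
    by rewrite /crosses of_ (ltn_trans sf) //= ltn_neqAle jf eq_sym ngf.
  have /orP[/andP[h _]|//] := ge_total cr cf.
  by have /andP[h' _] := bot f cf'; rewrite ev in h'; move: h' h rtlt; clear; lia.
have sj : diag_src e < j by rewrite ltn_neqAle -ltnS se andbT; apply: contra nev => /eqP h; apply/eqP/val_inj.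
have ce : crosses j e by rewrite /crosses oe sj ltnW.
apply: IH => // f cf; have [of_ sf jf tf] := crosses_lt cf.
have [gf|ngf] := eqVneq (dtgt f) v; last first.
  by apply: bot; rewrite /crosses of_ (ltn_trans sf) //= ltn_neqAle jf eq_sym ngf.
have /orP[/andP[_ h]|//] := ge_total ce cf; rewrite gf in h.
have [|h'|h'] := @gap e v oe; first by rewrite sj.
- have vN : v != ord_max by rewrite -val_eqE /=; have := ltn_ord (dtgt e); lia.
  have [z /andP[oz /eqP sz]] := out_exists vN; have [zv _] := diag_out_lt oz.
  have cz : crosses j.+1 z by rewrite /crosses oz sz /= ltnS leqnn; rewrite sz in zv.
  by have /andP[+ _] := bot z cz; rewrite sz; move: h'; clear; lia.
by move: h h'; clear; lia.
Qed.

Lemma top_descends (j : nat) e : crosses j e ->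
  (forall f, crosses j f -> ge e f) -> descends (diag_twin e) rdart.
Proof.
elim: j e => [|j IH] e ce0 top; case: (crosses_lt ce0) => oe se je te; first by [].
clear ce0.
have jn : j < n.+2 := ltn_trans je (ltn_ord _).
pose v : 'I_n.+2 := Ordinal jn.
have [ev|nev] := eqVneq (diag_src e) v.
  have lft z : diag_out z -> diag_src z = v -> dtgt e <= dtgt z.
    move=> oz sz; have zv := diag_out_lt oz.
    have cz : crosses j.+1 z by rewrite /crosses oz sz /= ltnS leqnn; case: zv; rewrite sz.
    by have := top z cz; rewrite ge_same_src // ?ev ?sz.
  have [v0|v0] := eqVneq v ord0.
    apply: descends1 => //; apply: turn_south; first by rewrite ev.
    by move=> z sz; apply: lft; rewrite ?south_out ?v0.
  have [r [or_ gr hr]] := in_leftmost v0.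
  have [rlt rtlt] := diag_out_lt or_; rewrite gr in rlt rtlt.
  have cr : crosses j r by rewrite /crosses or_ gr leqnn andbT.
  apply: (@descendsS _ r) => //; last first.
    by apply: turn_out_in; rewrite ?gr ?ev.
  apply: IH => // f cf; have [of_ sf jf tf] := crosses_lt cf.
  have [gf|ngf] := eqVneq (dtgt f) v.
    by rewrite ge_same_tgt ?gf ?gr // hr.
  have vf : j < dtgt f by rewrite ltn_neqAle jf eq_sym ngf.
  have cf' : crosses j.+1 f by rewrite /crosses of_ (ltn_trans sf).
  have /orP[//|/andP[_ h]] := ge_total cr cf; rewrite gr in h.
  have /andP[h' _] := top f cf'; rewrite ev in h'.
  by have [|h2|h2] := @gap f v of_; rewrite ?sf //; move: h h' h2; clear; lia.
have sj : diag_src e < j by rewrite ltn_neqAle -ltnS se andbT; apply: contra nev => /eqP h; apply/eqP/val_inj.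
have ce : crosses j e by rewrite /crosses oe sj ltnW.
apply: IH => // f cf; have [of_ sf jf tf] := crosses_lt cf.
have [gf|ngf] := eqVneq (dtgt f) v; last first.
  by apply: top; rewrite /crosses of_ (ltn_trans sf) //= ltn_neqAle jf eq_sym ngf.
have /orP[//|/andP[_ h]] := ge_total ce cf; rewrite gf in h.
have vN : v != ord_max by rewrite -val_eqE /=; have := ltn_ord (dtgt e); lia.
have [z /andP[oz /eqP sz]] := out_exists vN; have [zv _] := diag_out_lt oz.
have cz : crosses j.+1 z by rewrite /crosses oz sz /= ltnS leqnn; rewrite sz in zv.
by have /andP[+ _] := top z cz; rewrite sz; move: h te; clear; lia.
Qed.

Definition source_corner c := exists e, [/\ diag_out c, diag_out e & diag_turn e = c].

Lemma adjacent_descends (j : nat) e e' : crosses j e -> crosses j e' -> ge e e' -> e != e' ->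
  (forall f, crosses j f -> ge e f -> ge f e' -> f = e \/ f = e') ->
  exists c, [/\ source_corner c, ascends c e & descends (diag_twin e') c].
Proof.
elim: j e e' => [|j IH] e e' ce ce'; case: (crosses_lt ce) => oe se je te;
  case: (crosses_lt ce') => oe' se' je' te' ee ne adj; first by [].
have jn : j < n.+2 := ltn_trans je (ltn_ord _).
pose v : 'I_n.+2 := Ordinal jn; have /andP[ees eeg] := ee.
have crz z : diag_out z -> diag_src z = v -> crosses j.+1 z.
  by move=> oz sz; rewrite /crosses oz; have [] := diag_out_lt oz; rewrite sz /= ltnS leqnn => ->.
have crf f : crosses j f -> dtgt f != v -> crosses j.+1 f /\ diag_src f < v < dtgt f.
  move=> /crosses_lt[of_ sf jf _] ngf; have lf : j < dtgt f by rewrite ltn_neqAle jf eq_sym ngf.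
  by rewrite /crosses of_ lf (ltn_trans sf) //= sf.
have crp f : crosses j.+1 f -> diag_src f != v -> crosses j f /\ diag_src f < v < dtgt f.
  move=> /crosses_lt[of_ sf jf _] nsf.
  have lf : diag_src f < j.
    by rewrite ltn_neqAle -ltnS sf andbT; apply: contra nsf => /eqP h; apply/eqP/val_inj.
  by rewrite /crosses of_ lf /= (ltnW jf).
have [ev|nev] := eqVneq (diag_src e) v; have [ev'|nev'] := eqVneq (diag_src e') v.
(* Both edges start at [v], consecutively: this is the bottom corner. *)
- have lt : dtgt e < dtgt e'.
    have se_ : diag_src e = diag_src e' by rewrite ev ev'.
    have := ee; rewrite ge_same_src // leq_eqVlt => /predU1P[/val_inj h|//].
    by case/eqP: ne; apply: dart_eq.
  have te_ : diag_turn e' = e.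
    apply: turn_outs => //; first by rewrite ev ev'.
    move=> z oz sz; apply/negP => /andP[l1 l2].
    have sz' : diag_src z = v by rewrite sz.
    have [||h|h] := adj z (crz z oz sz').
    + by rewrite ge_same_src ?(ltnW l1).
    + by rewrite ge_same_src ?(ltnW l2) // sz' ev'.
    + by rewrite h ltnn in l1.
    by rewrite h ltnn in l2.
  exists e; split; [by exists e' | exact: ascends0 | exact: descends1].
(* Only the upper edge starts at [v]; it is the lowest one there and gives way to the lowest edge
   entering [v], the rightmost one. *)
- have [ce2 sve'] := crp e' ce' nev'; have [l1 l2] := andP sve'.
  have v0 : v != ord0 by apply: contraTneq l1 => ->.
  have [r [or_ gr hr]] := in_rightmost v0.
  have [rlt rtlt] := diag_out_lt or_; rewrite gr in rlt rtlt.
  have cr : crosses j r by rewrite /crosses or_ gr leqnn andbT.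
  rewrite ev in ees te.
  have nts : t v <> t (diag_src e') :> nat by move/val_perm_inj => h; rewrite -h eqxx in nev'.
  have rm z : diag_out z -> diag_src z = v -> dtgt z <= dtgt e.
    move=> oz sz; rewrite leqNgt; apply/negP => lz.
    have gez : ge e z by rewrite ge_same_src ?(ltnW lz) // ev.
    have /orP[ge2|/andP[h _]] := ge_total (crz z oz sz) ce'; last first.
      by rewrite sz in h; move: h ees nts; clear; lia.
    have [h|h] := adj z (crz z oz sz) gez ge2; first by rewrite h ltnn in lz.
    by rewrite -h sz eqxx in nev'.
  have re' : ge r e'.
    have /orP[//|/andP[_ h]] := ge_total cr ce2; rewrite gr in h.
    by have [h2|h2] := gap oe' sve'; move: h h2 ees; clear; lia.
  have nre : r != e' by apply/eqP => h; rewrite -h gr ltnn in l2.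
  have [|c [sc ac dc]] := IH r e' cr ce2 re' nre; last first.
    exists c; split=> //; apply: (ascendsS ac) => //.
    by apply: turn_in_out; rewrite ?gr ?ev.
  move=> f cf rf fe'; have [of_ sf jf tf] := crosses_lt cf.
  have [gf|ngf] := eqVneq (dtgt f) v.
    left; apply: ge_anti => //; by rewrite ge_same_tgt ?gf ?gr ?hr.
  have [cf' _] := crf f cf ngf; have /andP[a b] := rf; rewrite gr in b.
  have gef : ge e f by rewrite /ge ev; apply/andP; move: a b rtlt te; clear; split; lia.
  have [h|h] := adj f cf' gef fe'; last by right.
  by rewrite h ev /= ltnn in sf.
(* Only the lower edge starts at [v]; it gives way to the highest edge entering [v], the leftmost
   one. *)
- have [ce2 sve] := crp e ce nev; have [l1 l2] := andP sve.
  have v0 : v != ord0 by apply: contraTneq l1 => ->.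
  have [r [or_ gr hr]] := in_leftmost v0.
  have [rlt rtlt] := diag_out_lt or_; rewrite gr in rlt rtlt.
  have cr : crosses j r by rewrite /crosses or_ gr leqnn andbT.
  rewrite ev' in ees te'.
  have nts : t v <> t (diag_src e) :> nat by move/val_perm_inj => h; rewrite -h eqxx in nev.
  have lft z : diag_out z -> diag_src z = v -> dtgt e' <= dtgt z.
    move=> oz sz; rewrite leqNgt; apply/negP => lz.
    have gez : ge z e' by rewrite ge_same_src ?(ltnW lz) // ev'.
    have /orP[/andP[h _]|ge2] := ge_total (crz z oz sz) ce.
      by rewrite sz in h; move: h ees nts; clear; lia.
    have [h|h] := adj z (crz z oz sz) ge2 gez; last by rewrite h ltnn in lz.
    by rewrite -h sz eqxx in nev.
  have er : ge e r.
    by have /orP[//|/andP[_ h]] := ge_total ce2 cr; rewrite gr in h; move: h te ees; clear; lia.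
  have nre : e != r by apply/eqP => h; rewrite h gr ltnn in l2.
  have [|c [sc ac dc]] := IH e r ce2 cr er nre; last first.
    exists c; split=> //; apply: (descendsS _ dc) => //.
    by apply: turn_out_in; rewrite ?gr ?ev'.
  move=> f cf ef fr; have [of_ sf jf tf] := crosses_lt cf.
  have [gf|ngf] := eqVneq (dtgt f) v.
    right; apply: ge_anti => //; by rewrite ge_same_tgt ?gf ?gr ?hr.
  have [cf' svf] := crf f cf ngf; have /andP[a b] := fr; rewrite gr in b.
  have fe' : ge f e'.
    have /orP[//|/andP[h _]] := ge_total cf' ce'; rewrite ev' in h.
    by have [h2|h2] := gap of_ svf; move: h h2 b; clear; lia.
  have [h|h] := adj f cf' ef fe'; first by left.
  by rewrite h ev' /= ltnn in sf.
(* Neither edge starts at [v]. An edge entering [v] between them would put the edges leaving [v]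
   between them too. *)
have [ce2 sve] := crp e ce nev; have [ce2' sve'] := crp e' ce' nev'.
apply: (IH e e') => // f cf ef fe'; have [of_ sf jf tf] := crosses_lt cf.
have [gf|ngf] := eqVneq (dtgt f) v; last by apply: adj => //; case: (crf f cf ngf).
have /andP[_ a] := ef; have /andP[_ b] := fe'; rewrite gf in a b.
have vN : v != ord_max.
  have /andP[_ l] := sve; apply: contraTneq l => ->.
  by rewrite -leqNgt -ltnS ltn_ord.
have [z /andP[oz /eqP sz]] := out_exists vN; have cz := crz z oz sz.
have ts : t v < t (diag_src e) by have [h|h] := gap oe sve => //; move: a h; clear; lia.
have /orP[/andP[h _]|ez] := ge_total cz ce.
  by rewrite sz in h; move: h ts; clear; lia.
have /orP[ze'|/andP[h _]] := ge_total cz ce'; last first.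
  by rewrite sz in h; move: h b te'; clear; lia.
have [h|h] := adj z cz ez ze'; first by rewrite -h sz eqxx in nev.
by rewrite -h sz eqxx in nev'.
Qed.

End Columns.

(** * Euler's formula for the diagram *)

Lemma next_fcycle (T : eqType) (f : T -> T) (l : seq T) : uniq l ->
  (forall x, x \in l -> next l x = f x) -> fcycle f l.
Proof.
move=> ul h; have e : {in l &, frel (next l) =2 frel f}.
  by move=> x y xl _; rewrite /= h.
by rewrite -(eq_in_cycle e (allss _)) cycle_next.
Qed.

Lemma fcard_transversal (T : finType) (f : T -> T) (A : {set T}) : injective f ->
  (forall x, exists2 c, fconnect f x c & c \in A) ->
  {in A &, forall c c', fconnect f c c' -> c = c'} -> fcard f T = #|A|.
Proof.
move=> inj_f ex un; have sym := fconnect_sym inj_f.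
have inj : {in A &, injective (froot f)}.
  by move=> c c' cA c'A /(rootP sym); apply: un.
rewrite -[RHS](card_in_imset inj) /n_comp_mem; apply: eq_card => x.
rewrite !inE andbT.
apply/eqP/imsetP => [rx|[c _ ->]]; last exact: root_root.
have [c xc cA] := ex x; exists c => //.
by rewrite -rx; apply/(rootP sym).
Qed.

Section DiagramMap.
Variables (n : nat) (s : 'S_n).
Notation t := (completion s).
Notation ddart := (diag_dart t).
Notation M := (Phi s).
Implicit Types (c d e f z : ddart) (u v : 'I_n.+2).

Lemma diag_twinK : involutive (@diag_twin _ t).
Proof. by move=> d; apply: val_inj => /=; case: (val d). Qed.

Lemma uniq_darts_at v : uniq (darts_at t v).
Proof. by have /(sorted_uniq ltn_trans ltnn)/map_uniq := darts_at_sorted t v. Qed.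

Lemma diag_turn_inj : injective (@diag_turn _ t).
Proof.
move=> d e h; have se : diag_src d = diag_src e by rewrite -(src_diag_turn d) h src_diag_turn.
move: h; rewrite /diag_turn se => h.
exact: (can_inj (prev_next (uniq_darts_at (diag_src e)))) h.
Qed.

Lemma cycle_darts_at v : fcycle (@diag_turn _ t) (darts_at t v).
Proof.
apply: next_fcycle (uniq_darts_at v) _ => d; rewrite mem_darts_at => /eqP sd.
by rewrite /diag_turn sd.
Qed.

Lemma diag_turn_fconnect d e : fconnect (@diag_turn _ t) d e = (diag_src d == diag_src e).
Proof.
have dd : d \in darts_at t (diag_src d) by rewrite mem_darts_at.
by rewrite (fconnect_cycle (cycle_darts_at _) dd) mem_darts_at eq_sym.
Qed.

Notation dface := (@dface n s).

Lemma dface_inj : injective dface.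
Proof. by move=> d e /diag_turn_inj /(can_inj diag_twinK). Qed.

Lemma source_corner_pred c x : source_corner c -> dface x = c -> ~~ diag_out x.
Proof.
case=> e [_ oe <-] /diag_turn_inj h.
by rewrite -out_twin_diag h.
Qed.

Lemma rdart_corner : source_corner (rdart s).
Proof.
have [e0 /andP[_ h0]] := @out_exists n s ord0 isT.
case: (@arg_minnP _ e0 [pred z | diag_src z == ord0] (fun z => val (dtgt z)) h0).
move=> e /eqP se emin; have [sr _] := rdart_spec s.
exists e; split; [exact: south_out sr|exact: south_out se|].
by apply: turn_south => // z sz; apply: emin; rewrite /= sz.
Qed.

Lemma le_dominated u v : connect (@Defs.arc M) u v = dominated t u v.
Proof.
apply/idP/idP.
  case/connectP => p; elim: p u => [|w p IH] u /=; first by move=> _ ->; apply: dom_refl.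
  case/andP=> /existsP[d /and4P[od _ /eqP <- /eqP <-]] pw ev.
  by apply: dom_trans (IH _ pw ev); apply: cov_dom od.
have [m] := ubnP (v - u); elim: m u => // m IH u lt uv.
have [->|ne] := eqVneq u v; first exact: connect0.
have [k c kv] := dom_first uv ne; have [uk _] := cov_lt c.
apply: (@connect_trans _ _ k).
  have [e [oe se ge_]] := dart_of_cov c.
  by apply/connect1/existsP; exists e; rewrite [out _]oe -se -ge_ !eqxx.
have [uv1 _] := dom_lt uv ne.
by apply: IH => //; lia.
Qed.

Lemma Phi_connected : connected_map M.
Proof.
split.
- exact: diag_twinK.
- move=> d; apply/eqP => h; have := out_twin_diag d.
  by rewrite -[diag_twin d]/(twin (r := M) d) h; case: (diag_out d).
- exact: diag_turn_inj.
- exact: diag_turn_fconnect.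
have sym : symmetric (@adjacent M).
  move=> u v; apply/existsP/existsP => -[d /andP[/eqP sd /eqP td]]; exists (twin d);
    by rewrite [src _]td /tgt [twin (twin d)]diag_twinK sd !eqxx.
have sub u v : dominated t u v -> connect (@adjacent M) u v.
  rewrite -le_dominated; apply: connect_sub => x y /existsP[d /and4P[_ _ sd td]].
  by apply/connect1/existsP; exists d; rewrite sd td.
move=> u v; apply: (@connect_trans _ _ (ord0 : vertex M)); last exact/sub/dom_min.
by rewrite (sym_connect_sym sym); apply/sub/dom_min.
Qed.

Lemma Phi_acyclic : acyclic M.
Proof.
move=> d od; rewrite le_dominated; apply/negP => /andP[h _].
by have [lt _] := diag_out_lt (od : diag_out (d : ddart)); move: h; rewrite leqNgt lt.
Qed.

Lemma Phi_source v : source (v : vertex M) <-> v = src (root_dart M).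
Proof.
have [sr _] := rdart_spec s; rewrite [src _]sr; split=> [/forallP h|->].
  apply/eqP/negPn/negP => /(@in_exists n s)[e /andP[oe /eqP ge_]].
  have := h (diag_twin e); rewrite [src _]ge_ eqxx /= => o.
  by have := out_twin_diag e; rewrite oe [diag_out _]o.
apply/forallP => d; apply/implyP => /eqP; exact: south_out.
Qed.

Lemma Phi_sink v : sink (v : vertex M) <-> v = ord_max.
Proof.
split=> [/forallP h|->].
  apply/eqP/negPn/negP => /(@out_exists n s)[e /andP[oe se]].
  by have := h e; rewrite [src _ == _]se [out _]oe.
apply/forallP => d; apply/implyP => /eqP; exact: north_in.
Qed.

Lemma Phi_no_transitive (e : dart M) : ~~ transitive_edge e.
Proof.
apply/negP => /andP[oe /connectP[[|w p]]] /=.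
  move=> _ h; have [lt _] := diag_out_lt (oe : diag_out (e : ddart)).
  by move: lt; rewrite -src_diag_twin h ltnn.
case/andP=> /existsP[d /and4P[od nd /eqP sd /eqP td]] pw ev.
have we : dominated t w (tgt e).
  rewrite -le_dominated; apply/connectP; exists p => //.
  apply: sub_path pw => x y /existsP[c /and4P[oc _ sx ty]]; apply/existsP; exists c.
  by rewrite oc sx ty.
have ew : covered_by t (src e) w by rewrite -[src e]sd -td; exact: od.
have [h|h] := cov_between (oe : covered_by t (src e) (tgt e)) (cov_dom ew) we.
  by have [lt _] := cov_lt ew; move: lt; rewrite h ltnn.
case/negP: nd; apply/eqP; apply: dart_eq; first exact: sd.
exact: etrans td h.
Qed.

Hypothesis plane_s : plane_perm s.

(** The two sides of a top corner at [w] are edges entering [w]. Either they are neighbours on the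
    line just left of [w], or the turn wraps around, which happens only when no edge leaves [w]:
    then [w] is the north pole, they are the lowest and the highest edge there, and the face is the
    outer one. *)
Lemma sink_corner d : diag_out d -> ~~ diag_out (dface d) ->
  exists c, [/\ source_corner c, ascends c d & descends (dface d) c].
Proof.
move=> od ob; set w := dtgt d; pose b := diag_twin (dface d).
have eb : diag_twin b = dface d by rewrite /b diag_twinK.
have gb : dtgt b = w by rewrite /b dtgt_diag_twin src_diag_turn src_diag_twin.
have oob : diag_out b by rewrite out_twin_diag.
have kin e : diag_out e -> key (diag_twin e) = n.+2 + diag_src e.
  by move=> oe; rewrite key_in ?out_twin_diag ?oe.
have cw e : diag_out e -> dtgt e = w -> crosses w e.
  by move=> oe ge_; rewrite /crosses oe ge_ leqnn andbT; have [] := diag_out_lt oe; rewrite ge_.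
have := diag_turn_spec (diag_twin d).
rewrite /= -/(dface d) -eb (kin d od) (kin b oob) => -[[lt h]|h].
  have lt' : diag_src d < diag_src b by rewrite -(ltn_add2l n.+2).
  apply: (adjacent_descends plane_s (cw d od erefl) (cw b oob gb)).
  - by rewrite ge_same_tgt ?gb ?(ltnW lt').
  - by apply: contraTneq lt' => ->; rewrite ltnn.
  move=> f cf df fb; have /andP[of_ _] := cf.
  have gf : dtgt f = w.
    apply: (@val_perm_inj _ t); apply: anti_leq; have /andP[_ ->] := df.
    by have /andP[_] := fb; rewrite gb.
  rewrite ge_same_tgt // in df; rewrite ge_same_tgt ?gf ?gb // in fb.
  have := h (diag_twin f); rewrite src_diag_twin gf => /(_ erefl).
  rewrite kin // !ltn_add2l => nb.
  have [e|ne] := eqVneq (diag_src f) (diag_src d); first by left; apply: dart_eq; rewrite ?gf.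
  right; apply: dart_eq; last by rewrite gf gb.
  apply/eqP; apply: contraNT nb => ne'.
  by rewrite !ltn_neqAle df fb eq_sym !val_eqE ne ne'.
have wN : w = ord_max.
  apply/eqP/negPn/negP => /(@out_exists n s) [z /andP[oz /eqP sz]].
  have := h z sz; have [_ kz] := key_out oz; lia.
have gN f : crosses w f -> diag_out f /\ dtgt f = w.
  case/and3P=> of_ _ wf; split=> //; apply: val_inj; apply: anti_leq; rewrite wf andbT wN.
  by rewrite -ltnS ltn_ord.
have hf f : crosses w f -> diag_src b <= diag_src f <= diag_src d.
  case/gN=> of_ gf; have := h (diag_twin f); rewrite src_diag_twin gf => /(_ erefl).
  by rewrite kin // !leq_add2l.
exists (rdart s); split; first exact: rdart_corner.
  apply: (bottom_ascends plane_s (cw d od erefl)) => f cf.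
  have [of_ gf] := gN f cf; rewrite ge_same_tgt ?gf //.
  by case/andP: (hf f cf).
apply: (top_descends plane_s (cw b oob gb)) => f cf.
have [of_ gf] := gN f cf; rewrite ge_same_tgt ?gf ?gb //.
by case/andP: (hf f cf).
Qed.

Lemma iter_dface_inj (i : nat) : injective (iter i dface).
Proof. by elim: i => [|i IH] x y //= /dface_inj /IH. Qed.

Lemma src_dface d : diag_src (dface d) = dtgt d.
Proof. exact: src_diag_turn. Qed.

Lemma face_turns_down c : exists i : nat, ~~ diag_out (iter i dface c).
Proof.
(* Each ascending step increases the abscissa, so [n.+2] of them in a row are impossible. *)
case: (pickP (fun i : 'I_n.+3 => ~~ diag_out (iter i dface c))) => [i|no]; first by exists i.
have h (i : nat) : i <= n.+2 -> i <= diag_src (iter i dface c).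
  elim: i => // i IH lt; have hi := IH (ltnW lt).
  rewrite iterS src_dface; apply: leq_ltn_trans hi _.
  have := no (Ordinal (ltnW lt : i < n.+3)); rewrite /= => /negbFE.
  by case/diag_out_lt.
by have := h n.+2 (leqnn _); rewrite leqNgt ltn_ord.
Qed.

(** From [c] the face goes up to its first top corner. The bottom corner attached to it must be [c],
    since no ascending dart precedes a bottom corner, and the descent returns to [c]. The face is
    one ascent and one descent, with no room for a second bottom corner. *)
Lemma source_corner_unique c c' : source_corner c -> source_corner c' ->
  fconnect dface c c' -> c = c'.
Proof.
move=> sc sc' cc'; have oc : diag_out c by case: sc => e [].
have oc' : diag_out c' by case: sc' => e [].
case: (ex_minnP (face_turns_down c)) => [[|i] oi imin]; first by rewrite /= oc in oi.
have up (k : nat) : k <= i -> diag_out (iter k dface c).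
  by move=> ki; apply/negPn/negP => /imin; rewrite ltnNge ki.
have [c0 [sc0 [i0 ei0 up0] [i' ei' dn]]] := sink_corner (up i (leqnn i)) oi.
have c0c : c0 = c.
  have [l|l|e] := ltngtP i0 i; last by move: ei0; rewrite e => /iter_dface_inj.
    case: (i - i0) (subnK (ltnW l)) (subn_gt0 i0 i) => [|m] em; first by rewrite l.
    move=> _; have h : dface (iter m dface c) = c0.
      by apply: (@iter_dface_inj i0); rewrite ei0 -iterS -iterD addnC em.
    by have := source_corner_pred sc0 h; rewrite up //; lia.
  case: (i0 - i) (subnK (ltnW l)) (subn_gt0 i i0) => [|m] em; first by rewrite l.
  move=> _; have h : dface (iter m dface c0) = c.
    by apply: (@iter_dface_inj i); rewrite -ei0 -iterS -iterD addnC em.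
  by have := source_corner_pred sc h; rewrite up0 //; lia.
(* [i.+1] ascending darts followed by [i'] descending ones. *)
have period : iter (i' + i.+1) dface c = c by rewrite iterD iterS ei' c0c.
have iter_mul (q : nat) : iter (q * (i' + i.+1)) dface c = c.
  by elim: q => // q IH; rewrite mulSn iterD IH.
have L0 : 0 < i' + i.+1 by rewrite addnS.
have ec' := iter_findex cc'; rewrite (divn_eq (findex dface c c') (i' + i.+1)) addnC iterD iter_mul in ec'.
have := ltn_pmod (findex dface c c') L0; move: (_ %% _) ec' => r er rL.
have [|ri] := leqP r i.
  case: r er rL => [|r] er rL ri //.
  by have := source_corner_pred sc' er; rewrite up // ltnW.
have := dn (r - i.+1); rewrite -iterS -iterD subnK // er oc' => h.
have : r - i.+1 < i' by rewrite ltn_subLR // addnC.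
by move/h.
Qed.

(** A dart with leftmost origin in its face must be outgoing, and the dart before it along the face
    ingoing. *)
Lemma face_low_corner d : exists2 c, fconnect dface d c & source_corner c.
Proof.
case: (@arg_minnP _ d (fconnect dface d) (fun z => val (diag_src z)) (connect0 _ d)).
move=> c dc cmin; exists c => //.
have oc : diag_out c.
  apply/negPn/negP => /diag_outN_lt[lt _].
  have := cmin (dface c); rewrite (connect_trans dc) ?fconnect1 // => /(_ isT).
  by rewrite src_dface; move: lt => /=; lia.
pose x := finv dface c; have ex : dface x = c by apply: f_finv dface_inj c.
have ox : ~~ diag_out x.
  apply/negP => /diag_out_lt[lt _]; have := cmin x.
  rewrite (connect_trans dc) ?fconnect_finv // => /(_ isT).
  rewrite -ex src_dface; move: lt => /=; lia.
by exists (diag_twin x); split=> //; rewrite out_twin_diag.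
Qed.

Definition source_corners := [set d : ddart | diag_out d && diag_out (finv (@diag_turn _ t) d)].

Lemma mem_source_corners d : d \in source_corners <-> source_corner d.
Proof.
rewrite inE; split=> [/andP[od oc]|[e [od oe ed]]].
  by exists (finv (@diag_turn _ t) d); split=> //; apply: f_finv diag_turn_inj d.
by rewrite od -ed (finv_f (@diag_turn_inj)) oe.
Qed.

Lemma fcard_dface : fcard dface ddart = #|source_corners|.
Proof.
apply: fcard_transversal dface_inj _ _ => [d|c c' /mem_source_corners sc /mem_source_corners sc'].
  by have [c dc sc] := face_low_corner d; exists c => //; apply/mem_source_corners.
exact: source_corner_unique.
Qed.

Definition turning := [set d : ddart | diag_out d && ~~ diag_out (finv (@diag_turn _ t) d)].

Lemma turning_min d : d \in turning -> forall z, diag_src z = diag_src d -> key d <= key z.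
Proof.
rewrite inE => /andP[od ic] z sz; set y := finv _ d in ic.
have yd : diag_turn y = d by apply: f_finv diag_turn_inj d.
have sy : diag_src y = diag_src d by rewrite -yd src_diag_turn.
have [[lt _]|h] := diag_turn_spec y.
  by move: lt; rewrite yd (key_in ic); have [_] := key_out od; lia.
by have := h z; rewrite yd sy => /(_ sz) /andP[].
Qed.

Lemma card_turning : #|turning| = n.
Proof.
have inj : {in turning &, injective (@diag_src _ t)}.
  move=> d e dt et se; apply: key_inj => //; apply: anti_leq.
  by rewrite (turning_min dt) ?(turning_min et).
rewrite -(card_in_imset inj).
have -> : (@diag_src _ t) @: turning = ~: [set ord0; ord_max].
  apply/setP => v; rewrite !inE negb_or; apply/imsetP/andP => [[d + ->]|[v0 vN]].
    rewrite inE => /andP[od ic]; split.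
      apply: contra ic => /eqP sd; apply: south_out; rewrite -sd -[in RHS](f_finv diag_turn_inj d).
      by rewrite src_diag_turn.
    by apply: contraL od => /eqP /north_in.
  have [x /andP[ox /eqP sx]] := @out_exists n s v vN.
  have [y /andP[oy /eqP gy]] := @in_exists n s v v0.
  have xy : fconnect (@diag_turn _ t) x (diag_twin y).
    by rewrite diag_turn_fconnect sx src_diag_twin gy.
  have [|z xz /andP[oz iz]] := @rise_exists _ _ (@diag_out _ t) diag_turn_inj _ _ xy ox.
    by rewrite out_twin_diag oy.
  exists z; first by rewrite inE oz.
  by move: xz; rewrite diag_turn_fconnect sx => /eqP.
rewrite cardsCs setCK card_ord cards2.
have -> : (ord0 : 'I_n.+2) != ord_max by [].
by lia.
Qed.

(** Outgoing darts are counted by the corner before them: [n] corners are changes of orientation and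
    the others are one for each face. So [E = F + n], with [n + 2] vertices. *)
Lemma Phi_euler : euler_planar M.
Proof.
rewrite /euler_planar.
rewrite (@card_half M diag_twinK (@diag_out _ t)); last exact: out_twin_diag.
rewrite [fcard _ _]fcard_dface /= card_ord.
have <- : #|source_corners| + #|turning| = #|@diag_out _ t|.
  rewrite -(cardID (mem source_corners) (@diag_out _ t)).
  congr (_ + _); apply: eq_card => d; rewrite !inE -!topredE /= ?inE;
    by case: (diag_out d); rewrite ?andbT ?andbF.
by rewrite card_turning addnC -addnA addn2.
Qed.

(** The lowest edge into the north pole is the lowest one on the last line, so an ascent from the
    root dart along the outer face reaches it. *)
Lemma Phi_outer_sink : on_outer_face (M := M) ord_max.
Proof.
have [d [od gd hd]] := @in_rightmost n s ord_max isT.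
have cd : crosses n.+1 d.
  by rewrite /crosses od gd leqnn andbT; have [] := diag_out_lt od; rewrite gd.
have [i ei _] : ascends (rdart s) d.
  apply: (bottom_ascends plane_s cd) => f /and3P[of_ _ jf].
  have gf : dtgt f = ord_max by apply: val_inj; apply: anti_leq; rewrite jf -ltnS ltn_ord.
  by rewrite ge_same_tgt ?gf ?gd // hd.
exists (dface d); last by rewrite [src _]src_dface gd.
by rewrite -ei -iterS; apply: fconnect_iter.
Qed.

Lemma Phi_poset : plane_bipolar_poset M n.
Proof.
split; first split; first split.
- exact: Phi_connected.
- exact: Phi_euler.
- exact: out_twin_diag.
- exact: Phi_acyclic.
- split; first exact: Phi_source.
  by exists ord_max; split; [exact: Phi_sink|exact: Phi_outer_sink].
- exact: Phi_no_transitive.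
exact: card_ord.
Qed.

End DiagramMap.

(** * Both mappings are inverse to each other *)

Lemma orbit_map (T T' : finType) (f : T -> T) (f' : T' -> T') (h : T -> T') x :
  injective h -> (forall y, f' (h y) = h (f y)) ->
  fingraph.orbit f' (h x) = map h (fingraph.orbit f x).
Proof.
move=> inj_h hf; have it k y : iter k f' (h y) = h (iter k f y).
  by elim: k => //= k ->.
have -> : fingraph.orbit f' (h x) = map h (traject f x (fingraph.order f' (h x))).
  rewrite /fingraph.orbit; move: (fingraph.order f' (h x)) => k; elim: k x => //= k IH x.
  by rewrite hf IH.
congr (map h (traject f x _)); rewrite /fingraph.order -(card_image inj_h).
apply: eq_card => y; rewrite inE; apply/idP/imageP => [hy|[z + ->]].
  by exists (iter (findex f' (h x) y) f x); rewrite ?inE ?fconnect_iter // -it iter_findex.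
by rewrite inE => xz; rewrite -(iter_findex xz) -it fconnect_iter.
Qed.

Section IsoInvariance.
Variables (n : nat) (M M' : rooted_map).
Hypotheses (HM : plane_bipolar_poset M n) (HM' : plane_bipolar_poset M' n).
Variables (fv : vertex M -> vertex M') (fd : dart M -> dart M').
Hypotheses (fv_bij : bijective fv) (fd_bij : bijective fd).
Hypothesis fd_root : fd (root_dart M) = root_dart M'.
Hypothesis fd_src : forall d, src (fd d) = fv (src d).
Hypothesis fd_twin : forall d, twin (fd d) = fd (twin d).
Hypothesis fd_turn : forall d, turn (fd d) = fd (turn d).
Hypothesis fd_out : forall d, out (fd d) = out d.

Lemma iso_cw d : finv (@turn M') (fd d) = fd (finv (@turn M) d).
Proof.
apply: (turn_inj HM'); rewrite (f_finv (turn_inj HM')) fd_turn.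
by rewrite (f_finv (turn_inj HM)).
Qed.

Lemma iso_source v : source (fv v) = source v.
Proof.
have [gd gdK fdK] := fd_bij; apply/forallP/forallP => h d.
  by have := h (fd d); rewrite fd_src fd_out (inj_eq (bij_inj fv_bij)).
by rewrite -(fdK d) fd_src fd_out (inj_eq (bij_inj fv_bij)).
Qed.
Lemma iso_sink v : sink (fv v) = sink v.
Proof.
have [gd gdK fdK] := fd_bij; apply/forallP/forallP => h d.
  by have := h (fd d); rewrite fd_src fd_out (inj_eq (bij_inj fv_bij)).
by rewrite -(fdK d) fd_src fd_out (inj_eq (bij_inj fv_bij)).
Qed.
Lemma iso_inner v : inner (fv v) = inner v.
Proof. by rewrite /inner iso_source iso_sink. Qed.

Lemma iso_cw_step d : cw_step (@right_tree M') (fd d) = fd (cw_step (@right_tree M) d).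
Proof.
rewrite /cw_step iso_cw /right_tree /rightmost_in !fd_twin !fd_src !iso_inner !fd_turn !fd_out.
by case: ifP.
Qed.
Lemma iso_ccw_step d : ccw_step (@left_tree M') (fd d) = fd (ccw_step (@left_tree M) d).
Proof.
rewrite /ccw_step /left_tree /leftmost_in !fd_twin !fd_src !iso_inner !iso_cw !fd_out !fd_turn.
by case: ifP.
Qed.

Lemma iso_visit_rank st st' v : (forall d, st' (fd d) = fd (st d)) ->
  visit_rank st' (fv v) = visit_rank st v.
Proof.
move=> h; have tour : tour_vertices st' = map fv (tour_vertices st).
  rewrite /tour_vertices -fd_root (orbit_map _ (bij_inj fd_bij) h) -!map_comp.
  by apply: eq_map => d /=.
rewrite /visit_rank tour -(card_imset _ (bij_inj fv_bij)); apply: eq_card => w.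
have [gv gvK fvK] := fv_bij; rewrite -(fvK w) (mem_imset _ _ (bij_inj fv_bij)) !inE.
by rewrite iso_inner !index_map //; apply: bij_inj fv_bij.
Qed.

Lemma iso_Psi : Psi n M = Psi n M'.
Proof.
suff e : perm_eq [seq (xcoord v, ycoord v) | v in @inner M]
                [seq (xcoord v, ycoord v) | v in @inner M'].
  by rewrite /Psi; apply: eq_pick => s; rewrite (permPr e).
have -> : [seq (xcoord v, ycoord v) | v in @inner M] =
    [seq (xcoord w, ycoord w) | w <- [seq fv v | v in @inner M]].
  rewrite -map_comp; apply: eq_map => v /=.
  by rewrite /xcoord /ycoord !(iso_visit_rank _ iso_cw_step) !(iso_visit_rank _ iso_ccw_step).
apply: perm_map; apply: uniq_perm.
- by rewrite map_inj_uniq ?enum_uniq //; apply: bij_inj fv_bij.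
- exact: enum_uniq.
have [gv gvK fvK] := fv_bij; move=> w; rewrite -(fvK w) mem_enum.
rewrite mem_map ?mem_enum; last exact: bij_inj fv_bij.
by rewrite -!topredE /= iso_inner.
Qed.
End IsoInvariance.

Lemma Psi_iso n M M' : plane_bipolar_poset M n -> plane_bipolar_poset M' n ->
  map_iso M M' -> Psi n M = Psi n M'.
Proof.
move=> HM HM' [fv [fd [[bv bd r] [fs ft fT fo]]]].
exact: (iso_Psi HM HM' bv bd r fs ft fT fo).
Qed.

(** * Recovering the permutation from its diagram *)

Lemma mono_ord_id m (p : 'I_m -> 'I_m) :
  (forall u v : 'I_m, u < v -> p u < p v) -> forall u, p u = u.
Proof.
move=> mono u; apply: val_inj; apply: anti_leq; apply/andP; split; last first.
  case: u => k; elim: k => // k IH lt; have lt' := ltnW lt.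
  by apply: leq_ltn_trans (IH lt') _; apply: mono.
have [k] := ubnP (m - u); elim: k u => // k IH u lt.
have [ul|ul] := ltnP u.+1 m; last first.
  by rewrite -ltnS (leq_trans (ltn_ord (p u))).
have h := IH (Ordinal ul) _; have := mono u (Ordinal ul) (ltnSn _).
by move: h; rewrite /= => h1 h2; have := h1 _; rewrite -ltnS; lia.
Qed.

(** [t'] composed with the inverse of [t] is increasing: for [t u < t v], what passes to [t'] is
    that [u] is dominated by [v] if [u < v], and that [v] is not dominated by [u] if [v < u]. *)
Lemma perm_of_dominance m (t t' : 'S_m) :
  (forall u v, dominated t u v = dominated t' u v) -> t = t'.
Proof.
move=> h; have mono : forall i j : 'I_m, i < j -> t' ((t^-1)%g i) < t' ((t^-1)%g j).
  move=> i j; have [u <-] : exists u, t u = i by exists ((t^-1)%g i); rewrite permKV.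
  have [v <-] : exists v, t v = j by exists ((t^-1)%g j); rewrite permKV.
  rewrite !permK => uv; rewrite ltn_neqAle; apply/andP; split.
    by apply: contraTneq uv => /val_inj/perm_inj ->; rewrite ltnn.
  have := h u v; have := h v u; rewrite /dominated.
  have [l|l|e] := ltngtP u v; last by rewrite (val_inj e) ltnn in uv.
    by rewrite /= (ltnW uv) => _ <-.
  by rewrite /= leqNgt uv /= => /esym/negbT; rewrite -ltnNge => /ltnW.
apply/permP => u; have := mono_ord_id mono (t u).
by rewrite permK.
Qed.

Lemma completion_inj n : injective (@completion n).
Proof.
move=> s s' e; apply/permP => i; apply: val_inj.
by apply: succn_inj; rewrite -!completion_val e.
Qed.

Section RoundTrip.
Variables (n : nat) (s : 'S_n).
Notation t := (completion s).
Notation M := (Phi s).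
Implicit Types (u v w : 'I_n.+2).

Lemma ge_trans : transitive (@ge n s).
Proof.
by move=> y x z /andP[a b] /andP[c d]; rewrite /ge (leq_trans c a) (leq_trans d b).
Qed.

Hypothesis plane_s : plane_perm s.
Let HM := Phi_poset plane_s.

Lemma southE : south M = ord0.
Proof. by have [sr _] := rdart_spec s. Qed.
Lemma northE : north M = ord_max.
Proof. by have [h _] := north_props HM; apply/esym/h/(Phi_sink s). Qed.

(** Keys increase along [turn] except where it wraps around, which cannot occur after an outgoing
    dart if there is an ingoing one, whose key is larger. At the south pole, the choice of the root
    fixes where the list starts. *)
Lemma sorted_rouT_Phi v : sorted ltn [seq key d | d <- rouT (v : vertex M)].
Proof.
have [v0|v0] := eqVneq (v : vertex M) (south M).
  rewrite v0 (rouTS HM) /rotation (lmS HM).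
  have [l e] : exists l, darts_at t ord0 = rdart s :: l.
    have : rdart s \in darts_at t ord0.
      by rewrite mem_darts_at; have [-> _] := rdart_spec s.
    by rewrite /rdart /Phi /=; case: (darts_at t ord0) => // d l _; exists l.
  have rin : rdart s \in darts_at t ord0 by rewrite e mem_head.
  have := fingraph.orbitE (cycle_darts_at s ord0) (uniq_darts_at s ord0) rin.
  rewrite [X in rot (index _ X)]e /= eqxx rot0 => ee.
  by rewrite [X in map _ X]ee; apply: darts_at_sorted.
have [v1|v1] := eqVneq (v : vertex M) (north M); first by rewrite v1 (rouTN HM).
have [x [q [ex _]]] := ins_nil HM v0.
have so : sorted (frel (@turn M)) (rouT (v : vertex M)).
  have [y [r ey]] := rouT_nil HM v1.
  have := cycle_rotation HM v; rewrite (rotationE HM) ex ey /=.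
  by rewrite rcons_cat cat_path /= rcons_path => /and3P[_ _ /andP[]].
rewrite sorted_map; apply: (@sub_in_sorted _ [in rouT (v : vertex M)] (frel (@turn M))) so.
- move=> d e; rewrite !(mem_rouT HM) => /andP[od /eqP sd] /andP[oe _] /eqP de.
  have [[lt _]|h] := diag_turn_spec (d : diag_dart t).
    by rewrite /= -de.
  have xin : x \in ins (v : vertex M) by rewrite ex mem_head.
  move: xin; rewrite (mem_ins HM) => /andP[ox /eqP sx].
  have := h x; rewrite [diag_src x]sx [diag_src d]sd => /(_ erefl) /andP[_].
  rewrite (key_in (ox : ~~ diag_out (x : diag_dart t))).
  by have [_] := key_out (od : diag_out (d : diag_dart t)); lia.
exact: allss.
Qed.

Lemma pairwise_outs v : pairwise (@ge n s) (outs (v : vertex M)).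
Proof.
rewrite -(sorted_pairwise ge_trans) /outs rev_sorted.
have := sorted_rouT_Phi v; rewrite sorted_map.
apply: (@sub_in_sorted _ [in rouT (v : vertex M)]); last exact: allss.
move=> d e; rewrite !(mem_rouT HM) => /andP[od /eqP sd] /andP[oe /eqP se] /= lt.
rewrite ge_same_src //; last by rewrite [diag_src e]se [diag_src d]sd.
have [kd _] := key_out (od : diag_out (d : diag_dart t)).
have [ke _] := key_out (oe : diag_out (e : diag_dart t)).
by move: lt; rewrite kd ke; have := ltn_ord (dtgt (d : diag_dart t)); lia.
Qed.

Definition column (j : nat) : {set vertex M} := [set i : 'I_n.+2 | i < j].

Lemma column_down (j : nat) : 0 < j -> j <= n.+1 -> down (column j).
Proof.
move=> j0 jn; split; rewrite ?inE.
- by rewrite southE.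
- by rewrite northE /= -leqNgt.
move=> d od; rewrite !inE => h; apply: ltn_trans h.
by have [] := diag_out_lt (od : diag_out (d : diag_dart t)).
Qed.

Lemma column_avail v : 0 < v -> v <= n -> avail (column v) (v : vertex M).
Proof.
move=> v0 vn; split; rewrite ?inE ?ltnn //.
  by rewrite northE -val_eqE /= neq_ltn ltnS vn.
move=> d od td; rewrite inE -td.
by have [] := diag_out_lt (od : diag_out (d : diag_dart t)).
Qed.

Lemma column_step v : column v.+1 = (v : vertex M) |: column v.
Proof. by apply/setP => i; rewrite !inE ltnS leq_eqVlt. Qed.

Lemma cut_crosses (j : nat) d : cut (column j) d -> crosses j (d : diag_dart t).
Proof.
case/and3P=> od; rewrite !inE -leqNgt => sj jt.
by rewrite /crosses [diag_out _]od sj.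
Qed.

(** The outgoing fan of [v] takes the place of the ingoing one. An edge of [A] is higher than an
    edge entering [v] and does not end at [v], so by [gap] it passes above [v], hence above the
    outgoing fan; an edge of [B] cannot be above that fan, as its head is not above [v]. *)
Lemma column_cut (j : nat) : 0 < j -> j <= n.+1 ->
  exists2 l : seq (dart M), is_cut (column j) l & pairwise (@ge n s) l.
Proof.
elim: j => // -[|j] IH _ jn.
  have -> : column 1 = [set south M].
    by apply/setP => i; rewrite !inE southE ltnS leqn0.
  by exists (outs (south M)); [exact: is_cut_south HM | exact: pairwise_outs].
have [l cl pl] := IH isT (ltnW jn).
pose v : 'I_n.+2 := Ordinal (ltnW jn : j.+1 < n.+2).
have av : avail (column v) (v : vertex M) by apply: column_avail.
have dv : down (column v) by apply: column_down => //; apply: ltnW.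
have [A [B [el cl']]] := cut_step HM dv cl av.
rewrite -column_step in cl'; exists (A ++ outs (v : vertex M) ++ B); first exact: cl'.
have vi := avail_inner HM dv av.
have [e [ein oe te]] : exists e, [/\ e \in es (v : vertex M), diag_out (e : diag_dart t) & dtgt (e : diag_dart t) = v].
  exists (rpar (v : vertex M)); have := rpar_in HM vi => h; split=> //.
    by move: h; rewrite (mem_es HM) => /andP[].
  by move: h; rewrite (mem_es HM) => /andP[_ /eqP].
move: pl; rewrite el !pairwise_cat allrel_catr.
case/and3P=> /andP[Aes AB] pA /and3P[esB _ pB].
have crA f : f \in A -> crosses v.+1 (f : diag_dart t) /\ crosses v f /\ dtgt f != v.
  move=> fA; have fl : f \in l by rewrite el mem_cat fA.
  have fl' : f \in A ++ outs (v : vertex M) ++ B by rewrite mem_cat fA.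
  have c : crosses v (f : diag_dart t) by apply: cut_crosses; rewrite -[cut _ _](cut_memX cl).
  have c' : crosses v.+1 (f : diag_dart t).
    by apply: cut_crosses; rewrite -[cut _ _](cut_memX cl').
  by split=> //; split=> //; apply: contraTneq c' => h; rewrite /crosses h ltnn !andbF.
have crB f : f \in B -> crosses v.+1 (f : diag_dart t) /\ crosses v f /\ dtgt f != v.
  move=> fB; have fl : f \in l by rewrite el !mem_cat fB !orbT.
  have fl' : f \in A ++ outs (v : vertex M) ++ B by rewrite !mem_cat fB !orbT.
  have c : crosses v (f : diag_dart t) by apply: cut_crosses; rewrite -[cut _ _](cut_memX cl).
  have c' : crosses v.+1 (f : diag_dart t).
    by apply: cut_crosses; rewrite -[cut _ _](cut_memX cl').
  by split=> //; split=> //; apply: contraTneq c' => h; rewrite /crosses h ltnn !andbF.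
have cro h : h \in outs (v : vertex M) -> crosses v.+1 (h : diag_dart t) /\ diag_src h = v.
  move=> ho; have fl' : h \in A ++ outs (v : vertex M) ++ B by rewrite !mem_cat ho orbT.
  split; first by apply: cut_crosses; rewrite -[cut _ _](cut_memX cl').
  by move: ho; rewrite (mem_outs HM) => /andP[_ /eqP].
have gp (f : diag_dart t) : crosses v.+1 f -> crosses v f ->
    t v < t (diag_src f) \/ t (dtgt f) < t v.
  case/crosses_lt=> of_ _ vf _ /crosses_lt[_ fv _ _].
  by apply: gap of_ _; rewrite fv.
rewrite ?pairwise_cat ?allrel_catr AB pA pB pairwise_outs !andbT /=; apply/andP; split.
  apply/allrelP => f h fA /cro[ch sh]; have [c' [c _]] := crA f fA.
  have /orP[//|/andP[a _]] := ge_total plane_s c' ch; rewrite sh in a.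
  have /andP[_ b] := allrelP Aes f e fA ein; rewrite te in b.
  by have [h'|h'] := gp f c' c; move: a b h'; clear; lia.
apply/allrelP => h f /cro[ch sh] fB; have [c' [c _]] := crB f fB.
have /orP[//|/andP[a _]] := ge_total plane_s ch c'; rewrite sh in a.
have /andP[_ b] := allrelP esB e f ein fB; rewrite te in b.
have [_ _ _ lt] := crosses_lt c.
by move: a b lt; clear; lia.
Qed.

(** After [twin (rpar q)], [turn] meets an outgoing dart, whose key is smaller: the order wraps
    around there, so the key of [twin (rpar q)] is the largest one. *)
Lemma rpar_max (q : vertex M) : inner q -> forall z : diag_dart t,
  diag_out z -> dtgt z = q -> diag_src z <= diag_src (rpar q : diag_dart t).
Proof.
move=> qi z oz gz; have := rpar_in HM qi; rewrite (mem_es HM) => /andP[or_ /eqP gr].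
have sy : src (twin (rpar q)) = q by exact: gr.
have iy : ~~ out (twin (rpar q)) by rewrite (out_twin HM) or_.
have ot := out_turn_rpar HM qi sy iy; rewrite eqxx in ot.
have kin (e : diag_dart t) : diag_out e -> key (diag_twin e) = n.+2 + diag_src e.
  by move=> oe; rewrite key_in ?out_twin_diag ?oe.
have ky : key (twin (rpar q) : diag_dart t) = n.+2 + diag_src (rpar q : diag_dart t) := kin _ or_.
have [[lt _]|h] := diag_turn_spec (twin (rpar q) : diag_dart t).
  have [_ k] := key_out (ot : diag_out (diag_turn (twin (rpar q) : diag_dart t))).
  by move: lt k; rewrite ky; clear; lia.
have := h (diag_twin z); rewrite [diag_src (diag_twin z)]gz [diag_src _]sy => /(_ erefl) /andP[_].
by rewrite ky kin // leq_add2l.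
Qed.

Lemma le_PhiE u v : le (u : vertex M) (v : vertex M) = dominated t u v.
Proof. exact: le_dominated. Qed.

(* Cuts at consecutive columns are sorted by height, so that the next vertex to
   the right is always the one a leftmost sweep would take. *)
Lemma not_left_of u v : u < v -> t v < t u -> ~ left_of (v : vertex M) (u : vertex M).
Proof.
move=> uv tvu left.
have nuv : ~~ le (u : vertex M) (v : vertex M).
  by rewrite le_PhiE /dominated (leqNgt (t u)) tvu andbF.
have nvu : ~~ le (v : vertex M) (u : vertex M) by rewrite le_PhiE /dominated leqNgt uv.
have ui := incomparable_inner HM nuv nvu; have vi := incomparable_inner HM nvu nuv.
have u0 : 0 < u.
  have := inner_neqS HM ui; rewrite southE -val_eqE /=; by rewrite lt0n.
have un : u <= n by rewrite -ltnS (leq_trans uv) // -ltnS ltn_ord.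
have [l cl pl] := column_cut u0 (leqW un).
have dU := column_down u0 (leqW un).
have [A [B [el _]]] := cut_step HM dU cl (column_avail u0 un).
have ru := rpar_in HM ui; have rl : rpar (u : vertex M) \in l by rewrite el !mem_cat ru orbT.
have tu : tgt (rpar (u : vertex M)) = u by move: ru; rewrite (mem_es HM) => /andP[_ /eqP].
(* An earlier edge [f] is higher on the line, so its head [q] dominates [u]. Some edge into [q] then
   starts at [u] or at a point dominating it, further right than [src f], so [f] is not the
   rightmost edge into [q]. *)
have np : no_par_before (@rpar M) l (rpar (u : vertex M)).
  move=> f b; apply/negP => /and3P[of_ qi /eqP ef]; set q := tgt f in qi ef.
  have [fl _] := before_mem b.
  have g : t u <= t q.
    have := subseq_pairwise b pl; rewrite pairwise2 => /andP[_].
    by rewrite [dtgt (rpar (u : vertex M) : diag_dart t)]tu.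
  have cf : crosses u (f : diag_dart t) by apply: cut_crosses; rewrite -[cut _ _](cut_memX cl).
  have [_ sf uq _] := crosses_lt cf.
  have duq : dominated t u q by rewrite /dominated uq g.
  have nq : u != q.
    apply: contraTneq (before_neq (cut_uniqX cl) b) => e; rewrite negbK ef.
    by apply/eqP; congr rpar.
  have [k ck uk] := dom_last duq nq; have [z [oz sz gz]] := dart_of_cov ck.
  have := rpar_max qi oz gz; rewrite -ef sz => ks.
  by have /andP[h _] := uk; move: ks h sf; clear; lia.
have dU' := not_above_down HM vi ui.
have sub : column u \subset not_above (v : vertex M) (u : vertex M).
  apply/subsetP => w; rewrite !inE !le_PhiE /dominated => wu.
  by rewrite (leqNgt v w) (leqNgt u w) (ltn_trans wu uv) wu.
have [l' cl' b'] := left.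
(* That no parent edge precedes [rpar u] persists up to the cut of [not_above v u], where [left]
   puts [rpar v] before it. *)
have := cut_no_par_mono HM dU dU' sub cl cl' rl _ np.
rewrite tu inE le_refl andbF => /(_ isT _ b'); rewrite /par.
have := rpar_in HM vi; rewrite (mem_es HM) => /andP[-> /eqP ->].
by rewrite vi eqxx.
Qed.

Lemma px_mono u v : u < v -> px n (u : vertex M) < px n (v : vertex M).
Proof.
move=> uv; have [tuv|tvu] := leqP (t u) (t v).
  have uv' : le (u : vertex M) (v : vertex M) by rewrite le_PhiE /dominated (ltnW uv).
  have nuv : (u : vertex M) != v by apply: contraTneq uv => ->; rewrite ltnn.
  by have [] := coord_le HM uv' nuv.
have [e|l _ _|l _ _|//|_ _ h _ _] := vertex_compareP HM (u : vertex M) (v : vertex M).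
- by rewrite e ltnn in uv.
- by move: l; rewrite le_PhiE /dominated (leqNgt (t u)) tvu andbF.
- by move: l; rewrite le_PhiE /dominated leqNgt uv.
by case: (not_left_of uv tvu).
Qed.

(** Only abscissae have to be compared: [posx] is increasing, hence the identity, and dominance then
    determines the ordinates. *)
Lemma Psi_Phi : Psi n M = Some s.
Proof.
have [s' sE] := perm_of_map HM.
have px_id (u : vertex M) : posx HM u = u.
  by apply: (mono_ord_id (p := fun u : 'I_n.+2 => posx HM (u : vertex M))) => a b; apply: px_mono.
rewrite (Psi_of_map sE); congr Some; apply: completion_inj.
apply: perm_of_dominance => u v.
rewrite -{1}(px_id u) -{1}(px_id v) (dominatedE sE).
exact: le_dominated.
Qed.

End RoundTrip.

Theorem proposition5p3 (n : nat) :
  (* Phi is a bijection from plane permutations of size n to plane bipolar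
     posets with n + 2 vertices, the latter up to isomorphism *)
  [/\ forall s : 'S_n, plane_perm s -> plane_bipolar_poset (Phi s) n,
      forall s s' : 'S_n, plane_perm s -> plane_perm s' ->
        map_iso (Phi s) (Phi s') -> s = s'
    & forall M : rooted_map, plane_bipolar_poset M n ->
        exists2 s : 'S_n, plane_perm s & map_iso (Phi s) M] /\
  (* Psi is well defined, with values in plane permutations, and is the inverse
     of Phi *)
  [/\ forall M M' : rooted_map, plane_bipolar_poset M n -> plane_bipolar_poset M' n ->
        map_iso M M' -> Psi n M = Psi n M',
      forall s : 'S_n, plane_perm s -> Psi n (Phi s) = Some s
    & forall M : rooted_map, plane_bipolar_poset M n ->
        exists s : 'S_n,
          [/\ plane_perm s, Psi n M = Some s & map_iso (Phi s) M]].
Proof.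
split; split.
- exact: Phi_poset.
- move=> s s' ps ps' iso; have := Psi_iso (Phi_poset ps) (Phi_poset ps') iso.
  by rewrite !Psi_Phi // => -[].
- by move=> M /poset_to_perm[s [ps _ iso]]; exists s.
- exact: Psi_iso.
- exact: Psi_Phi.
exact: poset_to_perm.
Qed.
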